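(* Let $\lambda\in\mathbb{C}$ with $\operatorname{Im}\lambda^2>0$ and let $q\in L^2(\mathbb{R})$. Then $$b_4(\lambda)=\frac{i}{2\pi}\int_{\xi_1+\xi_2=\eta_1+\eta_2}\frac{\lambda^4}{(2\lambda^2+\xi_1)(2\lambda^2+\eta_1)(2\lambda^2+\eta_2)}\operatorname{Re}\big(\hat q(\eta_1)\hat q(\eta_2)\hat q^*(\xi_1)\hat q^*(\xi_2)\big)\,d\xi_1d\eta_1d\eta_2 .$$ Suppose moreover that $q$ is a Schwartz function. Then, as $\lambda\to\infty$, one has the asymptotic series $$b_4(\lambda)\sim i\sum_{j=2}^{\infty}H_{j4}\,\frac{\lambda^{2-2j}}{2^{j+1}},$$ where $$H_{j4}=-\operatorname{Re}\Big(i^j\sum_{\alpha_1+\alpha_2+\alpha_3=j-2}(-1)^{\alpha_1}\int_{\mathbb{R}} q^{(\alpha_2)}q^{(\alpha_3)}\,\overline{q^{(\alpha_1)}q}\,dx\Big).$$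
   Context: $\hat q(\xi)=\frac1{\sqrt{2\pi}}\int_{\mathbb{R}}q(x)e^{-ix\xi}dx$; the star and the bar denote complex conjugation, $\hat q^*(\xi)=\overline{\hat q(\xi)}$; $q^{(\alpha)}$ is the $\alpha$-th derivative; the $\alpha_i$ are nonnegative integers. In the first formula, $\xi_2=\eta_1+\eta_2-\xi_1$ and integration is over $(\xi_1,\eta_1,\eta_2)\in\mathbb{R}^3$. $b_4$ is the component of degree $4$ in $(q,q^* )$ of $\ln s_{11}(\lambda)$, where $s_{11}(\lambda)$ is the reciprocal of the transmission coefficient of the derivative nonlinear Schrödinger (Kaup–Newell) spectral problem, i.e. $$b_4(\lambda)=s_4(\lambda)-\tfrac12s_2(\lambda)^2=-2\lambda^4\int_{x_1<x_2<y_1<y_2}q(y_1)q^*(x_1)q(y_2)q^*(x_2)e^{2i\lambda^2(y_1+y_2-x_1-x_2)}\,dx_1dy_1dx_2dy_2,$$ with $s_{2j}(\lambda)=(-1)^{j}\lambda^{2j}\int_{x_1<y_1<\cdots<x_j<y_j}\prod_{k=1}^{j}q(y_k)q^*(x_k)e^{2i\lambda^2(y_k-x_k)}dx_1dy_1\cdots dx_jdy_j$. *)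

(* Defs.v *)
From HB Require Import structures.
From mathcomp Require Import all_boot all_order all_algebra.
From mathcomp Require Import all_classical all_reals all_analysis.
From mathcomp Require complex.

Set Implicit Arguments.
Unset Strict Implicit.
Unset Printing Implicit Defensive.

Import Order.TTheory GRing.Theory Num.Theory.
Import numFieldNormedType.Exports.
Import complex ComplexField.Normc.

Local Open Scope classical_set_scope.
Local Open Scope ring_scope.
Local Open Scope complex_scope.

(* The library's integral is for (extended) real functions only; complex
   functions are integrated componentwise. *)
Definition cintegral d (T : measurableType d) (R : realType)
    (mu : {measure set T -> \bar R}) (D : set T) (f : T -> R[i]) : R[i] :=
  (\int[mu]_(x in D) Re (f x)) +i* (\int[mu]_(x in D) Im (f x)).

Definition cexp (R : realType) (z : R[i]) : R[i] :=
  (expR (Re z))%:C * (cos (Im z) +i* sin (Im z)).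

Section Transform.
Variable R : realType.
Implicit Types (q g : R -> R[i]) (lambda : R[i]).

Local Notation mu := (@lebesgue_measure R).

Definition L2 q : Prop :=
  ((fun x => Re (q x)) \in Lfun mu 2%:E) /\
  ((fun x => Im (q x)) \in Lfun mu 2%:E).

Definition truncated_fourier q (n : nat) (xi : R) : R[i] :=
  ((Num.sqrt (2 * pi))^-1)%:C *
  cintegral mu `[- n%:R, n%:R] (fun x => q x * cexp (- 'i%C * (x * xi)%:C)).

Definition is_fourier q g : Prop :=
  L2 g /\
  (\int[mu]_(xi in setT) ((normc (g xi - truncated_fourier q n xi)) ^+ 2)%:E)%E
    @[n --> \oo] --> (0 : \bar R)%E.

(* For [q] in [L^2] the integral defining the Fourier transform need not
   converge: the transform is the limit in [L^2] of the transforms of the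
   truncations of [q] (Plancherel), which is unique almost everywhere; a
   representative is chosen. *)
Definition fourier q : R -> R[i] := xget (fun=> 0) [set g | is_fourier q g].

Definition s2 q lambda : R[i] :=
  - (lambda ^+ 2) *
  cintegral (mu \x mu)%E [set p | p.1 < p.2]
    (fun '(x1, y1) => q y1 * conjc (q x1) *
       cexp (2 * 'i%C * lambda ^+ 2 * (y1 - x1)%:C)).

Definition s4 q lambda : R[i] :=
  lambda ^+ 4 *
  cintegral (mu \x mu \x mu \x mu)%E
    [set p : R * R * R * R | let: (x1, y1, x2, y2) := p in
       [/\ x1 < y1, y1 < x2 & x2 < y2]]
    (fun '(x1, y1, x2, y2) =>
       (q y1 * conjc (q x1) * cexp (2 * 'i%C * lambda ^+ 2 * (y1 - x1)%:C)) *
       (q y2 * conjc (q x2) * cexp (2 * 'i%C * lambda ^+ 2 * (y2 - x2)%:C))).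

(* The degree 4 part of [ln (1 + s2 + s4 + ...)]. *)
Definition b4 q lambda : R[i] := s4 q lambda - 2^-1 * s2 q lambda ^+ 2.

Definition cderiven (n : nat) q (x : R) : R[i] :=
  (derive1n n (fun y => Re (q y)) x) +i* (derive1n n (fun y => Im (q y)) x).

Definition smooth (f : R -> R) : Prop :=
  forall (n : nat) (x : R), derivable (derive1n n f) x 1.

Definition schwartz q : Prop :=
  [/\ smooth (fun x => Re (q x)), smooth (fun x => Im (q x)) &
    forall m n : nat, exists M : R, forall x : R,
      `|x| ^+ m * normc (cderiven n q x) <= M].

Definition H4 q (j : nat) : R :=
  - Re ('i%C ^+ j *
    \sum_(a1 < j.-1) \sum_(a2 < j.-1)
      \sum_(a3 < j.-1 | (a1 + a2 + a3 == j - 2)%N)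
      (-1) ^+ a1 *
      cintegral mu setT (fun x =>
        cderiven a2 q x * cderiven a3 q x * conjc (cderiven a1 q x * q x))).

(* [f ~ \sum_(m <= j) a j * phi j] in the sense of Poincare, as [z] tends to
   infinity in [D]: for every [n], the error of the partial sum up to [n] is
   [o(phi n)], uniformly in the argument of [z]. *)
Definition asymptotic_series (D : set R[i]) (f : R[i] -> R[i]) (m : nat)
    (a : nat -> R[i]) (phi : nat -> R[i] -> R[i]) : Prop :=
  forall n : nat, (m <= n)%N -> forall e : R, 0 < e ->
    exists M : R, forall z : R[i], D z -> M < normc z ->
      normc (f z - \sum_(m <= j < n.+1) a j * phi j z) <= e * normc (phi n z).

End Transform.

(* Main.v *)
Require Import Defs.
From HB Require Import structures.
From mathcomp Require Import all_boot all_order all_algebra.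
From mathcomp Require Import all_classical all_reals all_analysis.
From mathcomp Require complex.
From mathcomp Require Import ring lra measurable_realfun.

Set Implicit Arguments.
Unset Strict Implicit.
Unset Printing Implicit Defensive.

Import Order.TTheory GRing.Theory Num.Theory.
Import numFieldNormedType.Exports.
Import complex ComplexField.Normc.

Local Open Scope classical_set_scope.
Local Open Scope ring_scope.
Local Open Scope complex_scope.

(* With z = lambda^2, put f(x) = \int_{y > x} q(y) e^{2iz(y-x)} dy and
   g(y) = \int_{x < y} q*(x) e^{2iz(y-x)} dx. Decomposing s_2^2 and s_4 according
   to the relative position of the pairs gives the two formulas
     b_4 = - lambda^4 \int q g (f g) = - lambda^4 \int (q* f) (f g),
   whose average is symmetric under conjugation of the four factors. By Parseval
   f and g are the inverse transforms of i q^(xi) / (2z + xi) and of its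
   counterpart for q*, and expressing the quadrilinear integrals through
   transforms turns the average into the first formula, the real part coming
   from the symmetrization.

   If q is a Schwartz function, integration by parts gives, with
   zeta = i / (2z), f = \sum_k zeta^{k+1} q^(k) and
   g = \sum_k (-1)^k zeta^{k+1} (q^(k))* up to O(zeta^{N+1}), uniformly in x.
   Substituting these in both formulas and collecting the powers of zeta yields
   the asymptotic series; the average of the two turns the coefficients into
   real parts. *)

(** * Complex numbers *)

(** Both formulas for [b4] come from one identity. Let [uu] and [vv] be the marginals of the
    integrand of [s2]. Then [f g] at [y] is the integral over the pairs straddling [y], that is, the
    difference of the tails of [uu] and [vv] beyond [y]. Up to powers of [lambda], [s4] pairs [uu]
    with the tail of [vv], and half of [s2] squared pairs [uu] with its own tail, so only [f g]
    survives. In the Fourier formula the obstacle is that [fourier q] is only an [L^2] limit.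
    Parseval is proved against the kernels of [f] and [g], which are bounded, integrable and have a
    single jump. The Abel weight [exp (- e |xi|)] makes Fubini applicable and becomes a Poisson
    kernel. The quadrilinear integral converges because the resolvent is square-integrable: three
    weighted transforms are integrable, and the fourth transform is handled by Cauchy-Schwarz. In
    the asymptotic series the error must be uniform as [lambda^2] approaches the real axis.
    Remainders are bounded by [L^1] norms of derivatives, using only that the exponentials have
    modulus at most 1. *)

Section ComplexNumbers.
Variable R : realType.
Implicit Types (x y z : R[i]) (a t : R).

Lemma cReD x y : Re (x + y) = Re x + Re y. Proof. by case: x y => [? ?] []. Qed.
Lemma cImD x y : Im (x + y) = Im x + Im y. Proof. by case: x y => [? ?] []. Qed.
Lemma cReN x : Re (- x) = - Re x. Proof. by case: x. Qed.
Lemma cImN x : Im (- x) = - Im x. Proof. by case: x. Qed.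
Lemma cReM x y : Re (x * y) = Re x * Re y - Im x * Im y.
Proof. by case: x y => [? ?] []. Qed.
Lemma cImM x y : Im (x * y) = Re x * Im y + Im x * Re y.
Proof. by case: x y => [? ?] [? ?] /=; rewrite addrC. Qed.
Lemma Re_conjc x : Re (conjc x) = Re x. Proof. by case: x. Qed.
Lemma Im_conjc x : Im (conjc x) = - Im x. Proof. by case: x. Qed.
Lemma conjcM x y : conjc (x * y) = conjc x * conjc y. Proof. exact: (rmorphM (@conjc R)). Qed.
Lemma conjcD x y : conjc (x + y) = conjc x + conjc y. Proof. exact: (rmorphD (@conjc R)). Qed.
Lemma conjcN x : conjc (- x) = - conjc x. Proof. exact: (rmorphN (@conjc R)). Qed.
Lemma conjcX x n : conjc (x ^+ n) = conjc x ^+ n. Proof. exact: (rmorphXn (@conjc R)). Qed.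
Lemma conjcV x : conjc x^-1 = (conjc x)^-1. Proof. exact: (fmorphV (@conjc R)). Qed.
Lemma conjcR a : conjc a%:C = a%:C. Proof. by rewrite /= oppr0. Qed.
Lemma conjcC x : conjc (conjc x) = x. Proof. exact: conjcK. Qed.
Lemma complexM a t : (a * t)%:C = a%:C * t%:C. Proof. exact: (rmorphM (real_complex R)). Qed.
Lemma complexD a t : (a + t)%:C = a%:C + t%:C. Proof. exact: (rmorphD (real_complex R)). Qed.
Lemma complexN a : (- a)%:C = - a%:C. Proof. exact: (rmorphN (real_complex R)). Qed.
Lemma complexV a : (a^-1)%:C = (a%:C)^-1. Proof. exact: (fmorphV (real_complex R)). Qed.
Lemma complex_neq0 a : a != 0 -> a%:C != 0.
Proof. by apply: contra => /eqP[->]. Qed.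
Lemma complex_eq x y : Re x = Re y -> Im x = Im y -> x = y.
Proof. by case: x y => [? ?] [? ?] /= -> ->. Qed.

Lemma normc_ge0 x : 0 <= normc x. Proof. by case: x => a b; exact: sqrtr_ge0. Qed.

Lemma normc_sqr x : normc x ^+ 2 = Re x ^+ 2 + Im x ^+ 2.
Proof. by case: x => a b /=; rewrite sqr_sqrtr// addr_ge0// sqr_ge0. Qed.

Lemma normc_ler x a : 0 <= a -> Re x ^+ 2 + Im x ^+ 2 <= a ^+ 2 -> normc x <= a.
Proof. by move=> a0; rewrite -normc_sqr ler_sqr// nnegrE normc_ge0. Qed.

Lemma normcD_le x y : normc (x + y) <= normc x + normc y.
Proof. exact: le_normcD. Qed.

Lemma normc_opp x : normc (- x) = normc x.
Proof. by case: x => a b /=; rewrite !sqrrN. Qed.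

Lemma normcB_le x y : normc (x - y) <= normc x + normc y.
Proof. by rewrite (le_trans (normcD_le _ _))// normc_opp. Qed.

Lemma normc_conjc x : normc (conjc x) = normc x.
Proof. by case: x => a b /=; rewrite sqrrN. Qed.

Lemma normc_real a : normc a%:C = `|a|.
Proof. by rewrite /= expr0n/= addr0 sqrtr_sqr. Qed.

Lemma normc_i : normc 'i%C = 1 :> R.
Proof. by rewrite /= expr0n/= add0r expr1n sqrtr1. Qed.

Lemma normc_nat n : normc (n%:R : R[i]) = n%:R.
Proof. by rewrite -(rmorph_nat (real_complex R)) normc_real ger0_norm. Qed.

Lemma normcX x n : normc (x ^+ n) = normc x ^+ n.
Proof. by elim: n => [|n IH]; rewrite ?expr0 ?normc1// !exprS normcM IH. Qed.

Lemma normc_sum (I : Type) (r : seq I) (P : pred I) (F : I -> R[i]) :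
  normc (\sum_(i <- r | P i) F i) <= \sum_(i <- r | P i) normc (F i).
Proof.
elim/big_rec2: _ => [|i a x _ H]; first by rewrite normc0.
by rewrite (le_trans (normcD_le _ _))// lerD2l.
Qed.

Lemma normc_Re x : `|Re x| <= normc x.
Proof.
by rewrite -ler_sqr ?nnegrE ?normc_ge0// normc_sqr real_normK ?num_real// lerDl sqr_ge0.
Qed.

Lemma normc_Im x : `|Im x| <= normc x.
Proof.
by rewrite -ler_sqr ?nnegrE ?normc_ge0// normc_sqr real_normK ?num_real// lerDr sqr_ge0.
Qed.

Lemma normc_le_ReIm x : normc x <= `|Re x| + `|Im x|.
Proof.
apply: normc_ler; first by rewrite addr_ge0.
rewrite sqrrD !real_normK ?num_real// -addrA lerD2l lerDr.
by rewrite mulrn_wge0// mulr_ge0.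
Qed.

Lemma mulcJ x : x * conjc x = (normc x ^+ 2)%:C.
Proof. by rewrite normc_sqr; case: x => a b /=; simpc; congr (_ +i* _); ring. Qed.

Lemma normc_eq0 x : (normc x == 0) = (x == 0).
Proof. by apply/eqP/eqP => [/eq0_normc//|->]; rewrite normc0. Qed.

Lemma normc_gt0 x : (0 < normc x) = (x != 0).
Proof. by rewrite lt0r normc_ge0 andbT normc_eq0. Qed.

Lemma cexpD x y : cexp (x + y) = cexp x * cexp y.
Proof.
rewrite /cexp cReD cImD expRD cosD sinD rmorphM /=.
by simpc; congr (_ +i* _); ring.
Qed.

Lemma normc_cexp x : normc (cexp x) = expR (Re x).
Proof.
rewrite /cexp normcM normc_real ger0_norm ?expR_ge0//=.
by rewrite cos2Dsin2 sqrtr1 mulr1.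
Qed.

Lemma conjc_cexp x : conjc (cexp x) = cexp (conjc x).
Proof.
apply: complex_eq; rewrite ?Re_conjc ?Im_conjc /cexp ?cReM ?cImM Re_conjc Im_conjc cosN sinN /=;
  ring.
Qed.

Lemma cexp0 : cexp 0 = 1 :> R[i].
Proof. by rewrite /cexp /= expR0 cos0 sin0 mul1r. Qed.

Lemma normc_cexp_i (t : R) : normc (cexp ('i%C * t%:C)) = 1.
Proof. by rewrite normc_cexp cReM /= mul0r mulr0 subrr expR0. Qed.

Lemma conjc_cexp_i (t : R) : conjc (cexp ('i%C * t%:C)) = cexp ('i%C * (- t)%:C).
Proof.
by rewrite conjc_cexp; congr cexp; apply: complex_eq; rewrite /= ?simpc /=; ring.
Qed.

Lemma cexp_iD (s t : R) : cexp ('i%C * (s + t)%:C) = cexp ('i%C * s%:C) * cexp ('i%C * t%:C).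
Proof. by rewrite rmorphD mulrDr cexpD. Qed.

(** Domains of integration become factors of the integrand, so that restrictions pass through
    products, conjugation and Fubini as ordinary algebra. *)
Definition ind (b : bool) : R[i] := (b%:R)%:C.

Lemma normc_ind b : normc (ind b) = b%:R.
Proof. by rewrite normc_real ger0_norm. Qed.

Lemma conjc_ind b : conjc (ind b) = ind b.
Proof. by case: b; rewrite /ind /= oppr0. Qed.

Lemma indT : ind true = 1. Proof. by []. Qed.
Lemma indF : ind false = 0. Proof. by []. Qed.

Lemma ind_and b c : ind (b && c) = ind b * ind c.
Proof. by case: b c => [] []; rewrite ?indT ?indF ?mul1r ?mul0r. Qed.

Lemma normc_ind_le1 b : normc (ind b) <= 1.
Proof. by rewrite normc_ind; case: b. Qed.

End ComplexNumbers.

(** * Measurability of complex functions *)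

Section ComplexMeasurable.
Context d (T : measurableType d) (R : realType).
Implicit Types f g : T -> R[i].

Definition cmeas f := measurable_fun setT (fun x => Re (f x)) /\
                      measurable_fun setT (fun x => Im (f x)).

Lemma cmeas_cst (c : R[i]) : cmeas (fun=> c). Proof. by split; exact: measurable_cst. Qed.

Lemma cmeasD f g : cmeas f -> cmeas g -> cmeas (fun x => f x + g x).
Proof.
move=> [f1 f2] [g1 g2]; split.
  by under eq_fun do rewrite cReD; exact: measurable_funD.
by under eq_fun do rewrite cImD; exact: measurable_funD.
Qed.

Lemma cmeasN f : cmeas f -> cmeas (fun x => - f x).
Proof.
move=> [f1 f2]; split.
  by under eq_fun do rewrite cReN; exact: measurableT_comp.
by under eq_fun do rewrite cImN; exact: measurableT_comp.
Qed.

Lemma cmeasB f g : cmeas f -> cmeas g -> cmeas (fun x => f x - g x).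
Proof. by move=> mf mg; apply: cmeasD => //; exact: cmeasN. Qed.

Lemma cmeasM f g : cmeas f -> cmeas g -> cmeas (fun x => f x * g x).
Proof.
move=> [f1 f2] [g1 g2]; split.
  by under eq_fun do rewrite cReM; apply: measurable_funB; exact: measurable_funM.
by under eq_fun do rewrite cImM; apply: measurable_funD; exact: measurable_funM.
Qed.

Lemma cmeas_conjc f : cmeas f -> cmeas (fun x => conjc (f x)).
Proof.
move=> [f1 f2]; split; first by under eq_fun do rewrite Re_conjc.
by under eq_fun do rewrite Im_conjc; exact: measurableT_comp.
Qed.

Lemma cmeas_real (h : T -> R) : measurable_fun setT h -> cmeas (fun x => (h x)%:C).
Proof. by move=> mh; split => //=; exact: measurable_cst. Qed.

Lemma cmeas_cexp f : cmeas f -> cmeas (fun x => cexp (f x)).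
Proof.
move=> [f1 f2]; split; rewrite /cexp.
  under eq_fun do rewrite cReM /= mul0r subr0.
  apply: measurable_funM; first exact: (measurableT_comp (@measurable_expR R)).
  apply: (measurableT_comp _ f2); apply: continuous_measurable_fun; exact: continuous_cos.
under eq_fun do rewrite cImM /= mul0r addr0.
apply: measurable_funM; first exact: (measurableT_comp (@measurable_expR R)).
apply: (measurableT_comp _ f2); apply: continuous_measurable_fun; exact: continuous_sin.
Qed.

Lemma measurable_normc f : cmeas f -> measurable_fun setT (fun x => normc (f x)).
Proof.
move=> [f1 f2].
rewrite (_ : (fun x => _) = fun x => Num.sqrt (Re (f x) ^+ 2 + Im (f x) ^+ 2)).
  apply: (measurableT_comp (f := @Num.sqrt R)).
    by apply: continuous_measurable_fun; exact: sqrt_continuous.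
  by apply: measurable_funD; exact: measurable_funX.
by apply/funext => x; case: (f x).
Qed.

Lemma cmeas_ind (b : T -> bool) : measurable_fun setT b -> cmeas (fun x => ind R (b x)).
Proof.
move=> mb; apply: cmeas_real; apply: (measurableT_comp (f := fun b : bool => b%:R : R)) => //.
Qed.

Lemma cmeas_lt (h k : T -> R) : measurable_fun setT h -> measurable_fun setT k ->
  cmeas (fun x => ind R (h x < k x)).
Proof. by move=> mh mk; apply: cmeas_ind; exact: measurable_fun_ltr. Qed.

End ComplexMeasurable.

Lemma cmeas_comp d d' (T : measurableType d) (T' : measurableType d') (R : realType)
  (f : T' -> R[i]) (phi : T -> T') : cmeas f -> measurable_fun setT phi ->
  cmeas (fun x => f (phi x)).
Proof. by move=> [f1 f2] mp; split; [exact: (measurableT_comp f1)|exact: (measurableT_comp f2)]. Qed.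

(** * Integrals of complex functions *)

Section ComplexIntegral.
Context d (T : measurableType d) (R : realType).
Variable mu : {measure set T -> \bar R}.
Implicit Types f g : T -> R[i].

(** The norm integral lives in the extended reals, so that Tonelli can be applied to it before
    integrability is known. *)
Definition nint f : \bar R := (\int[mu]_x (normc (f x))%:E)%E.
Definition cL1 f := cmeas f /\ (nint f < +oo)%E.
Definition cint f : R[i] := cintegral mu setT f.

Lemma nint_ge0 f : (0 <= nint f)%E.
Proof. by apply: integral_ge0 => x _; rewrite lee_fin normc_ge0. Qed.

Lemma mnormc f : cmeas f -> measurable_fun setT (fun x => (normc (f x))%:E).
Proof. by move=> mf; apply/measurable_EFinP; exact: measurable_normc. Qed.

Lemma le_nint f g : cmeas f -> cmeas g ->
  (forall x, normc (f x) <= normc (g x)) -> (nint f <= nint g)%E.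
Proof.
move=> mf mg fg; apply: ge0_le_integral => //.
- by move=> x _; rewrite lee_fin normc_ge0.
- exact: mnormc.
- exact: mnormc.
- by move=> x _; rewrite lee_fin.
Qed.

Lemma cL1_le f g : cmeas f -> cL1 g -> (forall x, normc (f x) <= normc (g x)) -> cL1 f.
Proof. by move=> mf [mg g1] fg; split => //; exact: le_lt_trans (le_nint mf mg fg) g1. Qed.

Lemma cL1_le_real f (h : T -> R) : cmeas f -> measurable_fun setT h ->
  (\int[mu]_x (h x)%:E < +oo)%E -> (forall x, normc (f x) <= h x) -> cL1 f.
Proof.
move=> mf mh hoo fh; split => //; apply: le_lt_trans hoo; apply: ge0_le_integral => //.
- by move=> x _; rewrite lee_fin normc_ge0.
- exact: mnormc.
- exact/measurable_EFinP.
- by move=> x _; rewrite lee_fin.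
Qed.

Lemma cL1_Re f : cL1 f -> mu.-integrable setT (EFin \o (fun x => Re (f x))).
Proof.
move=> [mf foo]; apply/integrableP; split; first by apply/measurable_EFinP; case: mf.
apply: le_lt_trans foo; apply: ge0_le_integral => //.
- by apply: measurableT_comp => //; apply/measurable_EFinP; case: mf.
- exact: mnormc.
- by move=> x _; rewrite lee_fin normc_Re.
Qed.

Lemma cL1_Im f : cL1 f -> mu.-integrable setT (EFin \o (fun x => Im (f x))).
Proof.
move=> [mf foo]; apply/integrableP; split; first by apply/measurable_EFinP; case: mf.
apply: le_lt_trans foo; apply: ge0_le_integral => //.
- by apply: measurableT_comp => //; apply/measurable_EFinP; case: mf.
- exact: mnormc.
- by move=> x _; rewrite lee_fin normc_Im.
Qed.

Lemma nint_fin f : cL1 f -> nint f \is a fin_num.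
Proof. by move=> [_ foo]; rewrite ge0_fin_numE ?nint_ge0. Qed.

Lemma eq_cint f g : f =1 g -> cint f = cint g.
Proof. by move=> /funext ->. Qed.

Lemma eq_cL1 f g : f =1 g -> cL1 f -> cL1 g.
Proof. by move=> /funext ->. Qed.

Lemma eq_nint f g : (forall x, normc (f x) = normc (g x)) -> nint f = nint g.
Proof. by move=> fg; apply: eq_integral => x _; rewrite fg. Qed.

Lemma nint_conjc f : nint (fun x => conjc (f x)) = nint f.
Proof. by apply: eq_nint => x; rewrite normc_conjc. Qed.

Lemma nintZ c f : cmeas f -> nint (fun x => c * f x) = ((normc c)%:E * nint f)%E.
Proof.
move=> mf; rewrite /nint -ge0_integralZl//.
- by apply: eq_integral => x _; rewrite normcM EFinM.
- exact: mnormc.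
- by move=> x _; rewrite lee_fin normc_ge0.
- by rewrite lee_fin normc_ge0.
Qed.

Lemma nintD_le f g : cmeas f -> cmeas g -> (nint (fun x => (f x + g x)%R) <= nint f + nint g)%E.
Proof.
move=> mf mg; rewrite /nint -ge0_integralD//; last 4 first.
- by move=> x _; rewrite lee_fin normc_ge0.
- exact: mnormc.
- by move=> x _; rewrite lee_fin normc_ge0.
- exact: mnormc.
apply: ge0_le_integral => //.
- by move=> x _; rewrite lee_fin normc_ge0.
- by apply: mnormc; exact: cmeasD.
- by apply: emeasurable_funD; exact: mnormc.
- by move=> x _; rewrite -EFinD lee_fin normcD_le.
Qed.

Lemma cL1_0 : cL1 (fun=> 0).
Proof.
split; first exact: cmeas_cst.
by rewrite /nint; under eq_integral do rewrite normc0; rewrite integral0.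
Qed.

Lemma cL1D f g : cL1 f -> cL1 g -> cL1 (fun x => f x + g x).
Proof.
move=> [mf foo] [mg goo]; split; first exact: cmeasD.
by apply: le_lt_trans (nintD_le mf mg) _; exact: lte_add_pinfty.
Qed.

Lemma cL1Z c f : cL1 f -> cL1 (fun x => c * f x).
Proof.
move=> [mf foo]; split; first by apply: cmeasM => //; exact: cmeas_cst.
by rewrite nintZ// lte_mul_pinfty// lee_fin normc_ge0.
Qed.

Lemma cL1N f : cL1 f -> cL1 (fun x => - f x).
Proof.
move=> [mf foo]; split; first exact: cmeasN.
by rewrite (eq_nint (g := f))// => x; rewrite normc_opp.
Qed.

Lemma cL1B f g : cL1 f -> cL1 g -> cL1 (fun x => f x - g x).
Proof. by move=> f1 g1; apply: cL1D => //; exact: cL1N. Qed.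

Lemma cL1_conjc f : cL1 f -> cL1 (fun x => conjc (f x)).
Proof. by move=> [mf foo]; split; [exact: cmeas_conjc|rewrite nint_conjc]. Qed.

Lemma cL1M_bounded f g (K : R) : cmeas f -> (forall x, normc (f x) <= K) -> cL1 g ->
  cL1 (fun x => f x * g x).
Proof.
move=> mf fK g1; have K0 (x : T) : 0 <= K by exact: le_trans (normc_ge0 _) (fK x).
apply: cL1_le (cL1Z K%:C g1) _; first by apply: cmeasM => //; case: g1.
by move=> x; rewrite !normcM normc_real (ger0_norm (K0 x)) ler_wpM2r// normc_ge0.
Qed.

Lemma cL1_sum (I : Type) (r : seq I) (P : pred I) (F : I -> T -> R[i]) :
  (forall i, P i -> cL1 (F i)) -> cL1 (fun x => \sum_(i <- r | P i) F i x).
Proof.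
move=> FL; elim: r => [|i r IH].
  by apply: eq_cL1 cL1_0 => x; rewrite big_nil.
case: (boolP (P i)) => Pi; last by apply: eq_cL1 IH => x; rewrite big_cons (negbTE Pi).
by apply: eq_cL1 (cL1D (FL _ Pi) IH) => x; rewrite big_cons Pi.
Qed.

Lemma cintD f g : cL1 f -> cL1 g -> cint (fun x => f x + g x) = cint f + cint g.
Proof.
move=> f1 g1; apply: complex_eq; rewrite ?cReD ?cImD /=.
  under eq_Rintegral do rewrite cReD.
  by rewrite RintegralD//; exact: cL1_Re.
under eq_Rintegral do rewrite cImD.
by rewrite RintegralD//; exact: cL1_Im.
Qed.

Lemma cintZ c f : cL1 f -> cint (fun x => c * f x) = c * cint f.
Proof.
move=> f1; have f1R := cL1_Re f1; have f1I := cL1_Im f1.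
have hZ (h : T -> R) (a : R) : mu.-integrable setT (EFin \o h) ->
    mu.-integrable setT (EFin \o (fun x => a * h x)).
  move=> ih; rewrite (_ : _ \o _ = (fun x => a%:E * (EFin \o h) x)%E).
    exact: integrableZl.
  by apply/funext => x /=; rewrite EFinM.
apply: complex_eq; rewrite ?cReM ?cImM /=.
  under eq_Rintegral do rewrite cReM.
  by rewrite RintegralB// ?RintegralZl//; exact: hZ.
under eq_Rintegral do rewrite cImM.
by rewrite RintegralD// ?RintegralZl//; exact: hZ.
Qed.

Lemma cintZr c f : cL1 f -> cint (fun x => f x * c) = cint f * c.
Proof.
by move=> f1; rewrite mulrC -cintZ//; apply: eq_cint => x; rewrite mulrC.
Qed.

Lemma cintN f : cL1 f -> cint (fun x => - f x) = - cint f.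
Proof.
by move=> f1; rewrite -mulN1r -cintZ//; apply: eq_cint => x; rewrite mulN1r.
Qed.

Lemma cintB f g : cL1 f -> cL1 g -> cint (fun x => f x - g x) = cint f - cint g.
Proof. by move=> f1 g1; rewrite cintD// ?cintN//; exact: cL1N. Qed.

Lemma cint0 : cint (fun=> 0) = 0.
Proof. by apply: complex_eq => /=; rewrite /Rintegral integral0. Qed.

Lemma cint_sum (I : Type) (r : seq I) (P : pred I) (F : I -> T -> R[i]) :
  (forall i, P i -> cL1 (F i)) ->
  cint (fun x => \sum_(i <- r | P i) F i x) = \sum_(i <- r | P i) cint (F i).
Proof.
move=> FL; elim: r => [|i r IH].
  by rewrite big_nil -[RHS]cint0; apply: eq_cint => x; rewrite big_nil.
rewrite big_cons -IH.
case: ifPn => Pi; last by apply: eq_cint => x; rewrite big_cons (negbTE Pi).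
rewrite -cintD//; [|exact: FL|exact: cL1_sum].
by apply: eq_cint => x; rewrite big_cons Pi.
Qed.

Lemma cint_conjc f : cL1 f -> cint (fun x => conjc (f x)) = conjc (cint f).
Proof.
move=> f1; apply: complex_eq; rewrite ?Re_conjc ?Im_conjc /=.
  by under eq_Rintegral do rewrite Re_conjc.
under eq_Rintegral do rewrite Im_conjc -mulN1r.
by rewrite RintegralZl// ?mulN1r//; exact: cL1_Im.
Qed.

Lemma cint_real (h : T -> R) : cint (fun x => (h x)%:C) = (\int[mu]_x h x)%:C.
Proof. by apply: complex_eq => //=; rewrite /Rintegral integral0. Qed.

(* Multiplying the integrand by a unit makes its integral a nonnegative real. *)
Lemma le_normc_cint f : cL1 f -> ((normc (cint f))%:E <= nint f)%E.
Proof.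
move=> f1; have [->|I0] := eqVneq (cint f) 0; first by rewrite normc0 nint_ge0.
have N0 : normc (cint f) != 0 by rewrite normc_eq0.
pose c := conjc (cint f) / (normc (cint f))%:C.
have c1 : normc c = 1.
  by rewrite normcM normc_conjc normcV normc_real ger0_norm ?normc_ge0// divff.
have cI : c * cint f = (normc (cint f))%:C.
  rewrite /c mulrAC [conjc _ * _]mulrC mulcJ expr2 rmorphM mulfK//.
  by apply: contra_neq N0 => /complexI.
have cf1 := cL1Z c f1.
rewrite -[normc (cint f)]ger0_norm ?normc_ge0//.
rewrite -[normc (cint f)]/(Re (normc (cint f))%:C) -cI -cintZ//=.
rewrite EFin_normr_Rintegral//; last exact: cL1_Re cf1.
apply: le_trans (le_abse_integral _ _ _) _ => //.
  by apply/measurable_EFinP; case: cf1 => -[].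
rewrite -[nint f]mul1e -c1 -nintZ; last by case: f1.
apply: ge0_le_integral => //.
- by apply: measurableT_comp => //; apply/measurable_EFinP; case: cf1 => -[].
- by apply: mnormc; case: cf1.
- by move=> x _; rewrite lee_fin normc_Re.
Qed.

Lemma ae_eq_cint f g : cmeas f -> cmeas g -> {ae mu, forall x, f x = g x} -> cint f = cint g.
Proof.
move=> [f1 f2] [g1 g2] fg; apply: complex_eq => /=; congr fine; apply: ae_eq_integral => //.
- exact/measurable_EFinP.
- exact/measurable_EFinP.
- by apply: filterS fg => x -> _.
- exact/measurable_EFinP.
- exact/measurable_EFinP.
- by apply: filterS fg => x -> _.
Qed.

Lemma ae_eq_nint f g : cmeas f -> cmeas g -> {ae mu, forall x, f x = g x} -> nint f = nint g.
Proof.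
move=> mf mg fg; apply: ge0_ae_eq_integral => //.
- exact: mnormc.
- exact: mnormc.
- by move=> x _; rewrite lee_fin normc_ge0.
- by move=> x _; rewrite lee_fin normc_ge0.
- by apply: filterS fg => x -> _.
Qed.

Lemma ae_eq_cL1 f g : cmeas f -> cL1 g -> {ae mu, forall x, f x = g x} -> cL1 f.
Proof. by move=> mf [mg goo] fg; split => //; rewrite (ae_eq_nint mf mg fg). Qed.

End ComplexIntegral.

(** * Complex sequences and dominated convergence *)

Section ComplexConvergence.
Variable R : realType.
Implicit Types (u v : nat -> R[i]) (l m : R[i]).

Definition ccvg u l :=
  (fun n => Re (u n)) @ \oo --> Re l /\ (fun n => Im (u n)) @ \oo --> Im l.

Lemma ccvg_unique u l m : ccvg u l -> ccvg u m -> l = m.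
Proof. by move=> [a b] [c e]; apply: complex_eq; [exact: (cvg_unique (@Rhausdorff R) a c)|exact: (cvg_unique (@Rhausdorff R) b e)]. Qed.

Lemma ccvg_cst l : ccvg (fun=> l) l. Proof. by split; exact: cvg_cst. Qed.

Lemma ccvgM u v l m : ccvg u l -> ccvg v m -> ccvg (fun n => u n * v n) (l * m).
Proof.
move=> [a b] [c e]; split.
  by under eq_fun do rewrite cReM; rewrite cReM; apply: cvgB; exact: cvgM.
by under eq_fun do rewrite cImM; rewrite cImM; apply: cvgD; exact: cvgM.
Qed.

Lemma ccvgZ c u l : ccvg u l -> ccvg (fun n => c * u n) (c * l).
Proof. by apply: ccvgM; exact: ccvg_cst. Qed.

Lemma ccvgD u v l m : ccvg u l -> ccvg v m -> ccvg (fun n => u n + v n) (l + m).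
Proof.
move=> [a b] [c e]; split.
  by under eq_fun do rewrite cReD; rewrite cReD; apply: cvgD.
by under eq_fun do rewrite cImD; rewrite cImD; apply: cvgD.
Qed.

Lemma ccvg_real (h : nat -> R) (a : R) : h @ \oo --> a -> ccvg (fun n => (h n)%:C) a%:C.
Proof. by move=> ha; split => //=; exact: cvg_cst. Qed.

Lemma ccvg_normc u l (e : nat -> R) : (forall n, normc (u n - l) <= e n) ->
  e @ \oo --> 0 -> ccvg u l.
Proof.
move=> ue e0.
have aux (p : nat -> R) a : (forall n, `|p n - a| <= e n) -> p @ \oo --> a.
  move=> pe; rewrite -[a]addr0; rewrite (_ : p = fun n => a + (p n - a)).
    apply: cvgD; first exact: cvg_cst.
    apply: (squeeze_cvgr (f := \- e) (h := e)) => //; last first.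
      by rewrite -oppr0; exact: cvgN.
    by apply: nearW => n /=; rewrite -ler_norml.
  by apply/funext => n; rewrite subrKC.
split; apply: aux => n; apply: le_trans (ue n).
  by rewrite -cReN -cReD normc_Re.
by rewrite -cImN -cImD normc_Im.
Qed.

Lemma cvg_normc u l : ccvg u l -> (fun n => normc (u n)) @ \oo --> normc l.
Proof.
move=> [a b].
have nE x : normc x = Num.sqrt (Re x ^+ 2 + Im x ^+ 2) :> R by case: x.
rewrite nE (_ : (fun n => _) = fun n => Num.sqrt (Re (u n) ^+ 2 + Im (u n) ^+ 2)); last first.
  by apply/funext => n; rewrite nE.
have ab : (fun n => Re (u n) ^+ 2 + Im (u n) ^+ 2) @ \oo --> Re l ^+ 2 + Im l ^+ 2.
  by apply: cvgD; [exact: (cvgM a a)|exact: (cvgM b b)].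
exact: (continuous_cvg _ (@sqrt_continuous R _) ab).
Qed.

Lemma ccvg_dominated d (T : measurableType d) (mu : {measure set T -> \bar R})
    (F : nat -> T -> R[i]) (f : T -> R[i]) (g : T -> R) :
  (forall n, cmeas (F n)) -> cmeas f -> measurable_fun setT g ->
  (\int[mu]_x (g x)%:E < +oo)%E ->
  (forall n x, normc (F n x) <= g x) ->
  {ae mu, forall x, ccvg (F^~ x) (f x)} ->
  ccvg (fun n => cint mu (F n)) (cint mu f).
Proof.
move=> mF mf mg goo Fg Ff.
have g0 x : 0 <= g x by exact: le_trans (normc_ge0 _) (Fg 0%N x).
have ig : mu.-integrable setT (EFin \o g).
  apply/integrableP; split; first exact/measurable_EFinP.
  by under eq_integral do rewrite gee0_abs ?lee_fin//.
have aux (p : nat -> T -> R) (q : T -> R) : (forall n, measurable_fun setT (p n)) ->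
    measurable_fun setT q -> (forall n x, `|p n x| <= g x) ->
    {ae mu, forall x, p^~ x @ \oo --> q x} ->
    (fun n => \int[mu]_x p n x) @ \oo --> \int[mu]_x q x.
  move=> mp mq pg pq.
  have mp' n : measurable_fun setT (EFin \o p n) by exact/measurable_EFinP.
  have mq' : measurable_fun setT (EFin \o q) by exact/measurable_EFinP.
  have pq' : {ae mu, forall x, setT x -> (fun n => (EFin \o p n) x) @ \oo --> (EFin \o q) x}.
    apply: filterS pq => x pqx _; apply: cvg_EFin; first exact: nearW.
    exact: pqx.
  have pg' : {ae mu, forall x n, setT x -> (`|(EFin \o p n) x| <= (EFin \o g) x)%E}.
    by apply: aeW => x n _; rewrite lee_fin.
  have [iq _ cvg_pq] := dominated_convergence measurableT mp' mq' pq' ig pg'.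
  by apply: fine_cvg; rewrite fineK//; exact: integrable_fin_num.
split.
  apply: aux => [n|||]; [by case: (mF n)|by case: mf| |].
    by move=> n x; exact: le_trans (normc_Re _) (Fg n x).
  by apply: filterS Ff => x [].
apply: aux => [n|||]; [by case: (mF n)|by case: mf| |].
  by move=> n x; exact: le_trans (normc_Im _) (Fg n x).
by apply: filterS Ff => x [].
Qed.

End ComplexConvergence.

(** * Fubini's theorem *)

Section SigmaFiniteProduct.
Context d1 d2 (T1 : measurableType d1) (T2 : measurableType d2) (R : realType).
Variable m1 : {sigma_finite_measure set T1 -> \bar R}.
Variable m2 : {sigma_finite_measure set T2 -> \bar R}.

Lemma product_sigma_finite : sigma_finite setT (m1 \x m2)%E.
Proof.
have /sigma_finiteP[F [FT ndF Foo]] := sigma_finiteT m1.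
have /sigma_finiteP[G [GT ndG Goo]] := sigma_finiteT m2.
exists (fun n => F n `*` G n).
  apply/seteqP; split => // -[x y] _.
  have [n _ Fx] : (\bigcup_n F n) x by rewrite -FT.
  have [k _ Gy] : (\bigcup_n G n) y by rewrite -GT.
  exists (maxn n k) => //; split => /=.
    by apply: (subsetPset _ _ (ndF _ _ (leq_maxl n k))).
  by apply: (subsetPset _ _ (ndG _ _ (leq_maxr n k))).
move=> n; have [mF Fn] := Foo n; have [mG Gn] := Goo n.
split; first exact: measurableX.
by rewrite product_measure1E// lte_mul_pinfty// ge0_fin_numE.
Qed.

(* The library only makes products of subprobabilities canonically
   sigma-finite, so nested products need this explicit structure. *)
Definition pm : {sigma_finite_measure set (T1 * T2)%type -> \bar R} :=
  HB.pack (m1 \x m2)%E (Measure_isSigmaFinite.Build _ _ _ (m1 \x m2)%E product_sigma_finite).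

End SigmaFiniteProduct.

Section ProductIntegral.
Context d1 d2 (T1 : measurableType d1) (T2 : measurableType d2) (R : realType).
Variable m1 : {sigma_finite_measure set T1 -> \bar R}.
Variable m2 : {sigma_finite_measure set T2 -> \bar R}.
Implicit Types f : T1 * T2 -> R[i].

Lemma nint_prod1 f : cmeas f ->
  nint (pm m1 m2) f = (\int[m1]_x nint m2 (fun y => f (x, y)))%E.
Proof.
move=> mf; rewrite /nint fubini_tonelli1//; first exact: mnormc.
by move=> x; rewrite lee_fin normc_ge0.
Qed.

Lemma nint_prod2 f : cmeas f ->
  nint (pm m1 m2) f = (\int[m2]_y nint m1 (fun x => f (x, y)))%E.
Proof.
move=> mf; rewrite /nint fubini_tonelli2//; first exact: mnormc.
by move=> x; rewrite lee_fin normc_ge0.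
Qed.

Lemma measurable_nint1 f : cmeas f ->
  measurable_fun setT (fun x => nint m2 (fun y => f (x, y))).
Proof.
move=> mf; apply: (measurable_fun_fubini_tonelli_F (fun p => (normc (f p))%:E)).
  exact: mnormc.
by move=> x; rewrite lee_fin normc_ge0.
Qed.

(** Tonelli's measurability is applied to the positive and negative parts separately; slices with an
    infinite integral are absorbed by the totality of [fine]. *)
Lemma measurable_Rintegral1 (h : T1 * T2 -> R) : measurable_fun setT h ->
  measurable_fun setT (fun x => \int[m2]_y h (x, y)).
Proof.
move=> mh; have mE : measurable_fun setT (EFin \o h) by exact/measurable_EFinP.
apply: (measurableT_comp (f := fine)); first exact: fine_measurable.
rewrite (_ : (fun x => _) = fun x => (\int[m2]_y (EFin \o h)^\+ (x, y) -
    \int[m2]_y (EFin \o h)^\- (x, y))%E).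
  apply: emeasurable_funB.
    by apply: measurable_fun_fubini_tonelli_F => //; exact: measurable_funepos.
  by apply: measurable_fun_fubini_tonelli_F => //; exact: measurable_funeneg.
apply/funext => x; rewrite integralE.
by congr (_ - _)%E; apply: eq_integral => y _; rewrite ?funeposE ?funenegE.
Qed.

Lemma cmeas_cint f : cmeas f -> cmeas (fun x => cint m2 (fun y => f (x, y))).
Proof. by move=> [mf1 mf2]; split; [exact: (measurable_Rintegral1 mf1)|exact: (measurable_Rintegral1 mf2)]. Qed.

Lemma cL1_ReIm d (T : measurableType d) (mu : {measure set T -> \bar R}) (f : T -> R[i]) :
  mu.-integrable setT (EFin \o (fun x => Re (f x))) ->
  mu.-integrable setT (EFin \o (fun x => Im (f x))) -> cL1 mu f.
Proof.
move=> /integrableP[mR Roo] /integrableP[mI Ioo].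
have mf : cmeas f by split; exact/measurable_EFinP.
split => //; apply: (@le_lt_trans _ _ (\int[mu]_x `|(Re (f x))%:E| +
   \int[mu]_x `|(Im (f x))%:E|)%E); last exact: lte_add_pinfty.
rewrite -ge0_integralD//; last 2 first.
- exact: measurableT_comp.
- exact: measurableT_comp.
apply: ge0_le_integral => //.
- by move=> x _; rewrite lee_fin normc_ge0.
- exact: mnormc.
- by apply: emeasurable_funD; exact: measurableT_comp.
- by move=> x _; rewrite -EFinD lee_fin normc_le_ReIm.
Qed.

Lemma Rintegral_fubini (h : T1 * T2 -> R) : (pm m1 m2).-integrable setT (EFin \o h) ->
  m1.-integrable setT (EFin \o (fun x => \int[m2]_y h (x, y))) /\
  \int[(pm m1 m2)]_p h p = \int[m1]_x \int[m2]_y h (x, y).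
Proof.
move=> ih; have iF := integrable_fubini_F ih.
have mh : measurable_fun setT h by apply/measurable_EFinP; exact: measurable_int ih.
have mF : measurable_fun setT (EFin \o (fun x => \int[m2]_y h (x, y))).
  by apply/measurable_EFinP; exact: measurable_Rintegral1.
(* The inner integral is finite only for almost every [x]; elsewhere [fine] substitutes a default
   value, on a null set. *)
have FE : ae_eq m1 setT (EFin \o (fun x => \int[m2]_y h (x, y))) (fubini_F m2 (EFin \o h)).
  by apply: filterS (integrable_ae measurableT iF) => x /(_ I) Fx _; rewrite /= fineK.
split.
  apply/integrableP; split => //; have /integrableP[mF' ] := iF.
  congr (_ < _)%E; apply: ge0_ae_eq_integral => //.
  - exact: measurableT_comp.
  - exact: measurableT_comp.
  - by apply: filterS FE => x /(_ I) FEx _; rewrite FEx.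
rewrite {1}/Rintegral -integral12_prod_meas1//; congr fine.
apply: ae_eq_integral => //; first exact: measurable_int iF.
by apply: filterS FE => x /(_ I) FEx _; rewrite -FEx.
Qed.

Lemma cL1_cint f : cL1 (pm m1 m2) f -> cL1 m1 (fun x => cint m2 (fun y => f (x, y))).
Proof.
move=> f1; apply: cL1_ReIm.
  by have [] := Rintegral_fubini (cL1_Re f1).
by have [] := Rintegral_fubini (cL1_Im f1).
Qed.

Lemma cint_prod1 f : cL1 (pm m1 m2) f ->
  cint (pm m1 m2) f = cint m1 (fun x => cint m2 (fun y => f (x, y))).
Proof.
move=> f1; apply: complex_eq.
  by have [_] := Rintegral_fubini (cL1_Re f1).
by have [_] := Rintegral_fubini (cL1_Im f1).
Qed.

End ProductIntegral.

Section ProductSwap.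
Context d1 d2 (T1 : measurableType d1) (T2 : measurableType d2) (R : realType).
Variable m1 : {sigma_finite_measure set T1 -> \bar R}.
Variable m2 : {sigma_finite_measure set T2 -> \bar R}.
Implicit Types f : T1 * T2 -> R[i].

Lemma cL1_swap f : cL1 (pm m1 m2) f -> cL1 (pm m2 m1) (fun p => f (p.2, p.1)).
Proof.
move=> [mf foo]; have ms : cmeas (fun p : T2 * T1 => f (p.2, p.1)).
  by apply: cmeas_comp mf _; apply: measurable_fun_pair => //.
by split=> //; rewrite nint_prod1// -nint_prod2.
Qed.

Lemma fubini_real (h : T1 * T2 -> R) : (pm m1 m2).-integrable setT (EFin \o h) ->
  (pm m2 m1).-integrable setT (EFin \o (fun p => h (p.2, p.1))) ->
  \int[m1]_x \int[m2]_y h (x, y) = \int[m2]_y \int[m1]_x h (x, y).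
Proof.
move=> i1 i2; have [_ <-] := Rintegral_fubini i1; have [_ <-] := Rintegral_fubini i2.
congr fine; rewrite -integral21_prod_meas1// -integral12_prod_meas1//.
Qed.

Lemma cint_swap f : cL1 (pm m1 m2) f ->
  cint m1 (fun x => cint m2 (fun y => f (x, y))) =
  cint m2 (fun y => cint m1 (fun x => f (x, y))).
Proof.
move=> f1; have f2 := cL1_swap f1; apply: complex_eq => /=.
  exact: (fubini_real (cL1_Re f1) (cL1_Re f2)).
exact: (fubini_real (cL1_Im f1) (cL1_Im f2)).
Qed.

Lemma cint_prod2 f : cL1 (pm m1 m2) f ->
  cint (pm m1 m2) f = cint m2 (fun y => cint m1 (fun x => f (x, y))).
Proof. by move=> f1; rewrite cint_prod1// cint_swap. Qed.

Lemma cL1_tensor (a : T1 -> R[i]) (b : T2 -> R[i]) : cL1 m1 a -> cL1 m2 b ->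
  cL1 (pm m1 m2) (fun p => a p.1 * b p.2).
Proof.
move=> [ma aoo] [mb boo].
have mab : cmeas (fun p : T1 * T2 => a p.1 * b p.2).
  by apply: cmeasM; [exact: cmeas_comp ma _|exact: cmeas_comp mb _].
split=> //; rewrite nint_prod1//.
under eq_integral do rewrite /= nintZ//.
rewrite ge0_integralZr//; last 3 first.
- exact: mnormc.
- by move=> x _; rewrite lee_fin normc_ge0.
- exact: nint_ge0.
by rewrite lte_mul_pinfty// ?nint_ge0// -/(nint m1 a) ge0_fin_numE ?nint_ge0.
Qed.

Lemma cint_tensor (a : T1 -> R[i]) (b : T2 -> R[i]) : cL1 m1 a -> cL1 m2 b ->
  cint (pm m1 m2) (fun p => a p.1 * b p.2) = cint m1 a * cint m2 b.
Proof.
move=> a1 b1; rewrite cint_prod1; last exact: cL1_tensor.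
by rewrite -cintZr//; apply: eq_cint => x /=; rewrite cintZ.
Qed.

End ProductSwap.

(** * Square-integrable functions *)

Section SquareIntegrable.
Context d (T : measurableType d) (R : realType).
Variable mu : {measure set T -> \bar R}.
Implicit Types f g : T -> R[i].

Definition n2 f : \bar R := (\int[mu]_x (normc (f x) ^+ 2)%:E)%E.
Definition cL2 f := cmeas f /\ (n2 f < +oo)%E.

Lemma n2_ge0 f : (0 <= n2 f)%E.
Proof. by apply: integral_ge0 => x _; rewrite lee_fin sqr_ge0. Qed.

Lemma n2_fin f : cL2 f -> n2 f \is a fin_num.
Proof. by move=> [_ foo]; rewrite ge0_fin_numE ?n2_ge0. Qed.

Lemma msqr f : cmeas f -> measurable_fun setT (fun x => (normc (f x) ^+ 2)%:E).
Proof. by move=> mf; apply/measurable_EFinP; apply: measurable_funX; exact: measurable_normc. Qed.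

Lemma le_n2 f g : cmeas f -> cmeas g ->
  (forall x, normc (f x) <= normc (g x)) -> (n2 f <= n2 g)%E.
Proof.
move=> mf mg fg; apply: ge0_le_integral => //.
- by move=> x _; rewrite lee_fin sqr_ge0.
- exact: msqr.
- exact: msqr.
- by move=> x _; rewrite lee_fin lerXn2r// nnegrE normc_ge0.
Qed.

Lemma eq_n2 f g : (forall x, normc (f x) = normc (g x)) -> n2 f = n2 g.
Proof. by move=> fg; apply: eq_integral => x _; rewrite fg. Qed.

Lemma cL2_le f g : cmeas f -> cL2 g -> (forall x, normc (f x) <= normc (g x)) -> cL2 f.
Proof. by move=> mf [mg g1] fg; split => //; exact: le_lt_trans (le_n2 mf mg fg) g1. Qed.

Lemma n2Z c f : cmeas f -> n2 (fun x => c * f x) = ((normc c ^+ 2)%:E * n2 f)%E.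
Proof.
move=> mf; rewrite /n2 -ge0_integralZl//.
- by apply: eq_integral => x _; rewrite normcM exprMn EFinM.
- exact: msqr.
- by move=> x _; rewrite lee_fin sqr_ge0.
- by rewrite lee_fin sqr_ge0.
Qed.

Lemma eq_cL2 f g : f =1 g -> cL2 f -> cL2 g.
Proof. by move=> /funext ->. Qed.

Lemma cL2Z c f : cL2 f -> cL2 (fun x => c * f x).
Proof.
move=> [mf foo]; split; first by apply: cmeasM => //; exact: cmeas_cst.
by rewrite n2Z// lte_mul_pinfty// lee_fin sqr_ge0.
Qed.

Lemma cL2_conjc f : cL2 f -> cL2 (fun x => conjc (f x)).
Proof.
move=> [mf foo]; split; first exact: cmeas_conjc.
by rewrite (eq_n2 (g := f))// => x; rewrite normc_conjc.
Qed.

Lemma cL2M_bounded f g (K : R) : cmeas f -> (forall x, normc (f x) <= K) -> cL2 g ->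
  cL2 (fun x => f x * g x).
Proof.
move=> mf fK g1; have K0 (x : T) : 0 <= K by exact: le_trans (normc_ge0 _) (fK x).
apply: cL2_le (cL2Z K%:C g1) _; first by apply: cmeasM => //; case: g1.
by move=> x; rewrite !normcM normc_real (ger0_norm (K0 x)) ler_wpM2r// normc_ge0.
Qed.

Lemma n2D_le f g : cmeas f -> cmeas g ->
  (n2 (fun x => (f x + g x)%R) <= 2%:E * (n2 f + n2 g))%E.
Proof.
move=> mf mg; rewrite /n2 -ge0_integralD//; last 4 first.
- by move=> x _; rewrite lee_fin sqr_ge0.
- exact: msqr.
- by move=> x _; rewrite lee_fin sqr_ge0.
- exact: msqr.
rewrite -ge0_integralZl//; last 2 first.
- by apply: emeasurable_funD; exact: msqr.
- by move=> x _; rewrite -EFinD lee_fin addr_ge0 ?sqr_ge0.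
apply: ge0_le_integral => //.
- by move=> x _; rewrite lee_fin sqr_ge0.
- by apply: msqr; exact: cmeasD.
- apply: (emeasurable_funM (f := cst 2%:E)) => //.
  by apply: emeasurable_funD; exact: msqr.
move=> x _; rewrite -EFinD -EFinM lee_fin.
apply: (@le_trans _ _ ((normc (f x) + normc (g x)) ^+ 2)).
  by rewrite lerXn2r// ?nnegrE ?addr_ge0 ?normc_ge0// normcD_le.
by have := sqr_ge0 (normc (f x) - normc (g x)); nra.
Qed.

Lemma cL2D f g : cL2 f -> cL2 g -> cL2 (fun x => f x + g x).
Proof.
move=> [mf foo] [mg goo]; split; first exact: cmeasD.
apply: le_lt_trans (n2D_le mf mg) _.
by rewrite lte_mul_pinfty// lte_add_pinfty.
Qed.

Lemma cL2N f : cL2 f -> cL2 (fun x => - f x).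
Proof.
move=> [mf foo]; split; first exact: cmeasN.
by rewrite (eq_n2 (g := f))// => x; rewrite normc_opp.
Qed.

Lemma cL2B f g : cL2 f -> cL2 g -> cL2 (fun x => f x - g x).
Proof. by move=> f1 g1; apply: cL2D => //; exact: cL2N. Qed.

(** Young's inequality with a free weight [t], which [cauchy_schwarz] optimises afterwards. *)
Lemma nintM_le f g (t : R) : cmeas f -> cmeas g -> 0 < t ->
  (nint mu (fun x => (f x * g x)%R) <= (t / 2)%:E * n2 f + (t^-1 / 2)%:E * n2 g)%E.
Proof.
move=> mf mg t0; have ti0 : 0 < t^-1 by rewrite invr_gt0.
rewrite /n2 -!ge0_integralZl//; last 6 first.
- exact: msqr.
- by move=> x _; rewrite lee_fin sqr_ge0.
- by rewrite lee_fin divr_ge0// ltW.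
- exact: msqr.
- by move=> x _; rewrite lee_fin sqr_ge0.
- by rewrite lee_fin divr_ge0// ltW.
have mm (h : T -> R[i]) (c : R) : cmeas h ->
    measurable_fun setT (fun x => c%:E * (normc (h x) ^+ 2)%:E)%E.
  by move=> mh; apply: (emeasurable_funM (f := cst c%:E)) => //; exact: msqr.
rewrite -ge0_integralD//; last 4 first.
- by move=> x _; rewrite -EFinM lee_fin mulr_ge0 ?sqr_ge0// divr_ge0// ltW.
- exact: mm.
- by move=> x _; rewrite -EFinM lee_fin mulr_ge0 ?sqr_ge0// divr_ge0// ltW.
- exact: mm.
apply: ge0_le_integral => //.
- by move=> x _; rewrite lee_fin normc_ge0.
- by apply: mnormc; exact: cmeasM.
- by apply: emeasurable_funD; exact: mm.
move=> x _; rewrite -!EFinM -EFinD lee_fin normcM.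
have tV : t * t^-1 = 1 by rewrite divff// gt_eqF.
move: (normc (f x)) (normc (g x)) (t^-1) ti0 tV => a b s ti0 tV.
have -> : t / 2 * a ^+ 2 + s / 2 * b ^+ 2 = a * b + s / 2 * (t * a - b) ^+ 2.
  have -> : s / 2 * (t * a - b) ^+ 2 =
    t * s * t / 2 * a ^+ 2 - t * s * a * b + s / 2 * b ^+ 2 by field.
  by rewrite tV; field.
by rewrite lerDl mulr_ge0 ?sqr_ge0// divr_ge0// ltW.
Qed.

Lemma cL1M f g : cL2 f -> cL2 g -> cL1 mu (fun x => f x * g x).
Proof.
move=> [mf foo] [mg goo]; split; first exact: cmeasM.
apply: le_lt_trans (nintM_le mf mg ltr01) _.
by rewrite lte_add_pinfty// lte_mul_pinfty// lee_fin.
Qed.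

Definition norm2 f : R := Num.sqrt (fine (n2 f)).

Lemma norm2_ge0 f : 0 <= norm2 f. Proof. exact: sqrtr_ge0. Qed.

Lemma norm2_sqr f : cL2 f -> n2 f = (norm2 f ^+ 2)%:E.
Proof. by move=> f2; rewrite sqr_sqrtr ?fineK ?n2_fin// fine_ge0// n2_ge0. Qed.

Lemma cauchy_schwarz f g : cL2 f -> cL2 g ->
  (nint mu (fun x => (f x * g x)%R) <= (norm2 f * norm2 g)%:E)%E.
Proof.
move=> f2 g2; have fg1 := cL1M f2 g2.
rewrite -(fineK (nint_fin fg1)) lee_fin; set A := fine _.
have b0 := norm2_ge0 f; have c0 := norm2_ge0 g.
have H t : 0 < t -> A <= t / 2 * norm2 f ^+ 2 + t^-1 / 2 * norm2 g ^+ 2.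
  move=> t0; have := nintM_le (proj1 f2) (proj1 g2) t0.
  by rewrite !norm2_sqr// -!EFinM -EFinD -(fineK (nint_fin fg1)) lee_fin.
set b := norm2 f in b0 H *; set c := norm2 g in c0 H *.
(* The optimal weight [c / b] may vanish or have a zero denominator. Both norms are raised by a
   small [e'], whose total cost is controlled by [e' * (b + c) <= e]. *)
apply/ler_addgt0Pl => e e0.
have [e' e'E] : exists e', e' = e / (b + c + 1) by exists (e / (b + c + 1)).
have bc0 : 0 < b + c + 1 by rewrite ltr_wpDl// addr_ge0.
have e'0 : 0 < e' by rewrite e'E divr_gt0.
have be0 : 0 < b + e' by rewrite ltr_wpDl.
have ce0 : 0 < c + e' by rewrite ltr_wpDl.
apply: le_trans (H ((c + e') / (b + e')) (divr_gt0 ce0 be0)) _.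
have ee : e' * (b + c) <= e.
  rewrite e'E mulrAC ler_pdivrMr// ler_pM2l//.
  by rewrite lerDl.
have h1 : (c + e') / (b + e') / 2 * b ^+ 2 <= (c + e') * b / 2.
  rewrite (_ : _ / 2 * _ = (c + e') * b / 2 * (b / (b + e'))); last by field; rewrite gt_eqF.
  rewrite ler_piMr//; first by rewrite !mulr_ge0// ltW.
  by rewrite ler_pdivrMr// mul1r lerDl ltW.
have h2 : ((c + e') / (b + e'))^-1 / 2 * c ^+ 2 <= (b + e') * c / 2.
  rewrite invf_div (_ : _ / 2 * _ = (b + e') * c / 2 * (c / (c + e'))); last by field; rewrite gt_eqF.
  rewrite ler_piMr//; first by rewrite !mulr_ge0// ltW.
  by rewrite ler_pdivrMr// mul1r lerDl ltW.
apply: le_trans (lerD h1 h2) _; nra.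
Qed.

Lemma fatou_le (F : nat -> T -> R) (f : T -> R) (M : \bar R) :
  (forall n, measurable_fun setT (F n)) -> measurable_fun setT f ->
  (forall n x, 0 <= F n x) -> (forall x, 0 <= f x) ->
  {ae mu, forall x, F^~ x @ \oo --> f x} ->
  (\forall n \near \oo, (\int[mu]_x (F n x)%:E <= M)%E) ->
  (\int[mu]_x (f x)%:E <= M)%E.
Proof.
move=> mF mf F0 f0 Ff FM.
have mFE n : measurable_fun setT (fun x => (F n x)%:E) by exact/measurable_EFinP.
have F0E n x : setT x -> (0 <= (F n x)%:E)%E by rewrite lee_fin.
have := fatou mu measurableT mFE F0E.
have G0 x : (0 <= limn_einf (fun n => (F n x)%:E))%E.
  rewrite limn_einf_lim; apply: lime_ge; first exact: is_cvg_einfs.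
  by apply: nearW => n; apply: le_ereal_inf_tmp => _ [m _ <-]; rewrite lee_fin.
pose G x := limn_einf (fun n => (F n x)%:E).
have -> : (\int[mu]_x limn_einf (fun n => (F n x)%:E) = \int[mu]_x (f x)%:E)%E.
  apply: (@ge0_ae_eq_integral _ _ _ mu setT G) => //.
  (* Measurability of the lower limit is read off that of the upper limit of the negatives. *)
  - have -> : G = fun x => (- limn_esup (fun n => (- (F n x)%:E)))%E.
      apply/funext => x; rewrite -limn_einfN; congr limn_einf; apply/funext => n /=.
      by rewrite opprK.
    apply: measurableT_comp => //; apply: measurable_fun_limn_esup => n.
    exact: measurableT_comp.
  - exact/measurable_EFinP.
  - by move=> x _; exact: G0.
  - by move=> x _; rewrite lee_fin.
  - apply: filterS Ff => x Ffx _.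
    have Ffx' : (fun n => (F n x)%:E) @ \oo --> (f x)%:E by apply: cvg_EFin => //; exact: nearW.
    by rewrite /G (cvg_limn_einf_sup Ffx').1.
move=> /le_trans; apply.
rewrite limn_einf_lim; apply: lime_le; first exact: is_cvg_einfs.
apply: filterS FM => n FM; apply: le_trans FM.
by apply: ereal_inf_lbound; exists n => /=.
Qed.

End SquareIntegrable.

(** * Invariance of Lebesgue measure under translation and reflection *)

Section LebesgueInvariance.
Variable R : realType.
Local Notation mu := (@lebesgue_measure R).

Section Invariant.
Variable phi : R -> R.
Hypothesis mphi : measurable_fun setT (phi : measurableTypeR R -> measurableTypeR R).
Hypothesis phi_mu : forall A : set R, measurable A ->
  pushforward mu (phi : measurableTypeR R -> measurableTypeR R) A = mu A.

Lemma ge0_integral_invariant (h : R -> \bar R) : measurable_fun setT h ->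
  (forall x, (0 <= h x)%E) -> (\int[mu]_x h (phi x) = \int[mu]_x h x)%E.
Proof.
move=> mh h0; have -> : (\int[mu]_x h x =
    \int[pushforward mu (phi : measurableTypeR R -> measurableTypeR R)]_x h x)%E.
  by apply: eq_measure_integral => A mA _; exact/esym/phi_mu.
by rewrite ge0_integral_pushforward.
Qed.

Lemma integral_invariant (h : R -> \bar R) : measurable_fun setT h ->
  (\int[mu]_x h (phi x) = \int[mu]_x h x)%E.
Proof.
move=> mh; rewrite integralE [RHS]integralE; congr (_ - _)%E.
  rewrite -(ge0_integral_invariant (measurable_funepos mh))//.
  by apply: eq_integral => x _; rewrite ?funeposE ?funenegE.
rewrite -(ge0_integral_invariant (measurable_funeneg mh))//.
by apply: eq_integral => x _; rewrite ?funeposE ?funenegE.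
Qed.

Lemma cint_invariant (f : R -> R[i]) : cmeas f -> cint mu (fun x => f (phi x)) = cint mu f.
Proof.
move=> [fR fI]; apply: complex_eq; congr fine.
  by apply: (integral_invariant (h := fun x => (Re (f x))%:E)); exact/measurable_EFinP.
by apply: (integral_invariant (h := fun x => (Im (f x))%:E)); exact/measurable_EFinP.
Qed.

Lemma nint_invariant (f : R -> R[i]) : cmeas f -> nint mu (fun x => f (phi x)) = nint mu f.
Proof. by move=> mf; apply: (integral_invariant (h := fun x => (normc (f x))%:E)); exact: mnormc. Qed.

Lemma n2_invariant (f : R -> R[i]) : cmeas f -> n2 mu (fun x => f (phi x)) = n2 mu f.
Proof. by move=> mf; apply: (integral_invariant (h := fun x => (normc (f x) ^+ 2)%:E)); exact: msqr. Qed.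

Lemma cmeas_invariant (f : R -> R[i]) : cmeas (f : measurableTypeR R -> R[i]) ->
  cmeas (fun x : measurableTypeR R => f (phi x)).
Proof. by move=> mf; apply: cmeas_comp mf _. Qed.

Lemma cL1_invariant (f : R -> R[i]) : cL1 mu f -> cL1 mu (fun x => f (phi x)).
Proof. by move=> [mf foo]; split; [exact: cmeas_invariant|rewrite nint_invariant]. Qed.

End Invariant.

Lemma measurable_shift (c : R) :
  measurable_fun setT ((fun x => x + c) : measurableTypeR R -> measurableTypeR R).
Proof. by apply: measurable_funD. Qed.

(** The pushforward agrees with Lebesgue measure on half-open intervals, and these determine the
    measure. *)
Lemma lebesgue_measureD (c : R) (A : set R) : measurable A ->
  pushforward mu ((fun x => x + c) : measurableTypeR R -> measurableTypeR R) A = mu A.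
Proof.
move=> mA.
pose mphi := isMeasurableFun.Build _ _ _ _ _ (measurable_shift c).
pose phi : {mfun measurableTypeR R >-> measurableTypeR R} := 
  HB.pack ((fun x => x + c) : measurableTypeR R -> measurableTypeR R) mphi.
apply/esym.
apply: (lebesgue_measure_unique (mu := pushforward mu phi)) => //= _ [[a b]] _ <-.
rewrite /pushforward (_ : _ @^-1` _ = `]a - c, b - c]%classic); last first.
  by apply/seteqP; split => x /=; rewrite !in_itv/= ltrBlDr lerBrDr.
rewrite !lebesgue_measure_itv/= !lte_fin ltrD2r.
by case: ifP => // _; rewrite -!EFinB; congr (_%:E); ring.
Qed.

Lemma measurable_opp :
  measurable_fun setT ((fun x => - x) : measurableTypeR R -> measurableTypeR R).
Proof. by apply: measurableT_comp. Qed.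

Lemma ge0_integral_shift (c : R) (h : R -> \bar R) : measurable_fun setT h ->
  (forall x, (0 <= h x)%E) -> (\int[mu]_x h (x + c)%R = \int[mu]_x h x)%E.
Proof. exact: ge0_integral_invariant (measurable_shift c) (@lebesgue_measureD c) h. Qed.

(** Serves to discard the single point where a one-sided kernel jumps, or where two half-lines
    meet. *)
Lemma ae_off_point (c : R) (P : R -> Prop) : (forall x, x != c -> P x) ->
  {ae mu, forall x, P x}.
Proof.
move=> cP; exists [set c]; split => //; first by rewrite lebesgue_measure_set1.
by move=> x /= Px; apply/eqP; apply: contra_notT Px => /cP.
Qed.

End LebesgueInvariance.

(** * Calculus of complex functions on the line *)

Section ComplexDerivative.
Variable R : realType.
Implicit Types (F G f g : R -> R[i]) (u v : R -> R).

Lemma is_derive1_chain u v (x du dv : R) : is_derive x 1 u du -> is_derive (u x) 1 v dv ->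
  is_derive x 1 (fun t => v (u t)) (dv * du).
Proof.
move=> [ud <-] [vd <-].
have df : differentiable u x by exact/derivable1_diffP.
have dg : differentiable v (u x) by exact/derivable1_diffP.
apply: DeriveDef.
  by apply/derivable1_diffP; exact: differentiable_comp.
by rewrite -!derive1E -derive1_comp.
Qed.

Lemma is_derive_linear (a : R) (x : R) : is_derive x 1 (fun t => a * t) a.
Proof.
apply: (is_derive_eq (is_deriveZ a (is_derive_id x (1 : R)))).
by rewrite /GRing.scale /= mulr1.
Qed.

Lemma is_derive_mul u v (x du dv : R) : is_derive x 1 u du -> is_derive x 1 v dv ->
  is_derive x 1 (fun t => u t * v t) (u x * dv + v x * du).
Proof. by move=> hu hv; exact: is_deriveM. Qed.

Definition cderive F f := forall x : R,
  is_derive x 1 (fun t => Re (F t)) (Re (f x)) /\ is_derive x 1 (fun t => Im (F t)) (Im (f x)).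

Definition ccontinuous f := continuous (fun x => Re (f x)) /\ continuous (fun x => Im (f x)).

Lemma cderive_eq F f g : cderive F f -> f =1 g -> cderive F g.
Proof. by move=> Ff /funext <-. Qed.

Lemma cderive_continuous F f : cderive F f -> ccontinuous F.
Proof.
move=> Ff; split=> x; apply/differentiable_continuous/derivable1_diffP.
  by have [[d _] _] := Ff x.
by have [_ [d _]] := Ff x.
Qed.

Lemma ccontinuous_cmeas f : ccontinuous f -> cmeas f.
Proof. by move=> [fR fI]; split; exact: continuous_measurable_fun. Qed.

Lemma ccontinuousM f g : ccontinuous f -> ccontinuous g -> ccontinuous (fun x => f x * g x).
Proof.
move=> [f1 f2] [g1 g2]; split=> x.
  rewrite (_ : (fun x => Re _) = fun x => Re (f x) * Re (g x) - Im (f x) * Im (g x)).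
    by apply: cvgB; apply: cvgM; [exact: f1|exact: g1|exact: f2|exact: g2].
  by apply/funext => y; rewrite cReM.
rewrite (_ : (fun x => Im _) = fun x => Re (f x) * Im (g x) + Im (f x) * Re (g x)).
  by apply: cvgD; apply: cvgM; [exact: f1|exact: g2|exact: f2|exact: g1].
by apply/funext => y; rewrite cImM.
Qed.

Lemma ccontinuousD f g : ccontinuous f -> ccontinuous g -> ccontinuous (fun x => f x + g x).
Proof.
move=> [f1 f2] [g1 g2]; split=> x.
  rewrite (_ : (fun x => Re _) = fun x => Re (f x) + Re (g x)).
    by apply: cvgD; [exact: f1|exact: g1].
  by apply/funext => y; rewrite cReD.
rewrite (_ : (fun x => Im _) = fun x => Im (f x) + Im (g x)).
  by apply: cvgD; [exact: f2|exact: g2].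
by apply/funext => y; rewrite cImD.
Qed.

Lemma ccontinuous_cst c : ccontinuous (fun=> c).
Proof. by split; exact: cst_continuous. Qed.

Lemma cderiveM F G f g : cderive F f -> cderive G g ->
  cderive (fun x => F x * G x) (fun x => f x * G x + F x * g x).
Proof.
move=> Ff Gg x; have [f1 f2] := Ff x; have [g1 g2] := Gg x; split.
  rewrite (_ : (fun x => Re _) = (fun x => Re (F x) * Re (G x)) - (fun x => Im (F x) * Im (G x))).
    apply: is_derive_eq (is_deriveB (is_derive_mul f1 g1) (is_derive_mul f2 g2)) _.
    by rewrite cReD !cReM; ring.
  by apply/funext => y; rewrite cReM.
rewrite (_ : (fun x => Im _) = (fun x => Re (F x) * Im (G x)) + (fun x => Im (F x) * Re (G x))).
  apply: is_derive_eq (is_deriveD (is_derive_mul f1 g2) (is_derive_mul f2 g1)) _.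
  by rewrite cImD !cImM; ring.
by apply/funext => y; rewrite cImM.
Qed.

Lemma cderive_cst c : cderive (fun=> c) (fun=> 0).
Proof. by move=> x; split; exact: is_derive_cst. Qed.

Lemma cderiveZ c F f : cderive F f -> cderive (fun x => c * F x) (fun x => c * f x).
Proof.
move=> Ff; apply: cderive_eq (cderiveM (cderive_cst c) Ff) _ => x.
by rewrite mul0r add0r.
Qed.

Lemma cderive_cexp (c : R[i]) :
  cderive (fun x => cexp (c * x%:C)) (fun x => c * cexp (c * x%:C)).
Proof.
have cE (x : R) : cexp (c * x%:C) = (expR (Re c * x) * cos (Im c * x)) +i* (expR (Re c * x) * sin (Im c * x)).
  apply: complex_eq; rewrite /cexp ?cReM ?cImM /= !mulr0 ?mul0r ?subr0 ?addr0 ?add0r.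
    by [].
  by [].
move=> x; have eR := is_derive1_chain (is_derive_linear (Re c) x) (is_derive_expR _).
have eC := is_derive1_chain (is_derive_linear (Im c) x) (is_derive_cos _).
have eS := is_derive1_chain (is_derive_linear (Im c) x) (is_derive_sin _).
split.
  rewrite (_ : (fun t => _) = fun t => expR (Re c * t) * cos (Im c * t)).
    apply: is_derive_eq (is_derive_mul eR eC) _.
    by rewrite cReM cE /=; ring.
  by apply/funext => y; rewrite cE.
rewrite (_ : (fun t => _) = fun t => expR (Re c * t) * sin (Im c * t)).
  apply: is_derive_eq (is_derive_mul eR eS) _.
  by rewrite cImM cE /=; ring.
by apply/funext => y; rewrite cE.
Qed.

End ComplexDerivative.

(** * Half-line integrals and one-sided exponentials *)

Section HalfLine.
Variable R : realType.
Local Notation mu := (@lebesgue_measure R).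

Lemma ccvg_near (u : nat -> R[i]) l : (\forall n \near \oo, u n = l) -> ccvg u l.
Proof.
move=> ul; split; apply: cvg_near_cst.
  by apply: filterS ul => n ->.
by apply: filterS ul => n ->.
Qed.

Lemma Rintegral_FTC (F f : R -> R) a b : a < b -> (forall x : R, is_derive x 1 F (f x)) ->
  continuous f -> \int[mu]_(x in `]a, b]) f x = F b - F a.
Proof.
move=> ab Ff cf.
have cF : continuous F.
  by move=> x; apply/differentiable_continuous/derivable1_diffP; case: (Ff x).
rewrite Rintegral_itv_obnd_cbnd; last first.
  apply: integrableS (continuous_compact_integrable (@segment_compact R a b) _) => //.
    by apply: subset_itvr; rewrite bnd_simp.
  exact: continuous_subspaceT.
rewrite /Rintegral (continuous_FTC2 (F := F) ab)//.
- exact: continuous_subspaceT.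
- split.
  + by move=> x _; case: (Ff x).
  + by apply: cvg_at_right_filter; exact: cF.
  + by apply: cvg_at_left_filter; exact: cF.
- by move=> x _; rewrite derive1E; case: (Ff x).
Qed.

Lemma cint_interval (f : R -> R[i]) (a b : R) :
  cint mu (fun x => ind R ((a < x) && (x <= b)) * f x) =
  (\int[mu]_(x in `]a, b]) Re (f x)) +i* (\int[mu]_(x in `]a, b]) Im (f x)).
Proof.
rewrite [X in X +i* _]Rintegral_mkcond [X in _ +i* X]Rintegral_mkcond; apply: complex_eq; apply: eq_Rintegral => x _.
  rewrite patchE mem_setE in_itv/=.
  by case: ifP => _; rewrite ?indT ?indF ?mul1r ?mul0r.
rewrite patchE mem_setE in_itv/=.
by case: ifP => _; rewrite ?indT ?indF ?mul1r ?mul0r.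
Qed.

Lemma cint_halfline (F f : R -> R[i]) (m : R) : cderive F f -> ccontinuous f ->
  ccvg (fun n => F (m + n.+1%:R)) 0 ->
  cL1 mu (fun x => ind R (m < x) * f x) ->
  cint mu (fun x => ind R (m < x) * f x) = - F m.
Proof.
move=> Ff [cfR cfI] F0 fL.
(* The upper end is [m + n.+1] rather than [m + n], so that the interval is nondegenerate already at
   [n = 0], as [Rintegral_FTC] requires. *)
pose G n x := ind R ((m < x) && (x <= m + n.+1%:R)) * f x.
have mf : cmeas f by exact: ccontinuous_cmeas.
have GI n : cint mu (G n) = F (m + n.+1%:R) - F m.
  have mn : m < m + n.+1%:R by rewrite ltrDl.
  rewrite cint_interval; apply: complex_eq; rewrite ?cReD ?cReN ?cImD ?cImN /=.
    by rewrite (Rintegral_FTC mn (fun x => (Ff x).1)).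
  by rewrite (Rintegral_FTC mn (fun x => (Ff x).2)).
have : ccvg (fun n => cint mu (G n)) (- F m).
  rewrite -[- F m]add0r; have -> : (fun n => cint mu (G n)) = (fun n => F (m + n.+1%:R) - F m).
    by apply/funext => n.
  by apply: ccvgD => //; exact: ccvg_cst.
apply: ccvg_unique.
have mI : cmeas (fun x : R => ind R (m < x)) by exact: cmeas_lt.
refine (@ccvg_dominated R _ _ mu G _ (fun x => normc (ind R (m < x) * f x)) _ _ _ _ _ _).
- move=> n; apply: cmeasM => //; apply: cmeas_ind; apply: measurable_and.
    exact: measurable_fun_ltr.
  exact: measurable_fun_ler.
- exact: cmeasM.
- by apply: measurable_normc; exact: cmeasM.
- by case: fL.
- move=> n x; rewrite /G ind_and mulrAC normcM -[leRHS]mulr1.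
  by rewrite ler_wpM2l ?normc_ge0// normc_ind_le1.
- apply: aeW => x; apply: ccvg_near.
  have [mx|mx] := ltP m x; last by apply: nearW => n; rewrite /G ltNge mx.
  near=> n; rewrite /G mx; suff -> : x <= m + n.+1%:R by [].
  rewrite -lerBlDl; apply: (@le_trans _ _ n%:R); last by rewrite ler_nat.
  by near: n; exact: nbhs_infty_ger.
Unshelve. all: by end_near. Qed.

Lemma measurable_expRM (a : R) : measurable_fun setT (fun x : R => expR (a * x)).
Proof. by apply: measurableT_comp => //; apply: measurable_funM. Qed.

(** Up to the factor [a^-1], the integrand is the density of the exponential law of rate [a], whose
    integrability is known. *)
Lemma nint_expR (a : R) : 0 < a ->
  (\int[mu]_x ((0 < x)%R%:R * expR (- a * x))%:E < +oo)%E.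
Proof.
move=> a0.
have /integrableP[_ H] := integrableZl measurableT a^-1 (integrable_exponential_pdf a0).
apply: le_lt_trans H; apply: ge0_le_integral => //.
- apply/measurable_EFinP; apply: measurable_funM; last exact: (measurable_expRM (- a)).
  by apply: (measurableT_comp (f := fun b : bool => b%:R : R)) => //; exact: measurable_fun_ltr.
- apply: measurableT_comp => //; apply: emeasurable_funM => //.
  by apply/measurable_EFinP; exact: measurable_exponential_pdf.
- move=> x _; rewrite -EFinM abse_EFin lee_fin.
  have [x0|x0] := ltP 0 x; last by rewrite mul0r.
  rewrite (exponential_pdfE _ (ltW x0)) /= mulKf ?gt_eqF// mul1r.
  exact: ler_norm.
Qed.

Lemma cL1_cexp (c : R[i]) : 0 < Re c -> cL1 mu (fun x => ind R (0 < x) * cexp (- c * x%:C)).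
Proof.
move=> c0; apply: (@cL1_le_real _ _ _ mu _ (fun x => (0 < x)%R%:R * expR (- Re c * x))).
- apply: cmeasM; first exact: cmeas_lt.
  by apply: ccontinuous_cmeas; apply: cderive_continuous; exact: cderive_cexp.
- apply: measurable_funM; last exact: (measurable_expRM (- Re c)).
  by apply: (measurableT_comp (f := fun b : bool => b%:R : R)) => //; exact: measurable_fun_ltr.
- exact: nint_expR.
- move=> x; rewrite normcM normc_ind normc_cexp cReM cReN /= mulr0 subr0.
  by [].
Qed.

Lemma cint_cexp (c : R[i]) : 0 < Re c ->
  cint mu (fun x => ind R (0 < x) * cexp (- c * x%:C)) = c^-1.
Proof.
move=> c0; have cn0 : c != 0 by apply: contraTneq c0 => ->; rewrite ltxx.
rewrite (@cint_halfline (fun x => - c^-1 * cexp (- c * x%:C)) (fun x => cexp (- c * x%:C)))//.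
- by rewrite mulr0 cexp0 mulr1 opprK.
- apply: cderive_eq (cderiveZ _ (cderive_cexp (- c))) _ => x.
  by rewrite mulrA mulrNN mulVf// mul1r.
- by apply: cderive_continuous; exact: cderive_cexp.
- rewrite -(mulr0 (- c^-1)); apply: ccvgZ.
  apply: (ccvg_normc (e := fun n => expR (- (Re c * n.+1%:R)))).
    by move=> n; rewrite subr0 normc_cexp add0r cReM cReN /= mulr0 subr0 mulNr.
  apply: (cvg_comp _ (fun x => expR (- x)) (G := +oo)); last exact: cvgr_expR.
  apply/cvgryPge => A; near=> n; rewrite -ler_pdivrMl//.
  apply: (@le_trans _ _ n%:R); last by rewrite ler_nat.
  by near: n; exact: nbhs_infty_ger.
- exact: cL1_cexp.
Unshelve. all: by end_near. Qed.

End HalfLine.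

(** * The Poisson kernel and the Abel weight *)

Section Poisson.
Variable R : realType.
Local Notation mu := (@lebesgue_measure R).

Implicit Types e x t xi : R.

(** The Poisson kernel normalised to total mass [2 * pi]: it is the integral of [exp (- e |xi|)]
    against the character [exp (- i t xi)]. *)
Definition poisson (e t : R) : R := 2 * e / (e ^+ 2 + t ^+ 2).

Lemma poisson_ge0 e t : 0 < e -> 0 <= poisson e t.
Proof. by move=> e0; rewrite divr_ge0 ?mulr_ge0 ?addr_ge0 ?sqr_ge0// ltW. Qed.

Lemma poissonN e t : poisson e (- t) = poisson e t.
Proof. by rewrite /poisson sqrrN. Qed.

Lemma poisson_den (e t : R) : 0 < e -> 0 < e ^+ 2 + t ^+ 2.
Proof. by move=> e0; rewrite ltr_pwDl ?exprn_gt0// sqr_ge0. Qed.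

Lemma is_derive_poisson e (t : R) : 0 < e ->
  is_derive t 1 (fun t => 2 * atan (e^-1 * t)) (poisson e t).
Proof.
move=> e0.
have h := is_derive1_chain (is_derive_linear e^-1 t) (is_derive1_atan _).
apply: is_derive_eq (is_deriveZ (2 : R) h) _.
rewrite /GRing.scale /= /poisson; field.
by rewrite !gt_eqF ?poisson_den//.
Qed.

Lemma continuous_poisson e : 0 < e -> continuous (poisson e).
Proof.
move=> e0 t; rewrite /poisson; apply: cvgM; first exact: cvg_cst.
apply: cvgV; first by rewrite gt_eqF ?poisson_den.
by apply: cvgD; [exact: cvg_cst|exact: exprn_continuous].
Qed.

Lemma measurable_poisson e : 0 < e -> measurable_fun setT (poisson e).
Proof. by move=> e0; apply: continuous_measurable_fun; exact: continuous_poisson. Qed.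

Lemma integral_poisson e : 0 < e -> (\int[mu]_t (poisson e t)%:E = (2 * pi)%:E)%E.
Proof.
move=> e0; rewrite ge0_symfun_integralT; last 3 first.
- by move=> t; exact: poisson_ge0.
- exact: continuous_poisson.
- by move=> t; rewrite /= poissonN.
have cF (x : R) : {for x, continuous (fun t => 2 * atan (e^-1 * t))}.
  by apply/differentiable_continuous/derivable1_diffP; case: (is_derive_poisson x e0).
rewrite -set_itvcy (ge0_continuous_FTC2y (F := fun t => 2 * atan (e^-1 * t)) (l := pi)).
- by rewrite mulr0 atan0 mulr0 sube0 -EFinM.
- by move=> x _; exact: poisson_ge0.
- by apply: continuous_subspaceT; exact: continuous_poisson.
- have -> : pi = 2 * (pi / 2) :> R by field.
  apply: cvgM; first exact: cvg_cst.
  apply: (cvg_comp (fun t => e^-1 * t) (@atan R) (G := +oo)); last exact: cvgy_atan.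
  by apply: gt0_cvgMry; rewrite ?invr_gt0//; exact: cvg_id.
- by move=> x _; case: (is_derive_poisson x e0).
- by apply: cvg_at_right_filter; exact: cF.
- by move=> x _; rewrite derive1E; case: (is_derive_poisson x e0).
Qed.

Lemma integral_poisson_shift e x : 0 < e ->
  (\int[mu]_t (poisson e (x - t))%:E = (2 * pi)%:E)%E.
Proof.
move=> e0; rewrite -(integral_poisson e0).
rewrite -(ge0_integral_shift (- x) (h := fun t => (poisson e t)%:E)).
- by apply: eq_integral => t _; rewrite -poissonN opprB.
- by apply/measurable_EFinP; exact: measurable_poisson.
- by move=> t; rewrite lee_fin poisson_ge0.
Qed.

Lemma integral_poisson_shiftr e x : 0 < e ->
  (\int[mu]_t (poisson e (t - x))%:E = (2 * pi)%:E)%E.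
Proof.
move=> e0; rewrite -(integral_poisson_shift x e0); apply: eq_integral => t _.
by rewrite -poissonN opprB.
Qed.

Lemma measurable_poisson_rev e x : 0 < e -> measurable_fun setT (fun t : R => poisson e (x - t)).
Proof.
by move=> e0; apply: (measurableT_comp (measurable_poisson e0)); exact: measurable_funB.
Qed.

Lemma cL1_poisson e x : 0 < e -> cL1 mu (fun t => (poisson e (x - t))%:C).
Proof.
move=> e0; have mp := measurable_poisson_rev x e0.
apply: (@cL1_le_real _ _ _ mu _ (fun t => poisson e (x - t))) => //.
- by rewrite integral_poisson_shift// ltry.
- by move=> t; rewrite normc_real ger0_norm// poisson_ge0.
Qed.

(** The Abel summation factor: it makes frequency integrals absolutely convergent and tends to [1]
    as [e] tends to [0]. *)
Definition damp (e xi : R) : R[i] := (expR (- e * `|xi|))%:C.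

Lemma cmeas_damp e : cmeas (damp e).
Proof.
apply: cmeas_real; apply: (measurableT_comp (f := expR)) => //.
by apply: measurable_funM => //; exact: measurableT_comp.
Qed.

Lemma normc_damp e xi : 0 < e -> normc (damp e xi) <= 1.
Proof.
move=> e0; rewrite normc_real ger0_norm ?expR_ge0// -expR0 ler_expR mulNr.
by rewrite oppr_le0 mulr_ge0// ltW.
Qed.

Lemma damp_fourier e t : 0 < e ->
  cL1 mu (fun xi => damp e xi * cexp (- 'i%C * (t * xi)%:C)) /\
  cint mu (fun xi => damp e xi * cexp (- 'i%C * (t * xi)%:C)) = (poisson e t)%:C.
Proof.
(* Each half-line contributes a one-sided exponential, with exponents [e + i t] and [e - i t]; the
   sum of the inverses of the two exponents is the Poisson kernel. *)
move=> e0; pose c := e +i* t; pose c' := e +i* (- t).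
pose p (d : R[i]) (x : R) := ind R (0 < x) * cexp (- d * x%:C).
have p1 d : 0 < Re d -> cL1 mu (p d) by exact: cL1_cexp.
have pN1 d : 0 < Re d -> cL1 mu (fun x => p d (- x)).
  by move=> d0; apply: (cL1_invariant (@measurable_opp R) (@lebesgue_measureN R)); exact: p1.
have mf : cmeas (fun xi => damp e xi * cexp (- 'i%C * (t * xi)%:C)).
  apply: cmeasM; first exact: cmeas_damp.
  apply: cmeas_cexp; apply: cmeasM; first exact: cmeas_cst.
  by apply: cmeas_real; exact: measurable_funM.
(* At [0] both one-sided exponentials vanish while the damping factor is [1], so the equality holds
   off [0] only. *)
have fE : {ae mu, forall xi, damp e xi * cexp (- 'i%C * (t * xi)%:C) = p c xi + p c' (- xi)}.
  apply: (@ae_off_point _ 0) => x x0; rewrite /p /damp oppr_gt0.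
  have dE (s : R) : (expR s)%:C = cexp s%:C.
    by rewrite /cexp /= cos0 sin0; apply: complex_eq; rewrite /= ?mulr1 ?mulr0 ?mul0r ?subr0 ?addr0.
  rewrite dE -cexpD.
  have [x_lt0|x_gt0|x_eq0] := ltgtP x 0; last by rewrite x_eq0 eqxx in x0.
    rewrite indF mul0r add0r indT mul1r; congr cexp.
    by rewrite ltr0_norm//; apply: complex_eq; rewrite ?cReD ?cImD ?cReM ?cImM /=; ring.
  rewrite indF mul0r addr0 indT mul1r; congr cexp.
  by rewrite gtr0_norm//; apply: complex_eq; rewrite ?cReD ?cImD ?cReM ?cImM /=; ring.
have L := cL1D (p1 c e0) (pN1 c' e0).
split; first exact: (@ae_eq_cL1 _ _ _ mu _ _ mf L fE).
rewrite (@ae_eq_cint _ _ _ mu _ _ mf (proj1 L) fE).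
rewrite cintD; [|exact: p1|exact: pN1].
rewrite (cint_invariant (@measurable_opp R) (@lebesgue_measureN R) (f := p c')); last by case: (p1 c' e0).
rewrite !cint_cexp//.
have ec : c * c' = (e ^+ 2 + t ^+ 2)%:C.
  by apply: complex_eq; rewrite ?cReM ?cImM /c /c' /=; ring.
have c0 : c != 0 by apply: contraTneq e0 => c0; rewrite -[e]/(Re c) c0 ltxx.
have c'0 : c' != 0 by apply: contraTneq e0 => c'0; rewrite -[e]/(Re c') c'0 ltxx.
have invD (a b : R[i]) : a != 0 -> b != 0 -> a^-1 + b^-1 = (a + b) / (a * b).
  by move=> a0 b0; field; rewrite a0 b0.
rewrite invD//.
rewrite ec /poisson rmorphM fmorphV; congr (_ / _).
by apply: complex_eq; rewrite /c /c' ?cReM ?cImM ?cReD ?cImD /=; ring.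
Qed.

End Poisson.

(** * The Fourier transform *)

Section FourierL1.
Variable R : realType.
Local Notation mu := (@lebesgue_measure R).
Local Notation RT := (measurableTypeR R).
Implicit Types (h k : RT -> R[i]) (x xi e : R).

Definition fker (x xi : R) : R[i] := cexp (- 'i%C * (x * xi)%:C).

Lemma fkerE x xi : fker x xi = cexp ('i%C * (- (x * xi))%:C).
Proof. by rewrite /fker rmorphN mulrN mulNr. Qed.

Lemma normc_fker x xi : normc (fker x xi) = 1.
Proof. by rewrite fkerE normc_cexp_i. Qed.

Lemma normc_mul_fker (z : R[i]) x xi : normc (z * fker x xi) = normc z.
Proof. by rewrite normcM normc_fker mulr1. Qed.

Lemma conjc_fker x xi : conjc (fker x xi) = fker (- x) xi.
Proof. by rewrite !fkerE conjc_cexp_i mulNr. Qed.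

Lemma fkerD x y xi : fker (x + y) xi = fker x xi * fker y xi.
Proof. by rewrite !fkerE -cexp_iD mulrDl opprD. Qed.

Lemma cmeas_fker d (T : measurableType d) (u v : T -> R) :
  measurable_fun setT u -> measurable_fun setT v -> cmeas (fun t => fker (u t) (v t)).
Proof.
move=> mu_ mv; apply: cmeas_cexp; apply: cmeasM; first exact: cmeas_cst.
by apply: cmeas_real; exact: measurable_funM.
Qed.

Lemma cmeas_fkerl xi : cmeas (fun x : RT => fker x xi).
Proof. by apply: cmeas_fker. Qed.

Lemma cmeas_fkerr x : cmeas (fun xi : RT => fker x xi).
Proof. by apply: cmeas_fker. Qed.

Lemma cL1_fkerl h xi : cL1 mu h -> cL1 mu (fun x => h x * fker x xi).
Proof.
move=> h1; apply: (cL1_le _ h1); first by apply: cmeasM; [case: h1|exact: cmeas_fkerl].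
by move=> x; rewrite normc_mul_fker.
Qed.

Definition fnorm : R[i] := ((Num.sqrt (2 * pi))^-1)%:C.

Lemma fnorm_sqr : fnorm * fnorm = ((2 * pi)^-1)%:C :> R[i].
Proof.
rewrite /fnorm -rmorphM -invfM -expr2 sqr_sqrtr//.
by rewrite mulr_ge0// pi_ge0.
Qed.

Lemma conjc_fnorm : conjc fnorm = fnorm :> R[i].
Proof. by apply: complex_eq; rewrite /fnorm /= ?oppr0. Qed.

Definition FT h (xi : RT) : R[i] := fnorm * cint mu (fun x => h x * fker x xi).

Lemma cmeas_FT h : cmeas h -> cmeas (FT h).
Proof.
move=> mh; apply: cmeasM; first exact: cmeas_cst.
apply: (@cmeas_cint _ _ RT RT R mu (fun p => h p.2 * fker p.2 p.1)).
apply: cmeasM; first by apply: cmeas_comp mh _.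
by apply: cmeas_fker.
Qed.

Lemma FT_mul h k xi : cL1 mu h -> cL1 mu k ->
  FT h xi * conjc (FT k xi) = ((2 * pi)^-1)%:C *
    cint (pm mu mu) (fun p => (h p.1 * conjc (k p.2)) * fker (p.1 - p.2) xi).
Proof.
move=> h1 k1; rewrite /FT conjcM conjc_fnorm -cint_conjc; last exact: cL1_fkerl.
rewrite mulrACA fnorm_sqr -cint_tensor; last 2 first.
- exact: cL1_fkerl.
- by apply: cL1_conjc; exact: cL1_fkerl.
congr (_ * _); apply: eq_cint => -[x y] /=.
by rewrite conjcM conjc_fker fkerD mulrACA.
Qed.

Lemma cL1_conj_tensor h k : cL1 mu h -> cL1 mu k ->
  cL1 (pm mu mu) (fun p => h p.1 * conjc (k p.2)).
Proof. by move=> h1 k1; apply: (cL1_tensor (b := fun y => conjc (k y))) => //; exact: cL1_conjc. Qed.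

(** With the damping factor, the integral over the frequency and both positions converges
    absolutely. Integrating the frequency first leaves the Poisson kernel of the difference of
    positions. *)
Lemma damp_FT_mul h k e : 0 < e -> cL1 mu h -> cL1 mu k ->
  [/\ cL1 mu (fun xi => damp e xi * (FT h xi * conjc (FT k xi))),
      cL1 (pm mu mu) (fun p => h p.1 * conjc (k p.2) * (poisson e (p.1 - p.2))%:C) &
      cint mu (fun xi => damp e xi * (FT h xi * conjc (FT k xi))) =
      ((2 * pi)^-1)%:C *
      cint (pm mu mu) (fun p => h p.1 * conjc (k p.2) * (poisson e (p.1 - p.2))%:C)].
Proof.
move=> e0 h1 k1; have hk1 := cL1_conj_tensor h1 k1.
have d1 : cL1 mu (damp e).
  have [H _] := damp_fourier 0 e0.
  by apply: (eq_cL1 _ H) => x; rewrite -/(fker 0 x) /fker mul0r mulr0 cexp0 mulr1.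
pose Phi (q : RT * (RT * RT)) :=
  damp e q.1 * (h q.2.1 * conjc (k q.2.2) * fker (q.2.1 - q.2.2) q.1).
have Phi1 : cL1 (pm mu (pm mu mu)) Phi.
  have T1 := cL1_tensor d1 hk1.
  apply: (cL1_le _ T1); last by move=> q; rewrite /Phi normcM normc_mul_fker -normcM.
  rewrite /Phi; under eq_fun do rewrite mulrA.
  apply: cmeasM; first by case: T1.
  apply: cmeas_fker => //; apply: measurable_funB.
    by apply: measurableT_comp.
  by apply: measurableT_comp.
have E1 xi : cint (pm mu mu) (fun p => Phi (xi, p)) =
    (2 * pi)%:C * (damp e xi * (FT h xi * conjc (FT k xi))).
  rewrite /Phi /= cintZ; last first.
    apply: (cL1_le _ hk1); last by move=> p; rewrite normc_mul_fker.
    by apply: cmeasM; [case: hk1|apply: cmeas_fker => //; exact: measurable_funB].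
  rewrite FT_mul//; set I := cint _ _.
  rewrite mulrCA; congr (_ * _).
  rewrite mulrA -rmorphM divff ?mul1r//.
  by rewrite mulf_neq0// gt_eqF// pi_gt0.
have E2 p : cint mu (fun xi => Phi (xi, p)) =
    h p.1 * conjc (k p.2) * (poisson e (p.1 - p.2))%:C.
  have [D1 <-] := damp_fourier (p.1 - p.2) e0.
  rewrite -cintZ//; apply: eq_cint => xi; rewrite /Phi /=.
  by rewrite mulrCA -/(fker _ _).
have pi0 : (2 * pi)%:C != 0 :> R[i].
  by rewrite (inj_eq (@complexI R)) mulf_neq0// gt_eqF// pi_gt0.
have piV : ((2 * pi)^-1)%:C * (2 * pi)%:C = 1 :> R[i] by rewrite fmorphV mulVf.
have L1 := cL1_cint Phi1.
have L2 := cL1_cint (cL1_swap Phi1).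
have S := cint_swap Phi1.
have F1 : cL1 mu (fun xi => (2 * pi)%:C * (damp e xi * (FT h xi * conjc (FT k xi)))).
  by apply: (eq_cL1 _ L1) => xi; exact: E1.
have F2 : cL1 mu (fun xi => damp e xi * (FT h xi * conjc (FT k xi))).
  by apply: eq_cL1 (cL1Z ((2 * pi)^-1)%:C F1) => xi; rewrite mulrA piV mul1r.
split=> //.
  by apply: (eq_cL1 _ L2) => p; exact: E2.
rewrite (eq_cint mu E1) (eq_cint _ E2) cintZ// in S.
by rewrite -S mulrA piV mul1r.
Qed.

(** Schur's test: a product of values at two points is at most the mean of their squares, and the
    Poisson kernel has mass [2 * pi] in each variable, which cancels the prefactor. *)
Lemma plancherel_damped h e : 0 < e -> cL1 mu h -> cL2 mu h ->
  (\int[mu]_xi (expR (- e * `|xi|) * normc (FT h xi) ^+ 2)%:E <= n2 mu h)%E.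
Proof.
move=> e0 h1 h2; have [L1 L2 E] := damp_FT_mul e0 h1 h1.
have nE : (\int[mu]_xi (expR (- e * `|xi|) * normc (FT h xi) ^+ 2)%:E =
    (normc (cint mu (fun xi => damp e xi * (FT h xi * conjc (FT h xi)))))%:E)%E.
  rewrite (eq_cint mu (g := fun xi => (expR (- e * `|xi|) * normc (FT h xi) ^+ 2)%:C)); last first.
    by move=> xi; rewrite mulcJ complexM.
  rewrite cint_real normc_real ger0_norm; last first.
    by apply: Rintegral_ge0 => xi _; rewrite mulr_ge0 ?expR_ge0 ?sqr_ge0.
  rewrite /Rintegral fineK//; have := nint_fin L1.
  congr (_ \is a fin_num); apply: eq_integral => xi _.
  by rewrite mulcJ -complexM normc_real ger0_norm// mulr_ge0 ?expR_ge0 ?sqr_ge0.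
rewrite nE E normcM normc_real ger0_norm; last by rewrite invr_ge0 mulr_ge0// pi_ge0.
rewrite EFinM; have pi0 : 0 < 2 * pi :> R by rewrite mulr_gt0// pi_gt0.
apply: le_trans (lee_wpmul2l _ (le_normc_cint L2)) _; first by rewrite lee_fin invr_ge0 ltW.
have mp : measurable_fun setT (fun p : RT * RT => poisson e (p.1 - p.2)).
  apply: (measurableT_comp (measurable_poisson e0)); exact: measurable_funB.
pose G1 (p : RT * RT) := normc (h p.1) ^+ 2 * poisson e (p.1 - p.2).
pose G2 (p : RT * RT) := normc (h p.2) ^+ 2 * poisson e (p.1 - p.2).
have mh : measurable_fun setT (fun x => normc (h x) ^+ 2).
  by apply: measurable_funX; apply: measurable_normc; case: h1.
have mG1 : measurable_fun setT (EFin \o G1).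
  by apply/measurable_EFinP; apply: measurable_funM => //; exact: (measurableT_comp mh).
have mG2 : measurable_fun setT (EFin \o G2).
  by apply/measurable_EFinP; apply: measurable_funM => //; exact: (measurableT_comp mh).
have G10 p : (0 <= (EFin \o G1) p)%E by rewrite lee_fin mulr_ge0 ?sqr_ge0 ?poisson_ge0.
have G20 p : (0 <= (EFin \o G2) p)%E by rewrite lee_fin mulr_ge0 ?sqr_ge0 ?poisson_ge0.
have msq : measurable_fun setT (fun x => (normc (h x) ^+ 2)%:E) by exact/measurable_EFinP.
have I1 : (\int[pm mu mu]_p (EFin \o G1) p = n2 mu h * (2 * pi)%:E)%E.
  rewrite fubini_tonelli1// /n2 -ge0_integralZr//; last 2 first.
  - by move=> x _; rewrite lee_fin sqr_ge0.
  - by rewrite lee_fin ltW.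
  apply: eq_integral => x _; rewrite /fubini_F /G1 /=.
  under eq_integral do rewrite EFinM.
  rewrite ge0_integralZl ?integral_poisson_shift//.
  - by apply/measurable_EFinP; exact: measurable_poisson_rev.
  - by move=> y _; rewrite lee_fin poisson_ge0.
  - by rewrite lee_fin sqr_ge0.
have I2 : (\int[pm mu mu]_p (EFin \o G2) p = n2 mu h * (2 * pi)%:E)%E.
  rewrite fubini_tonelli2// /n2 -ge0_integralZr//; last 2 first.
  - by move=> x _; rewrite lee_fin sqr_ge0.
  - by rewrite lee_fin ltW.
  apply: eq_integral => x _; rewrite /fubini_G /G2 /=.
  under eq_integral do rewrite EFinM.
  rewrite ge0_integralZl ?integral_poisson_shiftr//.
  - apply/measurable_EFinP; apply: (measurableT_comp (measurable_poisson e0)).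
    exact: measurable_funB.
  - by move=> y _; rewrite lee_fin poisson_ge0.
  - by rewrite lee_fin sqr_ge0.
have H : (nint (pm mu mu) (fun p => (h p.1 * conjc (h p.2) * (poisson e (p.1 - p.2))%:C)%R) <=
    \int[pm mu mu]_p (2^-1%:E * ((EFin \o G1) p + (EFin \o G2) p)))%E.
  apply: ge0_le_integral => //.
  - by move=> p _; rewrite lee_fin normc_ge0.
  - by apply: mnormc; case: L2.
  - by apply: emeasurable_funM => //; exact: emeasurable_funD.
  move=> p _; rewrite /= -EFinD -EFinM lee_fin !normcM normc_conjc normc_real.
  rewrite (ger0_norm (poisson_ge0 _ e0)) /G1 /G2 -mulrDl mulrA.
  apply: ler_wpM2r; first exact: poisson_ge0.
  by have := sqr_ge0 (normc (h p.1) - normc (h p.2)); lra.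
apply: le_trans (lee_wpmul2l _ H) _; first by rewrite lee_fin invr_ge0 ltW.
rewrite ge0_integralZl//; last 2 first.
- exact: (emeasurable_funD mG1 mG2).
- by move=> p _; exact: adde_ge0.
rewrite ge0_integralD// I1 I2 -(fineK (n2_fin h2)) -!EFinM lee_fin.
set a := fine _; suff -> : (2 * pi)^-1 * (2^-1 * (a * (2 * pi) + a * (2 * pi))) = a by [].
have p0 : (pi : R) != 0 by rewrite gt_eqF ?pi_gt0.
by move: a (@pi R) p0 => {H E nE pi0} a p p0; field.
Qed.

Lemma damp_cvg xi : (fun n => expR (- n.+1%:R^-1 * `|xi|)) @ \oo --> (1 : R).
Proof.
have h : (fun n => - n.+1%:R^-1 * `|xi|) @ \oo --> - 0 * `|xi|.
  by apply: cvgM; [apply: cvgN; exact: cvg_harmonic|exact: cvg_cst].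
apply: (cvg_comp (fun n => - n.+1%:R^-1 * `|xi|) expR h).
have <- : expR (- 0 * `|xi|) = 1 by rewrite oppr0 mul0r expR0.
exact: continuous_expR.
Qed.

(** The damping is removed by Fatou's lemma along [e = 1 / (n + 1)], so that square-integrability of
    the transform comes out as a conclusion. This inequality is what extends the transform to
    [L^2]. *)
Lemma plancherel_le h : cL1 mu h -> cL2 mu h -> (n2 mu (FT h) <= n2 mu h)%E.
Proof.
move=> h1 h2.
have mF : measurable_fun setT (fun xi => normc (FT h xi) ^+ 2).
  by apply: measurable_funX; apply: measurable_normc; apply: cmeas_FT; case: h1.
apply: (@fatou_le _ _ _ mu (fun n xi => expR (- n.+1%:R^-1 * `|xi|) * normc (FT h xi) ^+ 2)).
- move=> n; apply: measurable_funM => //.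
  by have [m _] := @cmeas_damp R n.+1%:R^-1.
- exact: mF.
- by move=> n x; rewrite mulr_ge0 ?expR_ge0 ?sqr_ge0.
- by move=> x; rewrite sqr_ge0.
- apply: aeW => x; rewrite -[_ ^+ 2 in X in _ --> X]mul1r.
  by apply: cvgM; [exact: damp_cvg|exact: cvg_cst].
- by apply: nearW => n; apply: plancherel_damped => //; rewrite invr_gt0.
Qed.

Lemma cL2_FT h : cL1 mu h -> cL2 mu h -> cL2 mu (FT h).
Proof.
move=> h1 h2; split; first by apply: cmeas_FT; case: h1.
by apply: le_lt_trans (plancherel_le h1 h2) _; case: h2.
Qed.

End FourierL1.

(** * Parseval's identity by Poisson approximation *)

Section Parseval.
Variable R : realType.
Local Notation mu := (@lebesgue_measure R).
Local Notation RT := (measurableTypeR R).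
Implicit Types (h k g : RT -> R[i]) (x xi e : R).

Definition cont_at (g : RT -> R[i]) (x : R) := forall eta : R, 0 < eta ->
  exists2 delta : R, 0 < delta & forall y : R, `|x - y| < delta -> normc (g y - g x) <= eta.

Lemma ccvg_eps (u : nat -> R[i]) l :
  (forall eta : R, 0 < eta -> \forall n \near \oo, normc (u n - l) <= eta) -> ccvg u l.
Proof.
move=> H; split; apply/cvgrPdist_le => eta eta0; apply: filterS (H _ eta0) => n.
  by apply: le_trans; rewrite distrC -cReN -cReD normc_Re.
by apply: le_trans; rewrite distrC -cImN -cImD normc_Im.
Qed.

(** The tail is compared with one fixed integrable kernel, and the factor [e] makes it vanish in the
    limit. *)
Lemma poisson_tail e delta t : 0 < e -> 0 < delta -> delta <= `|t| ->
  poisson e t <= e * (1 + delta ^- 2) * poisson 1 t.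
Proof.
move=> e0 d0 dt; have d20 : 0 < delta ^+ 2 by rewrite exprn_gt0.
have t2 : delta ^+ 2 <= t ^+ 2.
  by rewrite -[t ^+ 2]real_normK ?num_real// lerXn2r// nnegrE// ltW.
have t20 : 0 < t ^+ 2 by exact: lt_le_trans t2.
rewrite /poisson expr1n ler_pdivrMr ?poisson_den//.
have dV : 1 <= delta ^- 2 * t ^+ 2 by rewrite mulrC ler_pdivlMr// mul1r.
have h1 : 1 + t ^+ 2 <= (1 + delta ^- 2) * (e ^+ 2 + t ^+ 2).
  have := sqr_ge0 e; have : 0 < delta ^- 2 by rewrite invr_gt0.
  move: (delta ^- 2) dV => s; nra.
rewrite mulr1 (_ : e * _ * _ * _ =
    2 * e * ((1 + delta ^- 2) * (e ^+ 2 + t ^+ 2) / (1 + t ^+ 2))); last by ring.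
rewrite ler_peMr ?mulr_ge0 ?(ltW e0)//.
by rewrite ler_pdivlMr ?mul1r// ltr_pwDl// sqr_ge0.
Qed.

Lemma poisson_approx g (K : R) x : cmeas g -> (forall y, normc (g y) <= K) -> cont_at g x ->
  ccvg (fun n => cint mu (fun y => g y * (poisson n.+1%:R^-1 (x - y))%:C)) ((2 * pi)%:C * g x).
Proof.
move=> mg gK cg; have K0 : 0 <= K by exact: le_trans (normc_ge0 _) (gK x).
have pi0 : 0 < 2 * pi :> R by rewrite mulr_gt0// pi_gt0.
apply: ccvg_eps => eta eta0.
pose eta' := eta / 2 / (2 * pi).
have eta'0 : 0 < eta' by rewrite !divr_gt0.
have [delta d0 gd] := cg _ eta'0.
(* [2 * K] bounds the oscillation of [g] and [e * (1 + delta ^- 2)] is the factor of [poisson_tail],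
   so the far part costs at most [C * e * (2 * pi)]. The [+ 1] below keeps the divisor positive when
   [K] is zero. *)
pose C := 2 * K * (1 + delta ^- 2).
have C0 : 0 <= C by rewrite !mulr_ge0// addr_ge0// invr_ge0 sqr_ge0.
have D0 : 0 < C * (2 * pi) + 1 by rewrite ltr_wpDl// mulr_ge0// ltW.
have D1 : 0 < eta / 2 / (C * (2 * pi) + 1) by rewrite !divr_gt0.
near=> n.
have eD : n.+1%:R^-1 <= eta / 2 / (C * (2 * pi) + 1).
  near: n; apply: filterS (near_infty_natSinv_lt (PosNum D1)) => m; exact: ltW.
move: eD; set e := n.+1%:R^-1 => eD; have e0 : 0 < e by rewrite invr_gt0.
have P1 := cL1_poisson x e0.
have gP1 : cL1 mu (fun y => g y * (poisson e (x - y))%:C) by exact: cL1M_bounded mg gK P1.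
have cP1 : cL1 mu (fun y => g x * (poisson e (x - y))%:C) by exact: cL1Z.
have -> : (2 * pi)%:C * g x = cint mu (fun y => g x * (poisson e (x - y))%:C).
  by rewrite cintZ// cint_real /Rintegral integral_poisson_shift//= mulrC.
rewrite -cintB// -lee_fin.
apply: (le_trans (le_normc_cint _)); first exact: cL1B.
have mp := measurable_poisson_rev x e0; have mp1 := measurable_poisson_rev x (@ltr01 R).
apply: (@le_trans _ _ (\int[mu]_y (eta'%:E * (poisson e (x - y))%:E +
    (C * e)%:E * (poisson 1 (x - y))%:E))%E).
  apply: ge0_le_integral => //.
  - by move=> y _; rewrite lee_fin normc_ge0.
  - by apply: mnormc; case: (cL1B gP1 cP1).
  - by apply/measurable_EFinP; apply: measurable_funD; exact: measurable_funM.
  move=> y _; rewrite -!EFinM -EFinD lee_fin -mulrBl normcM normc_real.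
  rewrite (ger0_norm (poisson_ge0 _ e0)).
  have p0 := poisson_ge0 (x - y) e0; have p10 := poisson_ge0 (x - y) (@ltr01 R).
  have [xy|xy] := ltP `|x - y| delta.
    apply: ler_wpDr; first by rewrite mulr_ge0// mulr_ge0// ltW.
    by apply: ler_wpM2r => //; exact: gd.
  apply: ler_wpDl; first by rewrite mulr_ge0// ltW.
  apply: (@le_trans _ _ (2 * K * (e * (1 + delta ^- 2) * poisson 1 (x - y)))).
    apply: ler_pM => //; [exact: normc_ge0| |exact: poisson_tail].
    by rewrite (le_trans (normcB_le _ _))// mulrC mulr_natr mulr2n lerD.
  by rewrite le_eqVlt; apply/orP; left; apply/eqP; rewrite /C; ring.
rewrite ge0_integralD//; last 4 first.
- by move=> y _; rewrite -EFinM lee_fin; apply: mulr_ge0; [exact: ltW|exact: poisson_ge0].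
- by apply/measurable_EFinP; exact: measurable_funM.
- move=> y _; rewrite -EFinM lee_fin; apply: mulr_ge0; last exact: poisson_ge0.
  by rewrite mulr_ge0// ltW.
- by apply/measurable_EFinP; exact: measurable_funM.
rewrite !ge0_integralZl//; last 6 first.
- by apply/measurable_EFinP.
- by move=> y _; rewrite lee_fin poisson_ge0.
- by rewrite lee_fin mulr_ge0// ltW.
- by apply/measurable_EFinP.
- by move=> y _; rewrite lee_fin poisson_ge0.
- by rewrite lee_fin ltW.
rewrite !integral_poisson_shift// -!EFinM -EFinD lee_fin.
have -> : eta' * (2 * pi) = eta / 2 by rewrite /eta' divfK// gt_eqF.
rewrite [leRHS](splitr eta) lerD2l.
have : e * (C * (2 * pi) + 1) <= eta / 2 by rewrite -ler_pdivlMr.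
apply: le_trans; rewrite -mulrA mulrCA ler_wpM2l ?(ltW e0)//.
by rewrite lerDl.
Unshelve. all: by end_near. Qed.

Lemma cont_at_conjc g x : cont_at g x -> cont_at (fun y => conjc (g y)) x.
Proof.
move=> cg eta eta0; have [delta d0 gd] := cg _ eta0; exists delta => // y yd.
by rewrite -conjcN -conjcD normc_conjc; exact: gd.
Qed.

(** Both sides are limits of the damped identity [damp_FT_mul]. On the left the limit is dominated
    because both transforms are square-integrable. On the right the Poisson averages of [k] stay
    below [K * (2 * pi)] and converge wherever [k] is continuous. *)
Lemma parseval h k (m K : R) : cL1 mu h -> cL2 mu h -> cL1 mu k -> cL2 mu k ->
  (forall x, normc (k x) <= K) -> (forall x, x != m -> cont_at k x) ->
  cint mu (fun xi => FT h xi * conjc (FT k xi)) = cint mu (fun x => h x * conjc (k x)).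
Proof.
move=> h1 h2 k1 k2 kK km.
have FF : cL1 mu (fun xi => FT h xi * conjc (FT k xi)).
  by apply: cL1M; [exact: cL2_FT|apply: cL2_conjc; exact: cL2_FT].
have e0 n : 0 < n.+1%:R^-1 :> R by rewrite invr_gt0.
have pi0 : 0 < 2 * pi :> R by rewrite mulr_gt0// pi_gt0.
pose u n := cint mu (fun xi => damp n.+1%:R^-1 xi * (FT h xi * conjc (FT k xi))).
have ul : ccvg u (cint mu (fun xi => FT h xi * conjc (FT k xi))).
  have [mFF FFoo] := FF.
  refine (@ccvg_dominated R _ _ mu _ _ (fun xi => normc (FT h xi * conjc (FT k xi))) _ _ _ _ _ _).
  - by move=> n; apply: cmeasM => //; exact: cmeas_damp.
  - exact: mFF.
  - exact: measurable_normc.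
  - exact: FFoo.
  - by move=> n x; rewrite normcM ler_piMl ?normc_ge0// normc_damp.
  - apply: aeW => x; rewrite -[X in ccvg _ X]mul1r; apply: ccvgM; last exact: ccvg_cst.
    by apply: ccvg_real; exact: damp_cvg.
apply: ccvg_unique ul _.
pose I n x := cint mu (fun y => conjc (k y) * (poisson n.+1%:R^-1 (x - y))%:C).
have uE n : u n = ((2 * pi)^-1)%:C * cint mu (fun x => h x * I n x).
  have [_ L2 E] := damp_FT_mul (e0 n) h1 k1.
  rewrite /u E cint_prod1//; congr (_ * _); apply: eq_cint => x /=.
  rewrite -cintZ; last first.
    apply: (@cL1M_bounded _ _ _ mu _ _ K _ _ (cL1_poisson x (e0 n))).
      by apply: cmeas_conjc; case: k1.
    by move=> y; rewrite normc_conjc.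
  by apply: eq_cint => y; rewrite mulrA.
have -> : u = fun n => ((2 * pi)^-1)%:C * cint mu (fun x => h x * I n x) by apply/funext.
have lE : cint mu (fun x => h x * conjc (k x)) =
    ((2 * pi)^-1)%:C * cint mu (fun x => h x * ((2 * pi)%:C * conjc (k x))).
  have hk : cL1 mu (fun x => h x * conjc (k x)) by apply: cL1M => //; exact: cL2_conjc.
  rewrite -[LHS]mul1r (_ : 1 = ((2 * pi)^-1)%:C * (2 * pi)%:C); last first.
    by rewrite -complexM mulVf// gt_eqF.
  rewrite -mulrA -cintZ//; congr (_ * _); apply: eq_cint => x.
  by rewrite mulrCA.
rewrite lE; apply: ccvgZ.
have mI n : cmeas (fun x : RT => I n x).
  apply: (@cmeas_cint _ _ RT RT R mu (fun p => conjc (k p.2) * (poisson n.+1%:R^-1 (p.1 - p.2))%:C)).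
  apply: cmeasM; first by apply: (cmeas_comp (f := fun y => conjc (k y))) => //; apply: cmeas_conjc; case: k1.
  apply: cmeas_real; apply: (measurableT_comp (measurable_poisson (e0 n))).
  exact: measurable_funB.
have mh : cmeas h by case: h1.
have mk : cmeas k by case: k1.
refine (@ccvg_dominated R _ _ mu _ _ (fun x => K * (2 * pi) * normc (h x)) _ _ _ _ _ _).
- by move=> n; apply: cmeasM.
- by apply: cmeasM => //; apply: cmeasM; [exact: cmeas_cst|exact: cmeas_conjc].
- by apply: measurable_funM => //; exact: measurable_normc.
- have K0 : 0 <= K by exact: le_trans (normc_ge0 _) (kK 0).
  have Kpi0 : 0 <= K * (2 * pi) by rewrite mulr_ge0// ltW.
  have -> : (\int[mu]_x (K * (2 * pi) * normc (h x))%:E)%E =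
      nint mu (fun x => (K * (2 * pi))%:C * h x).
    by apply: eq_integral => x _; rewrite normcM normc_real (ger0_norm Kpi0).
  rewrite nintZ// lte_mul_pinfty ?lee_fin ?normc_ge0//.
  by case: h1.
- move=> n x; rewrite normcM mulrC ler_wpM2r ?normc_ge0//.
  rewrite -lee_fin.
  have kP := @cL1M_bounded _ _ _ mu _ _ K (cmeas_conjc mk) _ (cL1_poisson x (e0 n)).
  apply: (le_trans (le_normc_cint _)); first by apply: kP => y; rewrite normc_conjc.
  have P1 := cL1_poisson x (e0 n).
  apply: (@le_trans _ _ (nint mu (fun y => K%:C * (poisson n.+1%:R^-1 (x - y))%:C))).
    apply: le_nint; first by apply: cmeasM; [exact: cmeas_conjc|case: P1].
      by apply: cmeasM; [exact: cmeas_cst|case: P1].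
    move=> y; rewrite !normcM ler_wpM2r ?normc_ge0// normc_conjc normc_real.
    by rewrite (le_trans (kK y))// ler_norm.
  rewrite nintZ; last by case: P1.
  rewrite normc_real ger0_norm; last exact: le_trans (normc_ge0 _) (kK 0).
  rewrite EFinM; have -> : nint mu (fun y => (poisson n.+1%:R^-1 (x - y))%:C) = (2 * pi)%:E.
    rewrite -(integral_poisson_shift x (e0 n)); apply: eq_integral => y _.
    by rewrite normc_real ger0_norm// poisson_ge0.
  by [].
- apply: (@ae_off_point _ m) => x xm; apply: ccvgM; first exact: ccvg_cst.
  apply: (poisson_approx (K := K)).
  + exact: cmeas_conjc.
  + by move=> y; rewrite normc_conjc.
  + by apply: cont_at_conjc; exact: km.
Qed.

End Parseval.

(** * Almost everywhere limits of rapidly Cauchy sequences in [L^2] *)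

Section RieszFischer.
Context d (T : measurableType d) (R : realType).
Variable mu : {measure set T -> \bar R}.

Lemma n2_sub_triangle (f g h : T -> R[i]) : cmeas f -> cmeas g -> cmeas h ->
  (n2 mu (fun x => (f x - g x)%R) <=
   2%:E * (n2 mu (fun x => (h x - f x)%R) + n2 mu (fun x => (h x - g x)%R)))%E.
Proof.
move=> mf mg mh; have mfh : cmeas (fun x => - (h x - f x)) by apply: cmeasN; exact: cmeasB.
have mhg : cmeas (fun x => h x - g x) by exact: cmeasB.
have := n2D_le mu mfh mhg.
rewrite (_ : (fun x => _) = fun x => f x - g x); last by apply/funext => x; ring.
by rewrite (eq_n2 mu (f := fun x => - (h x - f x)) (g := fun x => h x - f x)) // => x; rewrite normc_opp.
Qed.

Lemma cvg_of_geometric (u : nat -> R) (M : R) :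
  (forall n, `|u n.+1 - u n| <= M * 2^-1 ^+ n) -> cvgn u.
Proof.
move=> uM; have M0 : 0 <= M by have := uM 0%N; rewrite expr0 mulr1; exact: le_trans.
have : cvgn [normed series (fun n => u n.+1 - u n)].
  apply: (@series_le_cvg _ _ (geometric M 2^-1)) => //.
  - by move=> n; exact: normr_ge0.
  - by move=> n; rewrite /geometric /=; apply: mulr_ge0 => //; exact: exprn_ge0.
  - by apply: is_cvg_geometric_series; rewrite ger0_norm// invf_lt1// ltr1n.
move=> /normed_cvg; rewrite (_ : series _ = fun n => u n - u 0%N).
  move=> H; rewrite (_ : u = fun n => (u n - u 0%N) + u 0%N).
    by apply: is_cvgD => //; exact: is_cvg_cst.
  by apply/funext => n; rewrite subrK.
by apply/funext => n; rewrite /series /= telescope_sumr.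
Qed.

Lemma riesz_fischer (phi : nat -> T -> R[i]) (C : R) : (forall k, cmeas (phi k)) ->
  (forall k, (n2 mu (fun x => (phi k.+1 x - phi k x)%R) <= (C * 16^-1 ^+ k)%:E)%E) ->
  exists2 g : T -> R[i], cmeas g & {ae mu, forall x, ccvg (phi^~ x) (g x)}.
Proof.
move=> mphi phiC.
(* The weight [4 ^+ k] leaves integrals of order [4^-1 ^+ k], so their sum [S] is finite almost
   everywhere. Where it is finite, the increments of [phi] are at most the square root of [S] times
   [2^-1 ^+ k]. *)
pose D k x := (4 ^+ k * normc (phi k.+1 x - phi k x) ^+ 2)%:E.
have mD k : measurable_fun setT (D k).
  apply/measurable_EFinP; apply: measurable_funM => //.
  by apply: measurable_funX; apply: measurable_normc; exact: cmeasB.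
have D0 k x : (0 <= D k x)%E.
  by rewrite lee_fin; apply: mulr_ge0; [exact: exprn_ge0|exact: sqr_ge0].
have C0 : 0 <= C.
  by rewrite -lee_fin -[C]mulr1 -(expr0 16^-1) (le_trans (n2_ge0 mu _) (phiC 0%N)).
have ID k : (\int[mu]_x D k x <= (geometric C 4^-1 k)%:E)%E.
  rewrite /D; under eq_integral do rewrite EFinM.
  rewrite ge0_integralZl//; last 2 first.
  - by apply: msqr; exact: cmeasB.
  - by move=> x _; rewrite lee_fin sqr_ge0.
  apply: le_trans (lee_wpmul2l _ (phiC k)) _; first by rewrite lee_fin exprn_ge0.
  rewrite -EFinM lee_fin /= mulrCA -exprMn.
  by rewrite (_ : 4 * 16^-1 = 4^-1 :> R)//; field.
pose S x := (\sum_(0 <= k <oo) D k x)%E.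
have mS : measurable_fun setT S.
  by apply: ge0_emeasurable_sum => // k x _ _; exact: D0.
have IS : mu.-integrable setT S.
  apply/integrableP; split => //.
  have -> : (\int[mu]_x `|S x| = \int[mu]_x S x)%E.
    by apply: eq_integral => x _; rewrite gee0_abs// nneseries_ge0.
  rewrite /S integral_nneseries//.
  apply: (@le_lt_trans _ _ (\sum_(0 <= k <oo) (geometric C 4^-1 k)%:E)%E).
    apply: lee_nneseries => [k _ _|k _]; last exact: ID.
    by apply: integral_ge0 => x _; exact: D0.
  have cg : cvgn (series (geometric C (4^-1 : R))).
    by apply: is_cvg_geometric_series; rewrite ger0_norm// invf_lt1// ltr1n.
  have -> : (\sum_(0 <= k <oo) (geometric C 4^-1 k)%:E = (limn (series (geometric C (4^-1 : R))))%:E)%E.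
    rewrite -EFin_lim//; congr (limn _); apply/funext => n /=.
    by rewrite /series /= sumEFin.
  by rewrite ltry.
(* The upper limit is defined and measurable everywhere, and coincides with the limit at the points
   of convergence. *)
pose lim_part (u : nat -> T -> R) x := fine (limn_esup (fun k => (u k x)%:E)).
have mlim u : (forall k, measurable_fun setT (u k)) -> measurable_fun setT (lim_part u).
  move=> mu_; apply: (measurableT_comp (f := fine)); first exact: fine_measurable.
  by apply: measurable_fun_limn_esup => k; exact/measurable_EFinP.
exists (fun x => lim_part (fun k x => Re (phi k x)) x +i* lim_part (fun k x => Im (phi k x)) x).
  by split => /=; apply: mlim => k; have [] := mphi k.
apply: filterS (integrable_ae measurableT IS) => x /(_ I) Sx.
have lim_partE (u : nat -> T -> R) : cvgn (u^~ x) -> u^~ x @ \oo --> lim_part u x.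
  move=> ux; have ux' : (fun k => (u k x)%:E) @ \oo --> (limn (u^~ x))%:E.
    by apply: cvg_EFin; [exact: nearW|exact: ux].
  by rewrite /lim_part (cvg_limn_einf_sup ux').2.
have dM k : normc (phi k.+1 x - phi k x) <= Num.sqrt (fine (S x)) * 2^-1 ^+ k.
  have Dk : (D k x <= S x)%E.
    rewrite /S (nneseries_split 0%N k.+1)//= big_mkord big_ord_recr /= addeAC.
    by rewrite leeDr// adde_ge0 ?sume_ge0 ?nneseries_ge0.
  rewrite -(fineK Sx) lee_fin in Dk.
  have p0 : 0 <= 2^-1 ^+ k :> R by rewrite exprn_ge0.
  rewrite -ler_sqr ?nnegrE ?normc_ge0 ?mulr_ge0 ?sqrtr_ge0//.
  rewrite exprMn sqr_sqrtr; last by rewrite fine_ge0// nneseries_ge0.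
  have -> : (2^-1 ^+ k) ^+ 2 = (4 ^+ k)^-1 :> R.
    by rewrite -exprM mulnC exprM -exprVn; congr (_ ^+ k); field.
  by rewrite ler_pdivlMr ?exprn_gt0// mulrC.
split; apply: lim_partE; apply: cvg_of_geometric => k; apply: le_trans (dM k).
  by rewrite -cReN -cReD normc_Re.
by rewrite -cImN -cImD normc_Im.
Qed.

End RieszFischer.

(** * The Fourier transform on [L^2] *)

Section FourierL2.
Variable R : realType.
Local Notation mu := (@lebesgue_measure R).
Local Notation RT := (measurableTypeR R).
Implicit Types q : RT -> R[i].

Lemma sqr_integrable_Lfun (f : RT -> R) : measurable_fun setT f ->
  (\int[mu]_x (f x ^+ 2)%:E < +oo)%E -> (f : R -> R) \in Lfun mu 2%:E.
Proof.
move=> mf foo; rewrite inE; apply/andP; split; first by rewrite inE.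
rewrite inE /= /finite_norm unlock; apply: poweR_lty.
apply: le_lt_trans foo; rewrite le_eqVlt; apply/orP; left; apply/eqP.
apply: eq_integral => x _ /=.
by rewrite -(real_normK (num_real (f x))) -powR_mulrn ?normr_ge0.
Qed.

Lemma cL2_L2 q : cL2 mu q -> L2 q.
Proof.
move=> [[mR mI] qoo]; split; apply: sqr_integrable_Lfun => //; apply: le_lt_trans qoo;
  apply: ge0_le_integral => //; try (apply/measurable_EFinP; exact: measurable_funX);
  try (exact: (@msqr _ _ R q (conj mR mI)));
  try (by move=> x _; rewrite lee_fin normc_sqr ?lerDl ?lerDr sqr_ge0);
  by move=> x _; rewrite lee_fin sqr_ge0.
Qed.

Lemma L2_cL2 q : L2 q -> cL2 mu q.
Proof.
move=> [qR qI].
have mR : measurable_fun setT (fun x : RT => Re (q x)) by move: qR; rewrite inE => /andP[]; rewrite inE.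
have mI : measurable_fun setT (fun x : RT => Im (q x)) by move: qI; rewrite inE => /andP[]; rewrite inE.
split=> //.
have /integrableP[_ IR] := Lfun2_integrable_sqr qR.
have /integrableP[_ II] := Lfun2_integrable_sqr qI.
have -> : n2 mu q = (\int[mu]_x (`|(Re (q x) ^+ 2)%:E| + `|(Im (q x) ^+ 2)%:E|))%E.
  apply: eq_integral => x _; rewrite !gee0_abs ?lee_fin ?sqr_ge0//.
  by rewrite normc_sqr EFinD.
rewrite ge0_integralD//; first exact: lte_add_pinfty.
  by apply: measurableT_comp => //; apply/measurable_EFinP; exact: measurable_funX.
by apply: measurableT_comp => //; apply/measurable_EFinP; exact: measurable_funX.
Qed.

Definition trunc q (n : nat) (x : RT) : R[i] := ind R ((- n%:R <= x) && (x <= n%:R)) * q x.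

Lemma cmeas_itv_ind (a b : R) : cmeas (fun x : RT => ind R ((a <= x) && (x <= b))).
Proof. by apply: cmeas_ind; apply: measurable_and; exact: measurable_fun_ler. Qed.

Lemma cL2_itv_ind (a b : R) : cL2 mu (fun x => ind R ((a <= x) && (x <= b))).
Proof.
split; first exact: cmeas_itv_ind.
rewrite /n2 (eq_integral (EFin \o \1_(`[a, b]%classic : set RT))).
  rewrite integral_indic// setIT /= lebesgue_measure_itv.
  by case: ifP => _; rewrite ltry.
move=> x _; rewrite normc_ind /= indicE mem_setE in_itv /=.
by case: (_ && _); rewrite ?expr1n ?expr0n.
Qed.

Lemma cmeas_trunc q n : cmeas q -> cmeas (trunc q n).
Proof. by move=> mq; apply: cmeasM => //; exact: cmeas_itv_ind. Qed.

Lemma cL2_trunc q n : cL2 mu q -> cL2 mu (trunc q n).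
Proof.
move=> q2; apply: (@cL2M_bounded _ _ _ mu _ _ 1 _ _ q2); first exact: cmeas_itv_ind.
by move=> x; exact: normc_ind_le1.
Qed.

Lemma cL1_trunc q n : cL2 mu q -> cL1 mu (trunc q n).
Proof. by move=> q2; apply: cL1M => //; exact: cL2_itv_ind. Qed.

Lemma truncated_fourierE q n xi : truncated_fourier q n xi = FT (trunc q n) xi.
Proof.
rewrite /truncated_fourier /FT; congr (_ * _).
rewrite /cintegral [X in X +i* _]Rintegral_mkcond [X in _ +i* X]Rintegral_mkcond.
apply: complex_eq; apply: eq_Rintegral => x _; rewrite patchE mem_setE in_itv /=.
  rewrite /trunc; case: ifP => _; first by rewrite indT mul1r.
  by rewrite indF !mul0r.
rewrite /trunc; case: ifP => _; first by rewrite indT mul1r.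
by rewrite indF !mul0r.
Qed.

Lemma trunc_eventually q x : \forall n \near \oo, trunc q n x = q x.
Proof.
near=> n; rewrite /trunc; suff -> : (- n%:R <= x) && (x <= n%:R) by rewrite indT mul1r.
rewrite -ler_norml; near: n; exact: nbhs_infty_ger.
Unshelve. all: by end_near. Qed.

Definition tail2 q n : R := fine (n2 mu (fun x => q x - trunc q n x)).

Lemma tail2E q n : cL2 mu q -> n2 mu (fun x => q x - trunc q n x) = (tail2 q n)%:E.
Proof. by move=> q2; rewrite fineK//; apply: n2_fin; apply: cL2B => //; exact: cL2_trunc. Qed.

Lemma tail2_ge0 q n : 0 <= tail2 q n. Proof. by rewrite fine_ge0// n2_ge0. Qed.

Lemma tail2_cvg q : cL2 mu q -> tail2 q @ \oo --> 0.
Proof.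
move=> q2; have mq : cmeas q by case: q2.
pose F n x : R[i] := (normc (q x - trunc q n x) ^+ 2)%:C.
have mF n : cmeas (F n).
  apply: cmeas_real; apply: measurable_funX; apply: measurable_normc.
  by apply: cmeasB => //; exact: cmeas_trunc.
have FE n : cint mu (F n) = (tail2 q n)%:C by rewrite cint_real.
have : ccvg (fun n => cint mu (F n)) (cint mu (fun=> 0)).
  refine (@ccvg_dominated R _ _ mu _ _ (fun x => normc (q x) ^+ 2) _ _ _ _ _ _) => //.
  - by apply: measurable_funX; exact: measurable_normc.
  - by case: q2.
  - move=> n x; rewrite /F normc_real ger0_norm ?sqr_ge0//.
    rewrite lerXn2r ?nnegrE ?normc_ge0// /trunc.
    by case: (_ && _); rewrite ?indT ?indF ?mul1r ?mul0r ?subrr ?subr0 ?normc0 ?normc_ge0.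
  - apply: aeW => x; apply: ccvg_near; apply: filterS (trunc_eventually q x) => n nq.
    by rewrite /F nq subrr normc0 expr0n.
rewrite cint0 => -[H _]; move: H => /=.
by rewrite (_ : (fun n => _) = tail2 q)//; apply/funext => n.
Qed.

Lemma FTB h k xi : cL1 mu h -> cL1 mu k ->
  FT (fun x => h x - k x) xi = FT h xi - FT k xi.
Proof.
move=> h1 k1; rewrite /FT -mulrBr -cintB; [|exact: cL1_fkerl|exact: cL1_fkerl].
by congr (_ * _); apply: eq_cint => x; rewrite mulrBl.
Qed.

Lemma FT_trunc_sub_le q n m : cL2 mu q ->
  (n2 mu (fun xi => (FT (trunc q n) xi - FT (trunc q m) xi)%R) <=
   (2 * (tail2 q n + tail2 q m))%:E)%E.
Proof.
move=> q2; have mq : cmeas q by case: q2.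
have n1 := cL1_trunc n q2; have m1 := cL1_trunc m q2.
have -> : (fun xi => FT (trunc q n) xi - FT (trunc q m) xi) =
    FT (fun x => trunc q n x - trunc q m x) by apply/funext => xi; rewrite FTB.
apply: (le_trans (plancherel_le (cL1B n1 m1) _)).
  by apply: cL2B; exact: cL2_trunc.
rewrite EFinM [X in (_ <= _ * X)%E]EFinD -!tail2E//.
by apply: n2_sub_triangle => //; exact: cmeas_trunc.
Qed.

Lemma fourier_exists q : cL2 mu q -> exists g : RT -> R[i], cL2 mu g /\
  forall n, (n2 mu (fun xi => (g xi - FT (trunc q n) xi)%R) <= (2 * tail2 q n)%:E)%E.
Proof.
move=> q2; have mq : cmeas q by case: q2.
(* The rate [16^-1 ^+ k] is the one that [riesz_fischer] asks for; it selects a subsequence of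
   truncations. *)
have exN (k : nat) : exists N : nat, forall n, (N <= n)%N -> tail2 q n <= 16^-1 ^+ k.
  have e0 : 0 < 16^-1 ^+ k :> R by rewrite exprn_gt0.
  have /cvgrPdist_le /(_ _ e0) [N _ HN] := tail2_cvg q2.
  exists N => n Nn; have := HN n Nn.
  by rewrite sub0r normrN ger0_norm// tail2_ge0.
have [N HN] := choice exN.
pose phi k := FT (trunc q (N k)).
have mFT n : cmeas (FT (trunc q n)) by apply: cmeas_FT; exact: cmeas_trunc.
have small k : tail2 q (N k) <= 16^-1 ^+ k by exact: HN.
(* The constant [4]: two consecutive tails are each at most [16^-1 ^+ k], and [FT_trunc_sub_le]
   doubles their sum. *)
have [] := @riesz_fischer _ _ _ mu phi 4 (fun k => mFT (N k)).
  move=> k; apply: (le_trans (FT_trunc_sub_le _ _ q2)); rewrite lee_fin.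
  have h1 := small k; have := small k.+1; rewrite exprS.
  have : 0 <= 16^-1 ^+ k :> R by rewrite exprn_ge0.
  move: (16^-1 ^+ k : R) h1 => a; lra.
move=> g mg gphi.
(* Fatou's lemma along the subsequence carries the Cauchy estimate over to the limit; the tail at
   the moving index is absorbed in [eps]. *)
have gn n : (n2 mu (fun xi => (g xi - FT (trunc q n) xi)%R) <= (2 * tail2 q n)%:E)%E.
  apply/lee_addgt0Pr => eps eps0.
  apply: (@fatou_le _ _ _ mu (fun k xi => normc (phi k xi - FT (trunc q n) xi) ^+ 2)).
  - by move=> k; apply: measurable_funX; apply: measurable_normc; apply: cmeasB => //; exact: mFT.
  - by apply: measurable_funX; apply: measurable_normc; exact: cmeasB.
  - by move=> k x; rewrite sqr_ge0.
  - by move=> x; rewrite sqr_ge0.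
  - apply: filterS gphi => x gx; have := ccvgD gx (ccvg_cst (- FT (trunc q n) x)).
    by move=> /cvg_normc H; exact: (cvgM H H).
  - near=> k; apply: (le_trans (FT_trunc_sub_le _ _ q2)); rewrite -EFinD lee_fin.
    rewrite mulrDr addrC lerD2l.
    have : 16^-1 ^+ k <= eps / 2.
      near: k; have e20 : 0 < eps / 2 by rewrite divr_gt0.
      have lt1 : `|16^-1| < 1 :> R by rewrite ger0_norm// invf_lt1// ltr1n.
      have /cvgrPdist_le /(_ _ e20) := cvg_expr lt1.
      apply: filterS => k; rewrite sub0r normrN ger0_norm// exprn_ge0//.
    by have := small k; lra.
exists g; split => //.
(* [g] is square-integrable since it differs from one square-integrable transform by a function of
   finite norm. *)
have F0 := cL2_FT (cL1_trunc 0 q2) (cL2_trunc 0 q2).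
have gF : cL2 mu (fun xi => g xi - FT (trunc q 0) xi).
  by split; [exact: cmeasB|exact: le_lt_trans (gn 0%N) (ltry _)].
have := cL2D gF F0; rewrite (_ : (fun x => _) = g)//.
by apply/funext => x; rewrite subrK.
Unshelve. all: by end_near. Qed.

(** Existence guarantees that [xget] picks a genuine transform; all later uses of [fourier] go
    through these two properties. *)
Lemma fourier_spec q : cL2 mu q -> cL2 mu (fourier q : RT -> R[i]) /\
  (fun n => n2 mu (fun xi => fourier q xi - FT (trunc q n) xi)) @ \oo --> 0%E.
Proof.
move=> q2.
have : is_fourier q (fourier q).
  apply: (@xgetPex _ (fun=> 0) [set g | is_fourier q g]).
  have [g [g2 gn]] := fourier_exists q2; exists g; split; first exact: cL2_L2.
  have t0 : (fun n => (2 * tail2 q n)%:E) @ \oo --> 0%E.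
    apply: cvg_EFin; first exact: nearW.
    rewrite -[X in _ --> X](mulr0 2).
    by apply: cvgM; [exact: cvg_cst|exact: tail2_cvg].
  apply: squeeze_cvge (cvg_cst 0%E) t0; apply: nearW => n; apply/andP; split.
    by apply: integral_ge0 => x _; rewrite lee_fin sqr_ge0.
  apply: le_trans (gn n); rewrite /n2 le_eqVlt; apply/orP; left; apply/eqP.
  by apply: eq_integral => xi _; rewrite truncated_fourierE.
move=> [gL H]; split; first exact: (L2_cL2 gL).
apply: cvg_trans H; apply: near_eq_cvg; apply: nearW => n.
by apply: eq_integral => xi _; rewrite truncated_fourierE.
Qed.

End FourierL2.

(** * Shifts and reversals of the line *)

Section ShiftReverse.
Variable R : realType.
Local Notation mu := (@lebesgue_measure R).
Local Notation RT := (measurableTypeR R).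
Implicit Types f : RT -> R[i].

Lemma cint_shift (c : R) f : cmeas f -> cint mu (fun x => f (x + c)) = cint mu f.
Proof. exact: (cint_invariant (measurable_shift c) (@lebesgue_measureD R c)). Qed.

Lemma cL1_shift (c : R) f : cL1 mu f -> cL1 mu (fun x => f (x + c)).
Proof. exact: (cL1_invariant (measurable_shift c) (@lebesgue_measureD R c)). Qed.

Lemma n2_shift (c : R) f : cmeas f -> n2 mu (fun x => f (x + c)) = n2 mu f.
Proof. exact: (n2_invariant (measurable_shift c) (@lebesgue_measureD R c)). Qed.

Lemma cmeas_shift (c : R) f : cmeas f -> cmeas (fun x : RT => f (x + c)).
Proof. exact: (cmeas_invariant (measurable_shift c)). Qed.

Lemma cL1_rev (c : R) f : cL1 mu f -> cL1 mu (fun x => f (c - x)).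
Proof.
move=> f1; have g1 := cL1_shift c f1.
apply: (eq_cL1 _ (cL1_invariant (@measurable_opp R) (@lebesgue_measureN R) g1)) => x.
by rewrite addrC.
Qed.

Lemma cint_rev (c : R) f : cmeas f -> cint mu (fun x => f (c - x)) = cint mu f.
Proof.
move=> mf; rewrite -(cint_shift c mf).
rewrite -(cint_invariant (@measurable_opp R) (@lebesgue_measureN R) (cmeas_shift c mf)).
by apply: eq_cint => x; rewrite addrC.
Qed.

End ShiftReverse.

(** * One-sided exponential convolutions *)

Section OneSidedExponentials.
Variable R : realType.
Local Notation mu := (@lebesgue_measure R).
Local Notation RT := (measurableTypeR R).
Implicit Types (q k : RT -> R[i]) (c z : R[i]) (m x xi s : R).

Definition expker c (s : RT) : R[i] := ind R (0 < s) * cexp (- c * s%:C).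

Lemma cmeas_expker c : cmeas (expker c).
Proof.
apply: cmeasM; first exact: cmeas_lt.
by apply: ccontinuous_cmeas; apply: cderive_continuous; exact: cderive_cexp.
Qed.

Lemma expker_le1 c s : 0 < Re c -> normc (expker c s) <= 1.
Proof.
move=> c0; rewrite normcM normc_ind normc_cexp; have [s0|s0] := ltP 0 s; last by rewrite mul0r.
rewrite mul1r -expR0 ler_expR cReM cReN /= mulr0 subr0 mulNr oppr_le0.
by rewrite mulr_ge0// ltW.
Qed.

Lemma cont_at_ccontinuous (F : RT -> R[i]) x : ccontinuous F -> cont_at F x.
Proof.
move=> [FR FI] eta eta0; have e2 : 0 < eta / 2 by rewrite divr_gt0.
have /cvgrPdist_le /(_ _ e2) := FR x; move=> /nbhs_ballP [d1 /= d10 H1].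
have /cvgrPdist_le /(_ _ e2) := FI x; move=> /nbhs_ballP [d2 /= d20 H2].
exists (Num.min d1 d2); first by rewrite lt_min d10.
move=> y; rewrite lt_min => /andP[y1 y2].
apply: le_trans (normc_le_ReIm _) _; rewrite [leRHS](splitr eta).
apply: lerD; first by rewrite cReD cReN distrC; exact: H1.
by rewrite cImD cImN distrC; exact: H2.
Qed.

Lemma cont_at_expker c s : s != 0 -> cont_at (expker c) s.
Proof.
move=> s0 eta eta0.
have [d d0 H] := cont_at_ccontinuous s (cderive_continuous (cderive_cexp (- c))) eta0.
exists (Num.min d `|s|); first by rewrite lt_min d0 normr_gt0.
move=> y; rewrite lt_min => /andP[yd ys]; rewrite /expker.
suff -> : (0 < y) = (0 < s).
  rewrite -mulrBr normcM; apply: le_trans (H y yd).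
  by rewrite ler_piMl ?normc_ge0 ?normc_ind_le1.
have [s_gt0|s_le0] := ltP 0 s.
  by rewrite (gtr0_norm s_gt0) in ys; apply/idP; move: ys; rewrite ltr_norml; lra.
have s_lt0 : s < 0 by rewrite lt_neqAle s0.
rewrite (ltr0_norm s_lt0) in ys; apply/negP/negP; rewrite -leNgt.
by move: ys; rewrite ltr_norml; lra.
Qed.

Lemma cL2_bounded1 k : cL1 mu k -> (forall x, normc (k x) <= 1) -> cL2 mu k.
Proof.
move=> [mk koo] k1; split=> //; apply: le_lt_trans koo; apply: ge0_le_integral => //.
- by move=> x _; rewrite lee_fin sqr_ge0.
- exact: msqr.
- exact: mnormc.
- by move=> x _; rewrite lee_fin expr2 ler_piMl ?normc_ge0.
Qed.

Lemma fker_cexp x xi : fker x xi = cexp (- ('i%C * xi%:C) * x%:C).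
Proof. by rewrite /fker; congr cexp; rewrite complexM; ring. Qed.

Lemma expker_fker c x xi : expker c x * fker x xi = expker (c + 'i%C * xi%:C) x.
Proof. by rewrite /expker -mulrA fker_cexp -cexpD -mulrDl -opprD. Qed.

Lemma Re_addi c xi : Re (c + 'i%C * xi%:C) = Re c.
Proof. by rewrite cReD cReM /= mul0r mulr0 subr0 addr0. Qed.

Lemma FT_expker c m xi : 0 < Re c ->
  FT (fun x => expker c (x - m)) xi = fnorm R * (fker m xi / (c + 'i%C * xi%:C)).
Proof.
move=> c0; rewrite /FT; congr (_ * _).
rewrite -(@cint_cexp R (c + 'i%C * xi%:C)) ?Re_addi// -/(expker _).
rewrite -cintZ; last by apply: cL1_cexp; rewrite Re_addi.
have mE : cmeas (fun x : RT => fker m xi * expker (c + 'i%C * xi%:C) x).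
  by apply: cmeasM; [exact: cmeas_cst|exact: cmeas_expker].
rewrite -(cint_shift (- m) mE); apply: eq_cint => x.
rewrite -expker_fker [RHS]mulrCA -fkerD.
by have -> : m + (x - m) = x by rewrite addrC subrK.
Qed.

Lemma FT_expker_rev c m xi : 0 < Re c ->
  FT (fun x => expker c (m - x)) xi = fnorm R * (fker m xi / (c - 'i%C * xi%:C)).
Proof.
move=> c0; rewrite /FT; congr (_ * _).
have cE : c - 'i%C * xi%:C = c + 'i%C * (- xi)%:C by rewrite complexN mulrN.
rewrite cE -(@cint_cexp R (c + 'i%C * (- xi)%:C)) ?Re_addi// -/(expker _).
rewrite -cintZ; last by apply: cL1_cexp; rewrite Re_addi.
have mE : cmeas (fun x : RT => fker m xi * expker (c + 'i%C * (- xi)%:C) x).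
  by apply: cmeasM; [exact: cmeas_cst|exact: cmeas_expker].
rewrite -(cint_rev m mE); apply: eq_cint => x.
rewrite -expker_fker [RHS]mulrCA.
have -> : fker (m - x) (- xi) = fker (x - m) xi by rewrite /fker mulrN -mulNr opprB.
by rewrite -fkerD; have -> : m + (x - m) = x by rewrite addrC subrK.
Qed.

Lemma cL1_expker_shift c m : 0 < Re c -> cL1 mu (fun x => expker c (x - m)).
Proof. by move=> c0; apply: (cL1_shift (- m)); exact: cL1_cexp. Qed.

Lemma cL1_expker_rev c m : 0 < Re c -> cL1 mu (fun x => expker c (m - x)).
Proof. by move=> c0; apply: cL1_rev; exact: cL1_cexp. Qed.

Lemma ccvg_cint_L2 (u : nat -> RT -> R[i]) (v k : RT -> R[i]) :
  (forall n, cL2 mu (u n)) -> cL2 mu v -> cL2 mu k ->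
  (fun n => n2 mu (fun x => v x - u n x)) @ \oo --> 0%E ->
  ccvg (fun n => cint mu (fun x => u n x * k x)) (cint mu (fun x => v x * k x)).
Proof.
move=> u2 v2 k2 uv.
have d2 n : cL2 mu (fun x => v x - u n x) by exact: cL2B.
apply: (@ccvg_normc _ _ _ (fun n => norm2 mu (fun x => v x - u n x) * norm2 mu k)) => [n|].
  rewrite -normc_opp opprB -cintB; [|exact: cL1M|exact: cL1M].
  have -> : cint mu (fun x => v x * k x - u n x * k x) = cint mu (fun x => (v x - u n x) * k x).
    by apply: eq_cint => x; rewrite mulrBl.
  rewrite -lee_fin; apply: (le_trans (le_normc_cint _)); first exact: cL1M.
  exact: cauchy_schwarz.
rewrite -[X in _ --> X](mul0r (norm2 mu k)); apply: cvgM; last exact: cvg_cst.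
have H : (fun n => fine (n2 mu (fun x => v x - u n x))) @ \oo --> (0 : R) by exact: fine_cvg uv.
have := continuous_cvg _ (@sqrt_continuous R _) H.
by rewrite sqrtr0 => H1; exact: H1.
Qed.

(** Both sides are continuous in the first factor for the [L^2] norm, by Cauchy-Schwarz, and the
    truncations of [q] are covered by [parseval]. *)
Lemma parseval_L2 q k (m K : R) : cL2 mu q -> cL1 mu k -> cL2 mu k ->
  (forall x, normc (k x) <= K) -> (forall x, x != m -> cont_at k x) ->
  cint mu (fun xi => fourier q xi * conjc (FT k xi)) = cint mu (fun x => q x * conjc (k x)).
Proof.
move=> q2 k1 k2 kK km; have [g2 gn] := fourier_spec q2.
have H1 : ccvg (fun n => cint mu (fun xi => FT (trunc q n) xi * conjc (FT k xi)))
    (cint mu (fun xi => fourier q xi * conjc (FT k xi))).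
  apply: (ccvg_cint_L2 (k := fun xi => conjc (FT k xi))) => //.
    by move=> n; apply: cL2_FT; [exact: cL1_trunc|exact: cL2_trunc].
  by apply: cL2_conjc; exact: cL2_FT.
apply: ccvg_unique H1 _.
have -> : (fun n => cint mu (fun xi => FT (trunc q n) xi * conjc (FT k xi))) =
    fun n => cint mu (fun x => trunc q n x * conjc (k x)).
  apply/funext => n; apply: (parseval (m := m) (K := K)) => //.
    exact: cL1_trunc.
  exact: cL2_trunc.
apply: (ccvg_cint_L2 (k := fun x => conjc (k x))) => //.
- by move=> n; exact: cL2_trunc.
- exact: cL2_conjc.
apply: cvg_EFin; first by apply: nearW => n; apply: n2_fin; apply: cL2B => //; exact: cL2_trunc.
exact: tail2_cvg.
Qed.

Definition wave z (t : R) : R[i] := cexp (2 * 'i%C * z * t%:C).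
(** [after z q] is the [f] of the overview; its [g] is [before z] applied to the conjugate of
    [q]. *)
Definition after z q (m : RT) : R[i] := cint mu (fun y => ind R (m < y) * (q y * wave z (y - m))).
Definition before z q (m : RT) : R[i] := cint mu (fun x => ind R (x < m) * (q x * wave z (m - x))).
(** The multiplier by which the convolutions [after] and [before] act on the Fourier side. *)
Definition resolvent z (xi : RT) : R[i] := 'i%C / (2 * z + xi%:C).

Definition cdecay z : R[i] := - (2 * 'i%C * z).

Lemma cdecay_Re z : Re (cdecay z) = 2 * Im z.
Proof. by case: z => a b; rewrite /cdecay /=; ring. Qed.

Lemma wave_expker z t : ind R (0 < t) * wave z t = expker (cdecay z) t.
Proof. by rewrite /expker /cdecay /wave opprK. Qed.

Lemma den_neq0 z xi : 0 < Im z -> 2 * z + xi%:C != 0.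
Proof.
move=> z0; have : Im (2 * z + xi%:C) = 2 * Im z by case: z {z0} => a b /=; ring.
by move=> h; apply: contraTneq z0 => e; rewrite -(pmulr_rgt0 _ (ltr0Sn R 1)) -h e ltxx.
Qed.

Lemma resolvent_rev z xi : 0 < Im z -> (cdecay z - 'i%C * xi%:C)^-1 = resolvent z xi.
Proof.
move=> z0; have d0 := den_neq0 xi z0.
have i0 : 'i%C != 0 :> R[i] by rewrite -normc_eq0 normc_i oner_neq0.
have ii : 'i%C * 'i%C = -1 :> R[i] by rewrite -expr2 sqr_i.
have -> : cdecay z - 'i%C * xi%:C = - 'i%C * (2 * z + xi%:C) by rewrite /cdecay; ring.
rewrite invfM /resolvent; congr (_ / _); apply: (mulfI i0).
by rewrite ii invrN mulrN divff.
Qed.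

Lemma resolvent_conj z xi : 0 < Im z -> conjc (conjc (cdecay z) + 'i%C * xi%:C)^-1 = resolvent z xi.
Proof.
move=> z0; rewrite -resolvent_rev// conjcV conjcD conjcC conjcM conjcR; congr (_ + _)^-1.
by rewrite -mulNr; congr (_ * _); apply: complex_eq; rewrite /= ?oppr0.
Qed.

Lemma after_fourier z q m : 0 < Im z -> cL2 mu q ->
  after z q m = fnorm R * cint mu (fun xi => fourier q xi * resolvent z xi * conjc (fker m xi)).
Proof.
(* Parseval conjugates its second factor, so the kernel is taken with the conjugate exponent. *)
move=> z0 q2; pose c := conjc (cdecay z).
have c0 : 0 < Re c by rewrite Re_conjc cdecay_Re mulr_gt0.
pose k (x : RT) := expker c (x - m).
have k1 : cL1 mu k by exact: cL1_expker_shift.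
have kle x : normc (k x) <= 1 by exact: expker_le1.
have k2 := cL2_bounded1 k1 kle.
have kc x : x != m -> cont_at k x.
  move=> xm eta eta0; rewrite -subr_eq0 in xm.
  have [d d0 H] := cont_at_expker c xm eta0; exists d => // y yd.
  by apply: H; rewrite opprB addrA subrK.
have := parseval_L2 q2 k1 k2 kle kc.
have -> : cint mu (fun x => q x * conjc (k x)) = after z q m.
  apply: eq_cint => x; rewrite /k /expker conjcM conjc_ind subr_gt0 mulrCA; congr (_ * (_ * _)).
  by rewrite conjc_cexp conjcM conjcN conjcC conjcR /wave /cdecay opprK.
move=> <-; have g2 : cL2 mu (fun xi => conjc (FT k xi)) by apply: cL2_conjc; exact: cL2_FT.
have [F2 _] := fourier_spec q2.
have FE xi : conjc (FT k xi) = fnorm R * (resolvent z xi * conjc (fker m xi)).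
  rewrite /k FT_expker// conjcM conjc_fnorm conjcM; congr (_ * _).
  by rewrite mulrC resolvent_conj.
rewrite -cintZ; first by apply: eq_cint => xi; rewrite FE mulrCA -[in RHS]mulrA.
have fn0 : fnorm R != 0.
  by rewrite complex_neq0// invr_neq0// gt_eqF// sqrtr_gt0 mulr_gt0// pi_gt0.
apply: (eq_cL1 _ (cL1Z (fnorm R)^-1 (cL1M F2 g2))) => xi.
by rewrite FE mulrCA mulKf// mulrA.
Qed.

Lemma before_fourier z q m : 0 < Im z -> cL2 mu q ->
  before z (fun x => conjc (q x)) m =
  fnorm R * cint mu (fun xi => conjc (fourier q xi) * resolvent z xi * fker m xi).
Proof.
move=> z0 q2; pose c := cdecay z.
have c0 : 0 < Re c by rewrite cdecay_Re mulr_gt0.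
pose k (x : RT) := expker c (m - x).
have k1 : cL1 mu k by exact: cL1_expker_rev.
have kle x : normc (k x) <= 1 by exact: expker_le1.
have k2 := cL2_bounded1 k1 kle.
have kc x : x != m -> cont_at k x.
  move=> xm eta eta0; rewrite eq_sym -subr_eq0 in xm.
  have [d d0 H] := cont_at_expker c xm eta0; exists d => // y yd.
  by apply: H; rewrite opprB addrC addrA subrK distrC.
have := parseval_L2 q2 k1 k2 kle kc.
(* The function under [before] is the conjugate of [q]: Parseval is used for [q] itself and the
   whole identity is then conjugated, which restores the kernel. *)
move=> /(congr1 conjc); have [F2 _] := fourier_spec q2; have Fk := cL2_FT k1 k2.
rewrite -!cint_conjc; last 2 first.
- by apply: cL1M => //; exact: cL2_conjc.
- by apply: cL1M => //; exact: cL2_conjc.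
have -> : cint mu (fun x => conjc (q x * conjc (k x))) = before z (fun x => conjc (q x)) m.
  apply: eq_cint => x; rewrite /k conjcM conjcC -wave_expker subr_gt0.
  by rewrite mulrCA.
move=> <-.
have FE xi : FT k xi = fnorm R * (resolvent z xi * fker m xi).
  by rewrite /k FT_expker_rev// [_ / _]mulrC resolvent_rev.
rewrite -cintZ; first by apply: eq_cint => xi; rewrite conjcM conjcC FE mulrCA -[in RHS]mulrA.
have fn0 : fnorm R != 0.
  by rewrite complex_neq0// invr_neq0// gt_eqF// sqrtr_gt0 mulr_gt0// pi_gt0.
apply: (eq_cL1 _ (cL1Z (fnorm R)^-1 (cL1M (cL2_conjc F2) Fk))) => xi.
by rewrite FE mulrCA mulKf// mulrA.
Qed.

(** Up to [fnorm] the resolvent is the transform of a one-sided exponential, so Plancherel's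
    inequality replaces a direct integration. *)
Lemma cL2_resolvent z : 0 < Im z -> cL2 mu (resolvent z).
Proof.
move=> z0; have c0 : 0 < Re (cdecay z) by rewrite cdecay_Re mulr_gt0.
have k1 := cL1_expker_rev 0 c0.
have k2 := cL2_bounded1 k1 (fun x => expker_le1 _ c0).
have fn0 : fnorm R != 0.
  by rewrite complex_neq0// invr_neq0// gt_eqF// sqrtr_gt0 mulr_gt0// pi_gt0.
have -> : resolvent z = fun xi => (fnorm R)^-1 * FT (fun x => expker (cdecay z) (0 - x)) xi.
  apply/funext => xi; rewrite FT_expker_rev// mulKf// resolvent_rev//.
  by rewrite /fker mul0r mulr0 cexp0 mul1r.
exact: cL2Z (cL2_FT k1 k2).
Qed.

Lemma resolvent_bounded z xi : 0 < Im z -> normc (resolvent z xi) <= (2 * Im z)^-1.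
Proof.
move=> z0; rewrite /resolvent normcM normc_i mul1r normcV lef_pV2 ?posrE ?mulr_gt0//.
  apply: le_trans (normc_Im _); rewrite ler_normr; apply/orP; left.
  by have -> : Im (2 * z + xi%:C) = 2 * Im z by case: z {z0} => a b /=; ring.
by rewrite normc_gt0 den_neq0.
Qed.

End OneSidedExponentials.

Lemma cintegral_mkcond d (T : measurableType d) (R : realType) (mu : {measure set T -> \bar R})
  (D : set T) (b : T -> bool) (f : T -> R[i]) : (forall x, (x \in D) = b x) ->
  cintegral mu D f = cint mu (fun x => ind R (b x) * f x).
Proof.
move=> Db; rewrite /cintegral [X in X +i* _]Rintegral_mkcond [X in _ +i* X]Rintegral_mkcond.
apply: complex_eq; apply: eq_Rintegral => x _; rewrite patchE Db.
  by case: (b x); rewrite ?indT ?indF ?mul1r ?mul0r.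
by case: (b x); rewrite ?indT ?indF ?mul1r ?mul0r.
Qed.

(** * Ordered integrals *)

Section OrderedIntegrals.
Variable R : realType.
Local Notation mu := (@lebesgue_measure R).
Local Notation RT := (measurableTypeR R).
Implicit Types w : RT -> R[i].

Lemma cmeas_lt_pair d (T : measurableType d) (a b : T -> RT) :
  measurable_fun setT a -> measurable_fun setT b -> cmeas (fun t => ind R (a t < b t)).
Proof. by move=> ma mb; apply: cmeas_lt. Qed.

Definition upper w (y : RT) : R[i] := cint mu (fun x => ind R (y < x) * w x).

Lemma cL1_ind_gt w (y : R) : cL1 mu w -> cL1 mu (fun x => ind R (y < x) * w x).
Proof.
move=> w1; apply: (@cL1M_bounded _ _ _ mu _ _ 1) => //; first exact: cmeas_lt.
by move=> x; exact: normc_ind_le1.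
Qed.

Lemma cL1_ind_lt w (y : R) : cL1 mu w -> cL1 mu (fun x => ind R (x < y) * w x).
Proof.
move=> w1; apply: (@cL1M_bounded _ _ _ mu _ _ 1) => //; first exact: cmeas_lt.
by move=> x; exact: normc_ind_le1.
Qed.

Lemma upper_compl w (y : R) : cL1 mu w ->
  cint mu (fun x => ind R (x < y) * w x) = cint mu w - upper w y.
Proof.
move=> w1; rewrite /upper -cintB//; last exact: cL1_ind_gt.
apply: ae_eq_cint; first by case: (cL1_ind_lt y w1).
  by case: (cL1B w1 (cL1_ind_gt y w1)).
apply: (@ae_off_point _ y) => x xy.
have [xy'|xy'|xy'] := ltgtP x y; rewrite ?indT ?indF ?mul1r ?mul0r ?subr0 ?subrr//.
by rewrite xy' eqxx in xy.
Qed.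

Lemma cmeas_upper w : cL1 mu w -> cmeas (upper w).
Proof.
move=> [mw _]; apply: (@cmeas_cint _ _ RT RT R mu (fun p => ind R (p.1 < p.2) * w p.2)).
by apply: cmeasM; [exact: cmeas_lt_pair|exact: cmeas_comp mw _].
Qed.

Lemma upper_bounded w (y : R) : cL1 mu w -> normc (upper w y) <= fine (nint mu w).
Proof.
move=> w1; rewrite -lee_fin fineK ?nint_fin//.
have h := cL1_ind_gt y w1; apply: (le_trans (le_normc_cint h)).
apply: le_nint; [by case: h|by case: w1|] => x.
by rewrite normcM ler_piMl ?normc_ge0 ?normc_ind_le1.
Qed.

Lemma cL1_upperM w w' : cL1 mu w -> cL1 mu w' -> cL1 mu (fun y => w' y * upper w y).
Proof.
move=> w1 w1'; apply: (eq_cL1 (f := fun y => upper w y * w' y)) => [y|]; first by rewrite mulrC.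
apply: (@cL1M_bounded _ _ _ mu _ _ (fine (nint mu w))) => //; first exact: cmeas_upper.
by move=> y; exact: upper_bounded.
Qed.

(** Fubini on the half-plane of ordered pairs: fixing the larger variable leaves the lower tail of
    [w'], the complement of its upper tail. *)
Lemma upper_swap w w' : cL1 mu w -> cL1 mu w' ->
  cint mu (fun y => w' y * upper w y) = cint mu (fun x => w x * (cint mu w' - upper w' x)).
Proof.
move=> w1 w1'.
have T1 : cL1 (pm mu mu) (fun p => ind R (p.1 < p.2) * (w' p.1 * w p.2)).
  apply: (@cL1M_bounded _ _ _ (pm mu mu) _ _ 1); first exact: cmeas_lt_pair.
    by move=> x; exact: normc_ind_le1.
  exact: cL1_tensor.
have := cint_swap T1 => /= S.
transitivity (cint mu (fun x => cint mu (fun y => ind R (x < y) * (w' x * w y)))).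
  apply: eq_cint => x; rewrite /upper -cintZ; last exact: cL1_ind_gt.
  by apply: eq_cint => y; rewrite mulrCA.
rewrite S; apply: eq_cint => x; rewrite -(upper_compl x w1') -(cintZ _ (cL1_ind_lt x w1')).
by apply: eq_cint => y; rewrite [w' _ * _]mulrC mulrCA.
Qed.

(** The ordered pairs make up half of the square: [upper_swap] with [w' = w] equates the integral
    with its complement in the full square. *)
Lemma upper_self w : cL1 mu w -> cint mu (fun y => w y * upper w y) = 2^-1 * cint mu w ^+ 2.
Proof.
move=> w1; set T := cint _ _.
have : T = cint mu w ^+ 2 - T.
  rewrite {1}/T upper_swap//.
  have -> : cint mu w ^+ 2 - T = cint mu (fun x => w x * cint mu w - w x * upper w x).
    rewrite cintB; [|by apply: (eq_cL1 _ (cL1Z (cint mu w) w1)) => x; rewrite mulrC|exact: cL1_upperM].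
    by rewrite cintZr.
  by apply: eq_cint => x; rewrite mulrBr.
move=> /eqP; rewrite -subr_eq0 => /eqP TE.
have t2 : (2%:R : R[i]) != 0 by rewrite -normc_eq0 normc_nat pnatr_eq0.
apply: (mulfI t2); rewrite mulrA divff// mul1r.
apply/eqP; rewrite -subr_eq0; apply/eqP; rewrite -TE; ring.
Qed.

End OrderedIntegrals.

(** * The ordered quadruple integral and the marginals of a pair *)

Section FourthOrder.
Variable R : realType.
Local Notation mu := (@lebesgue_measure R).
Local Notation RT := (measurableTypeR R).
Variables (q : RT -> R[i]) (z : R[i]).
Hypotheses (q2 : cL2 mu q) (z0 : 0 < Im z).

Local Notation W := (wave z).
Local Notation f := (after z q).
Local Notation g := (before z (fun x => conjc (q x))).

Definition pair (p : RT * RT) : R[i] := ind R (p.1 < p.2) * (q p.2 * conjc (q p.1) * W (p.2 - p.1)).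

Lemma decay_gt0 : 0 < Re (cdecay z). Proof. by rewrite cdecay_Re mulr_gt0. Qed.

Lemma waveD (s t : R) : W (s + t) = W s * W t.
Proof. by rewrite /wave -cexpD complexD mulrDr. Qed.

Lemma pair_expker p : pair p = q p.2 * conjc (q p.1) * expker (cdecay z) (p.2 - p.1).
Proof. by rewrite /pair -wave_expker subr_gt0 mulrCA. Qed.

Lemma cmeas_expker_diff : cmeas (fun p : RT * RT => expker (cdecay z) (p.2 - p.1)).
Proof. by apply: (cmeas_comp (cmeas_expker (cdecay z))); exact: measurable_funB. Qed.

Lemma cmeas_pair : cmeas pair.
Proof.
have [mq _] := q2; rewrite (_ : pair = fun p => q p.2 * conjc (q p.1) * expker (cdecay z) (p.2 - p.1)).
  apply: cmeasM; last exact: cmeas_expker_diff.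
  apply: cmeasM; first exact: cmeas_comp mq _.
  by apply: (cmeas_comp (cmeas_conjc mq)).
by apply/funext => p; exact: pair_expker.
Qed.

(* AM-GM: [|q x q y| <= (|q x|^2 + |q y|^2) / 2], then each term is integrated
   first against the exponential. *)
Lemma cL1_pair : cL1 (pm mu mu) pair.
Proof.
have c0 := decay_gt0; have [mq _] := q2.
have mE := cmeas_expker_diff.
pose sq x : R[i] := (normc (q x) ^+ 2)%:C.
have msq : cmeas (sq : RT -> R[i]).
  by apply: cmeas_real; apply: measurable_funX; exact: measurable_normc.
have nsq : (nint mu sq < +oo)%E.
  have -> : nint mu sq = n2 mu q.
    by apply: eq_integral => x _; rewrite normc_real ger0_norm ?sqr_ge0.
  by case: q2.
have e1 := cL1_cexp c0.
pose G1 (p : RT * RT) := sq p.1 * expker (cdecay z) (p.2 - p.1).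
pose G2 (p : RT * RT) := sq p.2 * expker (cdecay z) (p.2 - p.1).
have mG1 : cmeas G1 by apply: cmeasM => //; exact: cmeas_comp msq _.
have mG2 : cmeas G2 by apply: cmeasM => //; exact: cmeas_comp msq _.
have fin : (nint mu sq * nint mu (expker (cdecay z)) < +oo)%E.
  by apply: lte_mul_pinfty; rewrite ?nint_ge0// ?ge0_fin_numE ?nint_ge0//; case: e1.
have mk := cmeas_expker (cdecay z).
have G11 : cL1 (pm mu mu) G1.
  split=> //; rewrite nint_prod1//.
  have -> : (\int[mu]_x nint mu (fun y => G1 (x, y)) =
     \int[mu]_x ((normc (sq x))%:E * nint mu (expker (cdecay z))))%E.
    apply: eq_integral => x _; rewrite /G1 /= nintZ; last exact: cmeas_shift.
    congr (_ * _)%E.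
    exact: (nint_invariant (measurable_shift (- x)) (@lebesgue_measureD R (- x)) mk).
  rewrite ge0_integralZr// ?nint_ge0//; first exact: mnormc.
  by move=> x _; rewrite lee_fin normc_ge0.
have G21 : cL1 (pm mu mu) G2.
  split=> //; rewrite nint_prod2//.
  have -> : (\int[mu]_y nint mu (fun x => G2 (x, y)) =
     \int[mu]_y ((normc (sq y))%:E * nint mu (expker (cdecay z))))%E.
    apply: eq_integral => y _; rewrite /G2 /= nintZ; last first.
      by case: (cL1_rev y e1).
    congr (_ * _)%E.
    have := nint_invariant (@measurable_opp R) (@lebesgue_measureN R) (cmeas_shift y mk).
    have := nint_invariant (measurable_shift y) (@lebesgue_measureD R y) mk.
    by move=> -> <-; congr nint; apply/funext => x; rewrite addrC.
  rewrite ge0_integralZr// ?nint_ge0//; first exact: mnormc.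
  by move=> x _; rewrite lee_fin normc_ge0.
have G3 := cL1Z (2^-1)%:C (cL1D G11 G21).
apply: (cL1_le cmeas_pair G3) => p.
rewrite pair_expker /G1 /G2 -mulrDl mulrA normcM [leRHS]normcM.
rewrite ler_wpM2r ?normc_ge0// /sq -complexD -complexM normc_real normcM normc_conjc.
rewrite ger0_norm; last by rewrite mulr_ge0// addr_ge0 ?sqr_ge0.
by have := sqr_ge0 (normc (q p.1) - normc (q p.2)); lra.
Qed.

Lemma cL2_expker_shift (m : R) : cL2 mu (fun x => expker (cdecay z) (x - m)).
Proof.
have c0 := decay_gt0; apply: cL2_bounded1; first exact: cL1_expker_shift.
by move=> x; exact: expker_le1.
Qed.

Lemma cL2_expker_rev (m : R) : cL2 mu (fun x => expker (cdecay z) (m - x)).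
Proof.
have c0 := decay_gt0; apply: cL2_bounded1; first exact: cL1_expker_rev.
by move=> x; exact: expker_le1.
Qed.

Lemma cL1_after (m : R) : cL1 mu (fun y => ind R (m < y) * (q y * W (y - m))).
Proof.
apply: (eq_cL1 _ (cL1M q2 (cL2_expker_shift m))) => y.
by rewrite -wave_expker subr_gt0 mulrCA.
Qed.

Lemma cL1_before (m : R) : cL1 mu (fun x => ind R (x < m) * (conjc (q x) * W (m - x))).
Proof.
apply: (eq_cL1 _ (cL1M (cL2_conjc q2) (cL2_expker_rev m))) => y.
by rewrite -wave_expker subr_gt0 mulrCA.
Qed.

(** The two marginals of [pair]: [uu] keeps the later point of the pair and [vv] the earlier one. *)
Definition uu (y : RT) : R[i] := q y * g y.
Definition vv (x : RT) : R[i] := conjc (q x) * f x.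

Lemma pair_fst x : cint mu (fun y => pair (x, y)) = vv x.
Proof.
rewrite /vv /after -cintZ; last exact: cL1_after.
by apply: eq_cint => y; rewrite /pair /=; ring.
Qed.

Lemma pair_snd y : cint mu (fun x => pair (x, y)) = uu y.
Proof.
rewrite /uu /before -cintZ; last exact: cL1_before.
by apply: eq_cint => x; rewrite /pair /=; ring.
Qed.

Lemma cL1_pair_fst x : cL1 mu (fun y => pair (x, y)).
Proof.
apply: (eq_cL1 _ (cL1Z (conjc (q x)) (cL1_after x))) => y.
by rewrite /pair /=; ring.
Qed.

Lemma cL1_pair_snd y : cL1 mu (fun x => pair (x, y)).
Proof.
apply: (eq_cL1 _ (cL1Z (q y) (cL1_before y))) => x.
by rewrite /pair /=; ring.
Qed.

Lemma cL1_vv : cL1 mu vv.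
Proof. by apply: (eq_cL1 _ (cL1_cint cL1_pair)) => x; rewrite pair_fst. Qed.

Lemma cL1_uu : cL1 mu uu.
Proof. by apply: (eq_cL1 _ (cL1_cint (cL1_swap cL1_pair))) => y; rewrite -pair_snd. Qed.

Lemma cint_pair_vv : cint (pm mu mu) pair = cint mu vv.
Proof. by rewrite (cint_prod1 cL1_pair); apply: eq_cint => x; exact: pair_fst. Qed.

Lemma cint_pair_uu : cint (pm mu mu) pair = cint mu uu.
Proof. by rewrite (cint_prod2 cL1_pair); apply: eq_cint => x; exact: pair_snd. Qed.

Definition fg (y : RT) : R[i] := f y * g y.

(* The region [y < x], [t < x] minus the region [y < t < x] is [t <= y < x],
   where the integrand factorizes. *)
Lemma fgE y : fg y = upper uu y - upper vv y.
Proof.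
apply/esym; rewrite /fg.
have P1 := cL1_pair; have P1' := cL1_swap P1.
have A1 : cL1 (pm mu mu) (fun p => ind R (y < p.1) * pair p).
  apply: (@cL1M_bounded _ _ _ (pm mu mu) _ _ 1) => //; first exact: cmeas_lt_pair.
  by move=> x; exact: normc_ind_le1.
have E1 : upper uu y = cint mu (fun x => cint mu (fun t => ind R (y < x) * pair (t, x))).
  apply: eq_cint => x; rewrite -pair_snd -cintZ//; exact: cL1_pair_snd.
have E2 : upper vv y = cint mu (fun x => cint mu (fun t => ind R (y < t) * pair (t, x))).
  rewrite -(cint_swap A1) /=; apply: eq_cint => t; rewrite -pair_fst -cintZ//.
  exact: cL1_pair_fst.
have L1 : cL1 mu (fun x => cint mu (fun t => ind R (y < x) * pair (t, x))).
  apply: (eq_cL1 _ (cL1_ind_gt y cL1_uu)) => x; rewrite -pair_snd -cintZ//.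
  exact: cL1_pair_snd.
have L2 : cL1 mu (fun x => cint mu (fun t => ind R (y < t) * pair (t, x))).
  exact: (cL1_cint (cL1_swap A1)).
rewrite E1 E2 -(cintB L1 L2).
rewrite /after -cintZr; last exact: cL1_after.
apply: eq_cint => x; rewrite /before.
rewrite -cintZ; last exact: cL1_before.
have B1 : cL1 mu (fun t => ind R (y < x) * pair (t, x)) by exact: (cL1Z _ (cL1_pair_snd x)).
have B2 : cL1 mu (fun t => ind R (y < t) * pair (t, x)).
  exact: (cL1_ind_gt y (cL1_pair_snd x)).
rewrite -(cintB B1 B2); apply: ae_eq_cint; first by case: (cL1B B1 B2).
  by case: (cL1Z (ind R (y < x) * (q x * W (x - y))) (cL1_before y)).
apply: (@ae_off_point _ y) => t ty; rewrite /pair /=.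
have -> : W (x - t) = W (x - y) * W (y - t) by rewrite -waveD addrA subrK.
have [yx|xy] := ltP y x.
  have [ty'|yt|yt] := ltgtP t y; last by rewrite yt eqxx in ty.
    have -> : t < x by exact: lt_trans yx.
    by rewrite !indT !indF; ring.
  by rewrite !indT !indF; ring.
have [ty'|yt|yt] := ltgtP t y; last by rewrite yt eqxx in ty.
  by rewrite !indF; ring.
have -> : (t < x) = false by apply/negP/negP; rewrite -leNgt (le_trans xy)// ltW.
by rewrite !indF; ring.
Qed.

Lemma cL1_fgM w : cL1 mu w -> cL1 mu (fun y => w y * fg y).
Proof.
move=> w1; apply: (eq_cL1 _ (cL1B (cL1_upperM cL1_uu w1) (cL1_upperM cL1_vv w1))) => y.
by rewrite fgE mulrBr.
Qed.

(** By [upper_self], half the square is the integral of [uu] against its own upper tail; by [fgE],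
    exchanging that tail for the tail of [vv] costs exactly [fg]. *)
Lemma ordered_uu : cint mu (fun y => uu y * upper vv y) =
  2^-1 * cint (pm mu mu) pair ^+ 2 - cint mu (fun y => uu y * fg y).
Proof.
rewrite cint_pair_uu -upper_self; last exact: cL1_uu.
rewrite -cintB; [|exact: (cL1_upperM cL1_uu cL1_uu)|exact: (cL1_fgM cL1_uu)].
apply: eq_cint => y; rewrite fgE.
by move: (uu y) (upper uu y) (upper vv y) => a b c; ring.
Qed.

(** The same computation with [vv] outermost, after [upper_swap]; it relies on [uu] and [vv] having
    the same total integral. *)
Lemma ordered_vv : cint mu (fun y => uu y * upper vv y) =
  2^-1 * cint (pm mu mu) pair ^+ 2 - cint mu (fun y => vv y * fg y).
Proof.
have V := cL1_vv; have U := cL1_uu; have H := upper_self V.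
rewrite (upper_swap V U) -cint_pair_uu cint_pair_vv.
(* In this form half the square matches the complement of [upper uu] that [upper_swap] has
   produced. *)
have -> : 2^-1 * cint mu vv ^+ 2 = cint mu vv * cint mu vv - 2^-1 * cint mu vv ^+ 2.
  by field.
have L1 := cL1Z (cint mu vv) V; have L2 := cL1_upperM V V.
rewrite -H -(cintZ (cint mu vv) V) -(cintB L1 L2) -(cintB (cL1B L1 L2) (cL1_fgM V)).
apply: eq_cint => y; rewrite fgE.
by move: (vv y) (upper uu y) (upper vv y) (cint mu vv) => a b c d; ring.
Qed.

(** A chain of four points is seen as two ordered pairs with a single link, from the later point of
    the first to the earlier point of the second. *)
Definition quad (p : RT * RT * RT * RT) : R[i] :=
  ind R (p.1.1.2 < p.1.2) * (pair p.1.1 * pair (p.1.2, p.2)).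

Lemma cL1_quad : cL1 (pm (pm (pm mu mu) mu) mu) quad.
Proof.
have P1 := cL1_pair; have mp := cmeas_pair.
have mprod : cmeas (fun p : RT * RT * RT * RT => pair p.1.1 * pair (p.1.2, p.2)).
  apply: cmeasM.
    by apply: (cmeas_comp mp); exact: measurableT_comp.
  apply: (cmeas_comp mp); apply: measurable_fun_pair => //.
  exact: measurableT_comp.
apply: (@cL1M_bounded _ _ _ _ _ _ 1).
- apply: cmeas_lt_pair; last exact: measurableT_comp.
  by apply: (measurableT_comp (f := snd)) => //; exact: measurableT_comp.
- by move=> p; exact: normc_ind_le1.
split=> //; rewrite nint_prod1//.
(* The measure is nested one variable at a time, so the second pair is integrated out through the
   norm [a] of its slices; taken as a complex function, [a] fits [cL1_tensor]. *)
pose a (x : RT) : R[i] := (fine (nint mu (fun y => pair (x, y))))%:C.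
have ma : cmeas a.
  apply: cmeas_real; apply: (measurableT_comp (f := fine)); first exact: fine_measurable.
  exact: measurable_nint1.
have naE x : nint mu (fun y => pair (x, y)) = (normc (a x))%:E.
  rewrite normc_real ger0_norm ?fine_ge0 ?nint_ge0// fineK// nint_fin//.
  exact: cL1_pair_fst.
have a1 : cL1 mu a.
  split=> //; have := proj2 P1; rewrite nint_prod1//.
  by congr (_ < _)%E; apply: eq_integral => x _; rewrite naE.
have [_] := cL1_tensor P1 a1.
congr (_ < _)%E; apply: eq_integral => p _.
have -> : (fun y => pair (p, y).1.1 * pair ((p, y).1.2, (p, y).2)) =
  (fun y => pair p.1 * pair (p.2, y)) by [].
rewrite nintZ; last by case: (cL1_pair_fst p.2).
by rewrite naE normcM EFinM.
Qed.

(** Integrating [y2], then [x2], then [x1] produces [vv] at [x2], its upper tail at [y1], and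
    finally [uu] at [y1]. *)
Lemma cint_quad : cint (pm (pm (pm mu mu) mu) mu) quad = cint mu (fun y => uu y * upper vv y).
Proof.
have Q1 := cL1_quad; rewrite (cint_prod1 Q1).
have E1 (p : RT * RT * RT) : cint mu (fun y => quad (p, y)) = pair p.1 * (ind R (p.1.2 < p.2) * vv p.2).
  rewrite -pair_fst -cintZ; last exact: cL1_pair_fst.
  rewrite -cintZ; last by apply: cL1Z; exact: cL1_pair_fst.
  by apply: eq_cint => y; rewrite /quad /= mulrCA.
rewrite (eq_cint _ E1).
have Q2 := cL1_cint Q1; have {}Q2 := eq_cL1 E1 Q2.
rewrite (cint_prod1 Q2).
have E2 (p : RT * RT) : cint mu (fun x => pair p * (ind R (p.2 < x) * vv x)) = pair p * upper vv p.2.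
  by rewrite cintZ//; apply: cL1_ind_gt; exact: cL1_vv.
rewrite (eq_cint _ E2).
have Q3 := eq_cL1 E2 (cL1_cint Q2).
rewrite (cint_prod2 Q3); apply: eq_cint => y /=.
by rewrite cintZr ?pair_snd//; exact: cL1_pair_snd.
Qed.

End FourthOrder.

(** * The two cubic formulas for [b4] *)

Section B4.
Variable R : realType.
Local Notation mu := (@lebesgue_measure R).
Local Notation RT := (measurableTypeR R).
Variables (q : RT -> R[i]) (lambda : R[i]).
Hypotheses (q2 : cL2 mu q) (z0 : 0 < Im (lambda ^+ 2)).

Lemma s2E : s2 q lambda = - lambda ^+ 2 * cint (pm mu mu) (pair q (lambda ^+ 2)).
Proof.
rewrite /s2; congr (_ * _).
rewrite (@cintegral_mkcond _ _ _ (pm mu mu) _ (fun p : RT * RT => p.1 < p.2)).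
  by apply: eq_cint => -[x y].
by move=> p; apply/idP/idP; rewrite inE.
Qed.

Lemma s4E : s4 q lambda = lambda ^+ 4 * cint (pm (pm (pm mu mu) mu) mu) (quad q (lambda ^+ 2)).
Proof.
rewrite /s4; congr (_ * _).
rewrite (@cintegral_mkcond _ _ _ (pm (pm (pm mu mu) mu) mu) _ (fun p : RT * RT * RT * RT =>
  (p.1.1.2 < p.1.2) && ((p.1.1.1 < p.1.1.2) && (p.1.2 < p.2)))).
  apply: eq_cint => -[[[x1 y1] x2] y2]; rewrite /quad /pair /= !ind_and /wave; ring.
move=> -[[[x1 y1] x2] y2]; apply/idP/idP; rewrite inE /=.
  by move=> [-> -> ->].
by move=> /and3P[].
Qed.

Lemma b4_uu : b4 q lambda = - lambda ^+ 4 *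
  cint mu (fun y => uu q (lambda ^+ 2) y * fg q (lambda ^+ 2) y).
Proof. by rewrite /b4 s4E s2E (cint_quad q2 z0) (ordered_uu q2 z0);
  move: (cint _ _) (cint _ _) => a b; ring. Qed.

Lemma b4_vv : b4 q lambda = - lambda ^+ 4 *
  cint mu (fun y => vv q (lambda ^+ 2) y * fg q (lambda ^+ 2) y).
Proof. by rewrite /b4 s4E s2E (cint_quad q2 z0) (ordered_vv q2 z0);
  move: (cint _ _) (cint _ _) => a b; ring. Qed.

End B4.

(** * The Fourier representation *)

Section Trilinear.
Variable R : realType.
Local Notation mu := (@lebesgue_measure R).
Local Notation RT := (measurableTypeR R).
Local Notation mu3 := (pm (pm mu mu) mu).
Implicit Types (q alpha beta gamma D : RT -> R[i]).

(** The dependent frequency [xi_2], for the triple [(xi_1, eta_1, eta_2)]. *)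
Definition momentum (p : RT * RT * RT) : RT := p.1.2 + p.2 - p.1.1.

Lemma measurable_momentum : measurable_fun setT momentum.
Proof.
apply: measurable_funB; last exact: measurableT_comp.
by apply: measurable_funD => //; exact: measurableT_comp.
Qed.

Definition triple alpha beta gamma (p : RT * RT * RT) : R[i] :=
  alpha p.1.1 * beta p.1.2 * gamma p.2.

Lemma cL1_triple alpha beta gamma : cL1 mu alpha -> cL1 mu beta -> cL1 mu gamma ->
  cL1 mu3 (triple alpha beta gamma).
Proof. by move=> a1 b1 g1; exact: (cL1_tensor (cL1_tensor a1 b1) g1). Qed.

Lemma cint_triple alpha beta gamma : cL1 mu alpha -> cL1 mu beta -> cL1 mu gamma ->
  cint mu3 (triple alpha beta gamma) = cint mu alpha * cint mu beta * cint mu gamma.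
Proof.
move=> a1 b1 g1; rewrite -(cint_tensor a1 b1).
exact: (cint_tensor (cL1_tensor a1 b1) g1).
Qed.

(** As a function of the last variable, [momentum] is a translation, so Cauchy-Schwarz applies there
    without changing the norm of [D]; the other two factors are integrated afterwards. *)
Lemma nint_tripleM alpha beta gamma D : cL1 mu alpha -> cL1 mu beta -> cL1 mu gamma ->
  cL2 mu gamma -> cL2 mu D ->
  (nint mu3 (fun p => (triple alpha beta gamma p * D (momentum p))%R) <=
   nint (pm mu mu) (fun p => (alpha p.1 * beta p.2)%R) * (norm2 mu gamma * norm2 mu D)%:E)%E.
Proof.
move=> a1 b1 g1 g2 D2; have [mD _] := D2; have ab1 := cL1_tensor a1 b1.
have mT : cmeas (fun p => triple alpha beta gamma p * D (momentum p)).
  apply: cmeasM; first by case: (cL1_triple a1 b1 g1).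
  exact: (cmeas_comp mD measurable_momentum).
rewrite nint_prod1// -ge0_integralZr//; last 3 first.
- by apply: mnormc; case: ab1.
- by move=> p _; rewrite lee_fin normc_ge0.
- by rewrite lee_fin mulr_ge0// norm2_ge0.
have mab : cmeas (fun p : RT * RT => alpha p.1 * beta p.2) by case: ab1.
have E (p : RT * RT) : nint mu (fun y => triple alpha beta gamma (p, y) * D (momentum (p, y))) =
    ((normc (alpha p.1 * beta p.2))%:E *
     nint mu (fun y => (gamma y * D (y + (p.2 - p.1)))%R))%E.
  rewrite -nintZ; last by apply: cmeasM; [case: g1|exact: cmeas_shift].
  apply: eq_nint => y; rewrite /triple /momentum /= -!mulrA.
  by have -> : p.2 + y - p.1 = y + (p.2 - p.1) by rewrite addrAC addrC.
apply: ge0_le_integral => //.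
- by move=> p _; exact: nint_ge0.
- exact: (measurable_nint1 mu mT).
- by apply: emeasurable_funM => //; exact: mnormc.
move=> p _; rewrite E; apply: lee_wpmul2l; first by rewrite lee_fin normc_ge0.
have Ds : cL2 mu (fun y => D (y + (p.2 - p.1))).
  by split; [exact: cmeas_shift|rewrite n2_shift//; case: D2].
apply: (le_trans (cauchy_schwarz g2 Ds)); rewrite lee_fin.
by rewrite /norm2 n2_shift.
Qed.

Lemma cL1_tripleM alpha beta gamma D : cL1 mu alpha -> cL1 mu beta -> cL1 mu gamma ->
  cL2 mu gamma -> cL2 mu D -> cL1 mu3 (fun p => triple alpha beta gamma p * D (momentum p)).
Proof.
move=> a1 b1 g1 g2 D2; have [mD _] := D2; split.
  apply: cmeasM; first by case: (cL1_triple a1 b1 g1).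
  exact: (cmeas_comp mD measurable_momentum).
apply: (le_lt_trans (nint_tripleM a1 b1 g1 g2 D2)).
rewrite lte_mul_pinfty ?nint_ge0 ?ltry// ge0_fin_numE ?nint_ge0//.
by case: (cL1_tensor a1 b1).
Qed.

Lemma fnorm_neq0 : fnorm R != 0.
Proof. by rewrite complex_neq0// invr_neq0// gt_eqF// sqrtr_gt0 mulr_gt0// pi_gt0. Qed.

Lemma cint_fker q xi : cint mu (fun x => q x * fker x xi) = (fnorm R)^-1 * FT q xi.
Proof. by rewrite /FT mulKf// fnorm_neq0. Qed.

Lemma fker_momentum m p : fker m (momentum p) =
  conjc (fker m p.1.1) * fker m p.1.2 * fker m p.2.
Proof.
have fkerC x xi : fker x xi = fker xi x :> R[i] by rewrite /fker (mulrC x).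
rewrite conjc_fker (fkerC m) /momentum !fkerD -!(fkerC m).
have -> : fker m (- p.1.1) = fker (- m) p.1.1 by rewrite /fker (mulrN m) (mulNr m).
by rewrite mulrC mulrA.
Qed.

(** For truncated [q] this is Fubini, the characters in [A], [B] and [C] combining into the one at
    [momentum]. The truncation is removed on the left by domination and on the right by
    [nint_tripleM] with convergence in [L^2]. The inverse of [fnorm] appears because the integral in
    [m] lacks the normalisation of [FT]. *)
Lemma cint_quadrilinear q alpha beta gamma : cL2 mu q ->
  cL1 mu alpha -> cL1 mu beta -> cL1 mu gamma -> cL2 mu gamma ->
  let A m := cint mu (fun xi => alpha xi * conjc (fker m xi)) in
  let B m := cint mu (fun xi => beta xi * fker m xi) in
  let C m := cint mu (fun xi => gamma xi * fker m xi) in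
  cL1 mu (fun m => q m * (A m * B m * C m)) ->
  cint mu (fun m => q m * (A m * B m * C m)) =
  (fnorm R)^-1 * cint mu3 (fun p => triple alpha beta gamma p * fourier q (momentum p)).
Proof.
move=> q2 a1 b1 g1 g2 A B C qABC; have P1 := cL1_triple a1 b1 g1.
have [F2 Fcvg] := fourier_spec q2; have [mP _] := P1.
have mm := measurable_momentum.
have mkm m : cmeas (fun p => fker m (momentum p)) by apply: cmeas_fker.
have ABC m : A m * B m * C m = cint mu3 (fun p => triple alpha beta gamma p * fker m (momentum p)).
  have a1' : cL1 mu (fun xi => alpha xi * conjc (fker m xi)).
    apply: (cL1_le _ a1); first by apply: cmeasM; [case: a1|apply: cmeas_conjc; exact: cmeas_fkerr].
    by move=> x; rewrite normcM normc_conjc normc_fker mulr1.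
  have k1 k : cL1 mu k -> cL1 mu (fun xi => k xi * fker m xi).
    move=> k1; apply: (cL1_le _ k1); first by apply: cmeasM; [case: k1|exact: cmeas_fkerr].
    by move=> x; rewrite normc_mul_fker.
  rewrite -(cint_triple a1' (k1 _ b1) (k1 _ g1)); apply: eq_cint => p.
  by rewrite fker_momentum /triple; ring.
have FE n : cint mu (fun m => trunc q n m * (A m * B m * C m)) =
    (fnorm R)^-1 * cint mu3 (fun p => triple alpha beta gamma p * FT (trunc q n) (momentum p)).
  have t1 := cL1_trunc n q2; have t2 := cL2_trunc n q2.
  pose Phi (x : RT * (RT * RT * RT)) := trunc q n x.1 * triple alpha beta gamma x.2 * fker x.1 (momentum x.2).
  have Phi1 : cL1 (pm mu mu3) Phi.
    have T := cL1_tensor t1 P1; apply: (cL1_le _ T).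
      apply: cmeasM; first by case: T.
      by apply: cmeas_fker => //; exact: measurableT_comp.
    by move=> p; rewrite /Phi normc_mul_fker.
  have tF := cL1_tripleM a1 b1 g1 g2 (cL2_FT t1 t2).
  rewrite -(cintZ _ tF).
  transitivity (cint mu (fun m => cint mu3 (fun p => Phi (m, p)))).
    apply: eq_cint => m; rewrite ABC -cintZ.
      by apply: eq_cint => p; rewrite mulrA.
    by apply: (cL1_le _ P1); [exact: cmeasM|move=> p; rewrite normc_mul_fker].
  rewrite (cint_swap Phi1); apply: eq_cint => p /=.
  rewrite mulrCA -cint_fker -cintZ; last exact: cL1_fkerl.
  by apply: eq_cint => m; rewrite /Phi /= -mulrA mulrCA.
have L : ccvg (fun n => cint mu (fun m => trunc q n m * (A m * B m * C m)))
    (cint mu (fun m => q m * (A m * B m * C m))).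
  have [mqABC qABCoo] := qABC.
  refine (@ccvg_dominated R _ _ mu _ _ (fun m => normc (q m * (A m * B m * C m))) _ _ _ _ _ _).
  - move=> n.
    have -> : (fun m => trunc q n m * (A m * B m * C m)) =
      fun m => ind R ((- n%:R <= m) && (m <= n%:R)) * (q m * (A m * B m * C m)).
      by apply/funext => m; rewrite /trunc -mulrA.
    by apply: cmeasM => //; exact: cmeas_itv_ind.
  - exact: mqABC.
  - exact: measurable_normc.
  - exact: qABCoo.
  - move=> n m; rewrite /trunc -[_ * q m * _]mulrA normcM.
    by rewrite ler_piMl ?normc_ge0 ?normc_ind_le1.
  - apply: aeW => m; apply: ccvg_near; apply: filterS (trunc_eventually q m) => n.
    by move=> ->.
apply: ccvg_unique L _.
have -> : (fun n => cint mu (fun m => trunc q n m * (A m * B m * C m))) =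
  fun n => (fnorm R)^-1 * cint mu3 (fun p => triple alpha beta gamma p * FT (trunc q n) (momentum p)).
  by apply/funext => n; exact: FE.
apply: ccvgZ.
have t2 n : cL2 mu (FT (trunc q n)) by apply: cL2_FT; [exact: cL1_trunc|exact: cL2_trunc].
have d2 n : cL2 mu (fun xi => fourier q xi - FT (trunc q n) xi) by exact: (cL2B F2 (t2 n)).
have ab1 := cL1_tensor a1 b1.
apply: (@ccvg_normc _ _ _ (fun n => fine (nint (pm mu mu) (fun p => alpha p.1 * beta p.2)) *
   (norm2 mu gamma * norm2 mu (fun xi => fourier q xi - FT (trunc q n) xi)))) => [n|].
  have T1 := cL1_tripleM a1 b1 g1 g2 F2; have T2 := cL1_tripleM a1 b1 g1 g2 (t2 n).
  have T3 := cL1_tripleM a1 b1 g1 g2 (d2 n).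
  rewrite -normc_opp opprB -(cintB T1 T2).
  have -> : cint mu3 (fun p => triple alpha beta gamma p * fourier q (momentum p) -
      triple alpha beta gamma p * FT (trunc q n) (momentum p)) =
    cint mu3 (fun p => triple alpha beta gamma p * (fourier q (momentum p) - FT (trunc q n) (momentum p))).
    by apply: eq_cint => p; rewrite mulrBr.
  rewrite -lee_fin EFinM fineK ?nint_fin//.
  apply: (le_trans (le_normc_cint T3)).
  exact: (nint_tripleM a1 b1 g1 g2 (d2 n)).
have H : (fun n => fine (n2 mu (fun xi => fourier q xi - FT (trunc q n) xi))) @ \oo --> (0 : R).
  by apply: fine_cvg; exact: Fcvg.
have := continuous_cvg _ (@sqrt_continuous R _) H; rewrite sqrtr0 => H1.
rewrite -[X in _ --> X](mulr0 (fine (nint (pm mu mu) (fun p => alpha p.1 * beta p.2)))).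
apply: cvgM; first exact: cvg_cst.
rewrite -[X in _ --> X](mulr0 (norm2 mu gamma)).
by apply: cvgM; [exact: cvg_cst|exact: H1].
Qed.

End Trilinear.

(** * Both cubic integrals in terms of transforms *)

Section FourierSide.
Variable R : realType.
Local Notation mu := (@lebesgue_measure R).
Local Notation RT := (measurableTypeR R).
Local Notation mu3 := (pm (pm mu mu) mu).
Variables (q : RT -> R[i]) (z : R[i]).
Hypotheses (q2 : cL2 mu q) (z0 : 0 < Im z).
Local Notation Q := (fourier q).
Local Notation r := (resolvent z).

Lemma fourier_cL2 : cL2 mu Q. Proof. by have [] := fourier_spec q2. Qed.

(** Three factors come from the three one-sided convolutions and the inverse from
    [cint_quadrilinear]; this is the origin of [1 / (2 pi)] in the Fourier formula. *)
Lemma fnorm3 : fnorm R ^+ 3 * (fnorm R)^-1 = ((2 * pi)^-1)%:C.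
Proof. by rewrite -fnorm_sqr exprSr mulfK ?fnorm_neq0// expr2. Qed.

Lemma cL1_weighted (a b : RT -> R[i]) : cL2 mu a -> cL2 mu b -> cL1 mu (fun xi => a xi * b xi).
Proof. exact: cL1M. Qed.

Lemma cL2_weighted (a : RT -> R[i]) : cL2 mu a -> cL2 mu (fun xi => a xi * r xi).
Proof.
move=> a2; have [mr _] := cL2_resolvent z0; have [ma _] := a2.
apply: (cL2_le _ (cL2Z ((2 * Im z)^-1)%:C a2)); first exact: cmeasM.
move=> xi; rewrite normcM [leRHS]normcM mulrC; apply: ler_wpM2r; first exact: normc_ge0.
by rewrite normc_real (le_trans (resolvent_bounded xi z0))// ler_norm.
Qed.

Lemma cL2_weighted_conjc (a : RT -> R[i]) : cL2 mu a -> cL2 mu (fun xi => a xi * conjc (r xi)).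
Proof.
move=> a2; have := cL2_conjc (cL2_weighted (cL2_conjc a2)).
by apply: eq_cL2 => xi; rewrite conjcM conjcC.
Qed.

Definition wave4 (p : RT * RT * RT) : R[i] :=
  Q p.1.2 * Q p.2 * conjc (Q p.1.1) * conjc (Q (momentum p)).
Definition resolvent3 (p : RT * RT * RT) : R[i] := r p.1.1 * r p.1.2 * r p.2.

(** Here [q] and [f] supply the two unconjugated transforms, and the two factors [g] the conjugated
    ones, at [eta_1] and [eta_2]; hence the conjugate of [wave4]. *)
Lemma uu_fgE : cint mu (fun m => uu q z m * fg q z m) =
  ((2 * pi)^-1)%:C * cint mu3 (fun p => resolvent3 p * conjc (wave4 p)) /\
  cL1 mu3 (fun p => resolvent3 p * conjc (wave4 p)).
Proof.
have F2 := fourier_cL2; have r2 := cL2_resolvent z0.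
have c2 := cL2_conjc F2.
have a1 := cL1_weighted F2 r2; have b1 := cL1_weighted c2 r2; have b2 := cL2_weighted c2.
have E p : triple (fun xi => Q xi * r xi) (fun xi => conjc (Q xi) * r xi)
    (fun xi => conjc (Q xi) * r xi) p * Q (momentum p) = resolvent3 p * conjc (wave4 p).
  rewrite /triple /resolvent3 /wave4.
  move: (Q p.1.1) (Q p.1.2) (Q p.2) (Q (momentum p)) (r p.1.1) (r p.1.2) (r p.2).
  by move=> x1 x2 x3 x4 x5 x6 x7; rewrite !conjcM !conjcC; ring.
split; last by apply: (eq_cL1 E); exact: cL1_tripleM.
rewrite -(eq_cint mu3 E).
pose A m := cint mu (fun xi => Q xi * r xi * conjc (fker m xi)).
pose B m := cint mu (fun xi => conjc (Q xi) * r xi * fker m xi).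
have fE m : after z q m = fnorm R * A m by exact: after_fourier.
have gE m : before z (fun x => conjc (q x)) m = fnorm R * B m by exact: before_fourier.
have n0 := fnorm_neq0 R.
have I1 := cL1_fgM q2 z0 (cL1_uu q2 z0).
have J m : uu q z m * fg q z m = fnorm R ^+ 3 * (q m * (A m * B m * B m)).
  by rewrite /uu /fg fE gE; move: (q m) (A m) (B m) (fnorm R) => x1 x2 x3 x4; ring.
have L1 : cL1 mu (fun m => q m * (A m * B m * B m)).
  have n3 : fnorm R ^+ 3 != 0 by rewrite expf_neq0.
  by apply: (eq_cL1 _ (cL1Z (fnorm R ^+ 3)^-1 I1)) => m; rewrite J mulKf.
rewrite (eq_cint mu J) cintZ// (cint_quadrilinear q2 a1 b1 b1 b2 L1) mulrA; congr (_ * _).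
exact: fnorm3.
Qed.

(** The outer factor is the conjugate of [q], whereas [cint_quadrilinear] takes [q]: the integral is
    computed for the conjugate integrand, with conjugated resolvents, and conjugated back. *)
Lemma vv_fgE : cint mu (fun m => vv q z m * fg q z m) =
  ((2 * pi)^-1)%:C * cint mu3 (fun p => resolvent3 p * wave4 p) /\
  cL1 mu3 (fun p => resolvent3 p * wave4 p).
Proof.
have F2 := fourier_cL2; have r2 := cL2_resolvent z0; have rc2 := cL2_conjc r2.
have c2 := cL2_conjc F2.
have a1 := cL1_weighted F2 rc2; have b1 := cL1_weighted c2 rc2; have b2 := cL2_weighted_conjc c2.
have E p : conjc (triple (fun xi => Q xi * conjc (r xi)) (fun xi => conjc (Q xi) * conjc (r xi))
    (fun xi => conjc (Q xi) * conjc (r xi)) p * Q (momentum p)) = resolvent3 p * wave4 p.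
  rewrite /triple /resolvent3 /wave4.
  move: (Q p.1.1) (Q p.1.2) (Q p.2) (Q (momentum p)) (r p.1.1) (r p.1.2) (r p.2).
  by move=> x1 x2 x3 x4 x5 x6 x7; rewrite !conjcM !conjcC; ring.
have T1 := cL1_tripleM a1 b1 b1 b2 F2.
split; last by apply: (eq_cL1 E); exact: cL1_conjc.
rewrite -(eq_cint mu3 E) cint_conjc//.
pose A m := cint mu (fun xi => Q xi * conjc (r xi) * conjc (fker m xi)).
pose B m := cint mu (fun xi => conjc (Q xi) * conjc (r xi) * fker m xi).
have unimod (a : RT -> R[i]) (m : RT) : cL1 mu a -> cL1 mu (fun xi => a xi * fker m xi).
  move=> aL; apply: (cL1_le _ aL); first by apply: cmeasM; [case: aL|exact: cmeas_fkerr].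
  by move=> x; rewrite normc_mul_fker.
have fE m : after z q m = conjc (fnorm R * B m).
  rewrite conjcM conjc_fnorm -cint_conjc; last exact: unimod.
  rewrite (after_fourier m z0 q2); congr (_ * _); apply: eq_cint => xi.
  by rewrite (conjcM (_ * _)) (conjcM (conjc _)) !conjcC.
have gE m : before z (fun x => conjc (q x)) m = conjc (fnorm R * A m).
  rewrite conjcM conjc_fnorm -cint_conjc; last first.
    apply: (eq_cL1 _ (cL1_conjc (unimod _ m (cL1_conjc a1)))) => xi.
    by rewrite (conjcM (conjc _)) conjcC.
  rewrite (before_fourier m z0 q2); congr (_ * _); apply: eq_cint => xi.
  by rewrite (conjcM (_ * _)) (conjcM (Q xi)) !conjcC.
have n0 := fnorm_neq0 R.
have I1 := cL1_fgM q2 z0 (cL1_vv q2 z0).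
have J m : vv q z m * fg q z m = conjc (fnorm R ^+ 3 * (q m * (A m * B m * B m))).
  rewrite /vv /fg fE gE; move: (q m) (A m) (B m) => x1 x2 x3.
  by rewrite !conjcM !conjc_fnorm; ring.
have L3 : cL1 mu (fun m => fnorm R ^+ 3 * (q m * (A m * B m * B m))).
  by apply: (eq_cL1 _ (cL1_conjc I1)) => m; rewrite J conjcC.
have L1 : cL1 mu (fun m => q m * (A m * B m * B m)).
  have n3 : fnorm R ^+ 3 != 0 by rewrite expf_neq0.
  by apply: (eq_cL1 _ (cL1Z (fnorm R ^+ 3)^-1 L3)) => m; rewrite mulKf.
rewrite (eq_cint mu J) cint_conjc// cintZ// (cint_quadrilinear q2 a1 b1 b1 b2 L1) mulrA conjcM.
by rewrite fnorm3 conjcR.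
Qed.

End FourierSide.

Lemma b4_fourier (R : realType) (q : R -> R[i]) (lambda : R[i]) : L2 q -> 0 < Im (lambda ^+ 2) ->
  b4 q lambda =
    'i%C / (2 * pi%:C) *
    cintegral
      (@lebesgue_measure R \x @lebesgue_measure R \x @lebesgue_measure R)%E
      setT
      (fun '(xi1, eta1, eta2) =>
         let xi2 := eta1 + eta2 - xi1 in
         lambda ^+ 4 /
           ((2 * lambda ^+ 2 + xi1%:C) * (2 * lambda ^+ 2 + eta1%:C) *
            (2 * lambda ^+ 2 + eta2%:C)) *
         (Re (fourier q eta1 * fourier q eta2 *
              conjc (fourier q xi1) * conjc (fourier q xi2)))%:C).
Proof.
move=> /L2_cL2 q2 z0.
pose mu := @lebesgue_measure R; set z := lambda ^+ 2 in z0 *.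
have [U LU] := uu_fgE q2 z0; have [V LV] := vv_fgE q2 z0.
have two : (2%:R : R[i]) != 0 by rewrite -normc_eq0 normc_nat pnatr_eq0.
(* Twice [b4] is the sum of the two formulas, in which [wave4] meets its conjugate and leaves a real
   part. *)
have B : 2 * b4 q lambda = - lambda ^+ 4 * (((2 * pi)^-1)%:C *
    cint (pm (pm mu mu) mu) (fun p => resolvent3 z p * conjc (wave4 q p) + resolvent3 z p * wave4 q p)).
  rewrite (cintD LU LV) [in RHS]mulrDr -U -V [in RHS]mulrDr -(b4_uu q2 z0) -(b4_vv q2 z0).
  by rewrite mulr_natl mulr2n.
apply: (mulfI two); rewrite B.
have ii : 'i%C * 'i%C = -1 :> R[i] by rewrite -expr2 sqr_i.
pose G (p : R * R * R) : R[i] := lambda ^+ 4 /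
  ((2 * z + p.1.1%:C) * (2 * z + p.1.2%:C) * (2 * z + p.2%:C)) * (Re (wave4 q p))%:C.
have GE : cintegral (@lebesgue_measure R \x @lebesgue_measure R \x @lebesgue_measure R)%E setT
  (fun '(xi1, eta1, eta2) =>
         let xi2 := eta1 + eta2 - xi1 in
         lambda ^+ 4 /
           ((2 * z + xi1%:C) * (2 * z + eta1%:C) * (2 * z + eta2%:C)) *
         (Re (fourier q eta1 * fourier q eta2 *
              conjc (fourier q xi1) * conjc (fourier q xi2)))%:C) =
  cint (pm (pm mu mu) mu) G.
  by apply: eq_cint => -[[x1 y1] y2].
rewrite GE.
have S : (fun p => resolvent3 z p * conjc (wave4 q p) + resolvent3 z p * wave4 q p) =
    fun p => resolvent3 z p * (2 * (Re (wave4 q p))%:C).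
  apply/funext => p; rewrite -mulrDr; congr (_ * _).
  move: (wave4 q p) => w; apply: complex_eq; rewrite ?cReD ?cImD ?cReM ?cImM ?Re_conjc ?Im_conjc /=; ring.
have LS : cL1 (pm (pm mu mu) mu) (fun p => resolvent3 z p * (2 * (Re (wave4 q p))%:C)).
  by rewrite -S; exact: cL1D.
(* Three resolvents give [i ^ 3 = - i], which together with the sign of [- lambda ^+ 4] yields the
   factor [i]. *)
have RG p : - lambda ^+ 4 * (resolvent3 z p * (2 * (Re (wave4 q p))%:C)) = 2 * 'i%C * G p.
  rewrite /resolvent3 /resolvent /G !invfM.
  move: (2 * z + p.1.1%:C)^-1 (2 * z + p.1.2%:C)^-1 (2 * z + p.2%:C)^-1 (Re (wave4 q p))%:C (lambda ^+ 4) => a b c w l.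
  have -> : - l * ('i%C * a * ('i%C * b) * ('i%C * c) * (2 * w)) =
    - ('i%C * 'i%C) * (2 * 'i%C * (l * (a * b * c) * w)) by ring.
  by rewrite ii opprK mul1r.
have i20 : 2 * 'i%C != 0 :> R[i].
  by rewrite mulf_neq0// -normc_eq0 normc_i oner_neq0.
have LG : cL1 (pm (pm mu mu) mu) G.
  by apply: (eq_cL1 _ (cL1Z (2 * 'i%C)^-1 (cL1Z (- lambda ^+ 4) LS))) => p; rewrite RG mulKf.
rewrite S mulrCA -(cintZ _ LS) (eq_cint _ RG) (cintZ _ LG) complexV complexM.
move: (cint (pm (pm mu mu) mu) G) => I.
have -> : (2 : R)%:C = 2 :> R[i] by exact: (rmorph_nat (real_complex R) 2).
move: (2 * pi%:C)^-1 => k; ring.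
Qed.

(** * The asymptotic expansion *)

Section ByParts.
Variable R : realType.
Local Notation mu := (@lebesgue_measure R).
Local Notation RT := (measurableTypeR R).
Implicit Types (p : RT -> R[i]) (z : R[i]) (m : R).

Lemma normc_wave z (t : R) : 0 < Im z -> 0 <= t -> normc (wave z t) <= 1.
Proof.
move=> z0 t0; rewrite /wave normc_cexp -[leRHS]expR0 ler_expR.
have -> : Re (2 * 'i%C * z * t%:C) = - (2 * Im z * t) by case: z {z0} => a b /=; ring.
by rewrite oppr_le0 !mulr_ge0// ltW.
Qed.

Lemma cmeas_wave z (u : RT -> R) : measurable_fun setT u -> cmeas (fun x : RT => wave z (u x)).
Proof.
move=> mu_; apply: cmeas_cexp; apply: cmeasM; first exact: cmeas_cst.
exact: cmeas_real.
Qed.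

Lemma cL1_after_of p z m : 0 < Im z -> cL1 mu p ->
  cL1 mu (fun y => ind R (m < y) * (p y * wave z (y - m))).
Proof.
move=> z0 p1; have [mp _] := p1; apply: (cL1_le _ p1).
  apply: cmeasM; first exact: cmeas_lt.
  by apply: cmeasM => //; apply: cmeas_wave; exact: measurable_funB.
move=> y; have [my|my] := ltP m y; last by rewrite indF mul0r normc0 normc_ge0.
by rewrite indT mul1r normcM ler_piMr ?normc_ge0// normc_wave// subr_ge0 ltW.
Qed.

(** Only the bound [1] on the exponential enters, not its decay, so the estimate is uniform in [z]
    up to the real axis. The asymptotic series needs this uniformity. *)
Lemma after_bounded p z m : 0 < Im z -> cL1 mu p -> normc (after z p m) <= fine (nint mu p).
Proof.
move=> z0 p1; have L := cL1_after_of m z0 p1; rewrite -lee_fin fineK ?nint_fin//.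
apply: (le_trans (le_normc_cint L)); apply: le_nint; [by case: L|by case: p1|].
move=> y; have [my|my] := ltP m y; last by rewrite indF mul0r normc0 normc_ge0.
by rewrite indT mul1r normcM ler_piMr ?normc_ge0// normc_wave// subr_ge0 ltW.
Qed.

(** Reflection carries results on [after] over to [before]; the derivative of a reflected function
    changes sign, whence the alternating signs in the expansion of [g]. *)
Lemma before_after p z m : cmeas p -> before z p m = after z (fun y => p (- y)) (- m).
Proof.
move=> mp; rewrite /after.
have mG : cmeas (fun x : RT => ind R (x < m) * (p x * wave z (m - x))).
  apply: cmeasM; first exact: cmeas_lt.
  by apply: cmeasM => //; apply: cmeas_wave; exact: measurable_funB.
rewrite /before -(cint_invariant (@measurable_opp R) (@lebesgue_measureN R) mG).
by apply: eq_cint => y; rewrite ltrNl !opprK addrC.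
Qed.

Lemma ImN0 z : 0 < Im z -> z != 0.
Proof. by move=> z0; apply: contraTneq z0 => ->; rewrite ltxx. Qed.

(** The fundamental theorem on the half-line is applied to [p] times the exponential; [i / (2 z)] is
    the inverse of [- 2 i z]. *)
Lemma after_parts p (p' : RT -> R[i]) z m (M : R) : 0 < Im z -> cderive p p' -> ccontinuous p' ->
  cL1 mu p -> cL1 mu p' -> (forall x : R, `|x| * normc (p x) <= M) ->
  after z p m = 'i%C / (2 * z) * (p m + after z p' m).
Proof.
move=> z0 pp' cp' p1 p1' pM.
pose c := 2 * 'i%C * z.
pose F (x : R) := p x * (cexp (- (c * m%:C)) * cexp (c * x%:C)).
pose F' (x : R) := p' x * (cexp (- (c * m%:C)) * cexp (c * x%:C)) +
  p x * (cexp (- (c * m%:C)) * (c * cexp (c * x%:C))).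
have WE (x : R) : cexp (- (c * m%:C)) * cexp (c * x%:C) = wave z (x - m).
  by rewrite -cexpD /wave complexD complexN; congr cexp; rewrite /c; ring.
have FF' : cderive F F'.
  exact: (cderiveM pp' (cderiveZ (cexp (- (c * m%:C))) (cderive_cexp c))).
have cc : ccontinuous (fun x : R => cexp (c * x%:C)).
  exact: cderive_continuous (cderive_cexp c).
have cp := cderive_continuous pp'.
have cF' : ccontinuous F'.
  apply: ccontinuousD; first exact: (ccontinuousM cp' (ccontinuousM (ccontinuous_cst _) cc)).
  exact: (ccontinuousM cp (ccontinuousM (ccontinuous_cst _) (ccontinuousM (ccontinuous_cst _) cc))).
have L1 := cL1_after_of m z0 p1; have L2 := cL1_after_of m z0 p1'.
have FE (x : R) : ind R (m < x) * F' x = ind R (m < x) * (p' x * wave z (x - m)) +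
    c * (ind R (m < x) * (p x * wave z (x - m))).
  rewrite /F' [cexp _ * (c * _)]mulrCA WE.
  by move: (ind R _) (p' x) (p x) (wave z _) => a1 a2 a3 a4; ring.
have LF : cL1 mu (fun x => ind R (m < x) * F' x).
  by apply: (eq_cL1 _ (cL1D L2 (cL1Z c L1))) => x; rewrite FE.
(* The boundary term at infinity vanishes: at points beyond both [1] and [M / eta], the bound
   [M / |x|] on [p] is at most [eta]. *)
have F0 : ccvg (fun n => F (m + n.+1%:R)) 0.
  have M0 : 0 <= M by apply: le_trans (pM 0); rewrite mulr_ge0 ?normc_ge0.
  apply: ccvg_eps => eta eta0; near=> n; rewrite subr0 /F WE.
  have h0 : 0 <= m + n.+1%:R - m by rewrite addrAC subrr add0r.
  rewrite normcM (le_trans (ler_piMr (normc_ge0 _) (normc_wave z0 h0)))//.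
  have x1 : M / eta <= m + n.+1%:R.
    rewrite -lerBlDl (@le_trans _ _ n%:R)//; last by rewrite ler_nat.
    by near: n; exact: nbhs_infty_ger.
  have x0 : 1 <= m + n.+1%:R.
    rewrite -lerBlDl (@le_trans _ _ n%:R)//; last by rewrite ler_nat.
    by near: n; exact: nbhs_infty_ger.
  have xp : 0 < m + n.+1%:R by exact: lt_le_trans x0.
  have := pM (m + n.+1%:R); rewrite gtr0_norm// => H.
  rewrite -(ler_pM2l xp) (le_trans H)// -ler_pdivrMr//.
have := cint_halfline FF' cF' F0 LF.
rewrite (eq_cint mu FE) (cintD L2 (cL1Z c L1)) (cintZ c L1) -/(after z p m) -/(after z p' m).
have -> : F m = p m by rewrite /F WE subrr /wave mulr0 cexp0 mulr1.
move: (after z p m) (after z p' m) (p m) => A A' P E.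
have zn0 := ImN0 z0.
have ii : 'i%C * 'i%C = -1 :> R[i] by rewrite -expr2 sqr_i.
have two : (2%:R : R[i]) != 0 by rewrite -normc_eq0 normc_nat pnatr_eq0.
have z20 : 2 * z != 0 by rewrite mulf_neq0.
have -> : P = - (A' + c * A) by rewrite E opprK.
have -> : - (A' + c * A) + A' = - 'i%C * (2 * z) * A by rewrite /c; ring.
rewrite mulrA -[_ / _ * _]mulrA; rewrite [(2 * z)^-1 * _]mulrCA mulVf// mulr1.
by rewrite mulrN ii opprK mul1r.
Unshelve. all: by end_near. Qed.

Lemma before_parts p (p' : RT -> R[i]) z m (M : R) : 0 < Im z -> cderive p p' -> ccontinuous p' ->
  cL1 mu p -> cL1 mu p' -> (forall x : R, `|x| * normc (p x) <= M) ->
  before z p m = 'i%C / (2 * z) * (p m - before z p' m).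
Proof.
move=> z0 pp' cp' p1 p1' pM.
have [mp _] := p1; have [mp' _] := p1'.
have inv1 k : cL1 mu k -> cL1 mu (fun y => k (- y)).
  exact: (cL1_invariant (@measurable_opp R) (@lebesgue_measureN R)).
have dN : cderive (fun y => p (- y)) (fun y => - p' (- y)).
  move=> x; have [h1 h2] := pp' (- x); split.
    apply: is_derive_eq (is_derive1_chain (is_deriveNid x (1 : R)) h1) _.
    by rewrite cReN mulrN1.
  apply: is_derive_eq (is_derive1_chain (is_deriveNid x (1 : R)) h2) _.
  by rewrite cImN mulrN1.
have cN : ccontinuous (fun y => - p' (- y)).
  have [c1 c2] := cp'; split=> x.
    rewrite (_ : (fun y => _) = fun y => - Re (p' (- y))); last by apply/funext => y; rewrite cReN.
    apply: cvgN; apply: (continuous_comp (f := -%R) (g := fun x => Re (p' x))); last exact: c1.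
    exact: opp_continuous.
  rewrite (_ : (fun y => _) = fun y => - Im (p' (- y))); last by apply/funext => y; rewrite cImN.
  apply: cvgN; apply: (continuous_comp (f := -%R) (g := fun x => Im (p' x))); last exact: c2.
  exact: opp_continuous.
rewrite !before_after//.
rewrite (after_parts (- m) z0 dN cN (inv1 _ p1) (cL1N (inv1 _ p1')) (M := M)); last first.
  by move=> x; rewrite -normrN.
rewrite opprK; congr (_ * (_ + _)).
have LA := cL1_after_of (- m) z0 (inv1 _ p1').
rewrite /after -(cintN LA); apply: eq_cint => y.
by move: (ind R _) (p' (- y)) (wave z _) => a b c; ring.
Qed.

Lemma before_bounded p z m : 0 < Im z -> cL1 mu p -> normc (before z p m) <= fine (nint mu p).
Proof.
move=> z0 p1; have [mp _] := p1; rewrite before_after//.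
have -> : nint mu p = nint mu (fun y => p (- y)).
  by rewrite (nint_invariant (@measurable_opp R) (@lebesgue_measureN R) mp).
apply: after_bounded => //.
exact: (cL1_invariant (@measurable_opp R) (@lebesgue_measureN R)).
Qed.

End ByParts.

(** * Derivatives of Schwartz functions *)

Section SchwartzDerivatives.
Variables (R : realType) (q : R -> R[i]).
Local Notation mu := (@lebesgue_measure R).
Local Notation RT := (measurableTypeR R).
Hypothesis hq : schwartz q.

Lemma cderiven0 : cderiven 0 q = q.
Proof. by apply/funext => x; exact: complex_eq. Qed.

Lemma cderive_cderiven k : cderive (cderiven k q) (cderiven k.+1 q).
Proof.
have [sR sI _] := hq; move=> x; split.
  by apply: DeriveDef; [exact: sR|rewrite -[LHS]derive1E].
by apply: DeriveDef; [exact: sI|rewrite -[LHS]derive1E].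
Qed.

Lemma ccontinuous_cderiven k : ccontinuous (cderiven k q).
Proof. exact: cderive_continuous (cderive_cderiven k). Qed.

Lemma cderiven_bounded k : exists M : R, forall x, normc (cderiven k q x) <= M.
Proof.
have [_ _ /(_ 0%N k) [M H]] := hq; exists M => x.
by have := H x; rewrite expr0 mul1r.
Qed.

Lemma cderiven_decay k : exists M : R, forall x, `|x| * normc (cderiven k q x) <= M.
Proof. by have [_ _ /(_ 1%N k) [M H]] := hq; exists M. Qed.

Lemma cL1_cderiven k : cL1 mu (cderiven k q).
Proof.
(* The decay bounds of orders [0] and [2] add up to [M / (1 + x ^+ 2)], which is [M / 2] times
   [poisson 1]. *)
have [_ _ H] := hq; have [M0 H0] := H 0%N k; have [M2 H2] := H 2%N k.
have mq := ccontinuous_cmeas (ccontinuous_cderiven k).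
pose M := M0 + M2.
have M_ge0 : 0 <= M.
  apply: addr_ge0; first by apply: le_trans (H0 0); rewrite mulr_ge0 ?exprn_ge0 ?normc_ge0.
  by apply: le_trans (H2 0); rewrite mulr_ge0 ?exprn_ge0 ?normc_ge0.
have P1 := cL1Z ((M / 2)%:C) (cL1_poisson 0 (ltr01 : 0 < 1 :> R)).
refine (@cL1_le _ _ _ mu _ _ mq P1 _) => x.
have d0 : 0 < 1 + x ^+ 2 :> R by rewrite ltr_pwDl// sqr_ge0.
have M20 : 0 <= M / 2 by rewrite divr_ge0.
have p0 : 0 <= poisson 1 x :> R by apply: poisson_ge0.
rewrite normcM !normc_real sub0r poissonN (ger0_norm M20) (ger0_norm p0) /poisson mulr1 expr1n.
rewrite mulrA divfK ?pnatr_eq0// ler_pdivlMr// mulrDr mulr1 mulrC.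
have := H0 x; have := H2 x; rewrite expr0 mul1r real_normK ?num_real// /M addrC => h2 h0.
by rewrite addrC [_ * normc _]mulrC lerD// mulrC.
Qed.

End SchwartzDerivatives.

Section Conjugate.
Variable R : realType.
Implicit Types p : R -> R[i].

Lemma cderive_conjc p (p' : R -> R[i]) : cderive p p' ->
  cderive (fun x => conjc (p x)) (fun x => conjc (p' x)).
Proof.
move=> pp' x; have [dR dI] := pp' x; split.
  rewrite Re_conjc (_ : (fun t => Re _) = fun t => Re (p t))//.
  by apply/funext => t; rewrite Re_conjc.
rewrite Im_conjc (_ : (fun t => Im _) = fun t => - Im (p t)); first exact: is_deriveN.
by apply/funext => t; rewrite Im_conjc.
Qed.

End Conjugate.

(** * Expansions in powers of [zeta] with bounded coefficients *)

Section Expansion.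
Variable R : realType.
Local Notation mu := (@lebesgue_measure R).
Local Notation RT := (measurableTypeR R).
Implicit Types (K : R) (N : nat) (zeta : R[i]) (A : nat -> RT -> R[i]) (F : RT -> R[i]).

(* [F] is the sum of the [zeta ^+ k.+1 * A k], [k <= N], up to a bounded change
   of the last coefficient. *)
Definition expands K N zeta A F := exists A' : nat -> RT -> R[i],
  [/\ forall k x, (k < N)%N -> A' k x = A k x,
      forall k x, (k <= N)%N -> normc (A' k x) <= K &
      forall x, F x = \sum_(k < N.+1) zeta ^+ k.+1 * A' k x].

Lemma expands_le K K' N zeta A F : K <= K' -> expands K N zeta A F -> expands K' N zeta A F.
Proof.
move=> KK' [A' [h1 h2 h3]]; exists A'; split=> // k x kN.
by apply: le_trans KK'; exact: h2.
Qed.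

Lemma uniform_bound (p : nat -> RT -> R[i]) N :
  (forall k, exists M : R, forall x, normc (p k x) <= M) ->
  exists M : R, forall k x, (k <= N)%N -> normc (p k x) <= M.
Proof.
move=> pb; elim: N => [|N [M H]].
  by have [M H] := pb 0%N; exists M => k x; rewrite leqn0 => /eqP ->.
have [M' H'] := pb N.+1; exists (Num.max M M') => k x.
rewrite leq_eqVlt => /predU1P[->|kN]; first by rewrite le_max H' orbT.
by rewrite le_max H.
Qed.

Section Iterate.
Variable p : nat -> RT -> R[i].
Hypothesis dp : forall k, cderive (p k) (p k.+1).
Hypothesis p1 : forall k, cL1 mu (p k).
Hypothesis pb : forall k, exists M : R, forall x, normc (p k x) <= M.
Hypothesis px : forall k, exists M : R, forall x : R, `|x| * normc (p k x) <= M.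

Lemma after_iter z m n : 0 < Im z -> after z (p 0) m =
  \sum_(k < n) ('i%C / (2 * z)) ^+ k.+1 * p k m + ('i%C / (2 * z)) ^+ n * after z (p n) m.
Proof.
move=> z0; elim: n => [|n IH]; first by rewrite big_ord0 expr0 mul1r add0r.
have [M pM] := px n.
rewrite big_ord_recr /= IH.
rewrite {1}(after_parts m z0 (dp n) (cderive_continuous (dp n.+1)) (p1 n) (p1 n.+1) pM).
move: ('i%C / (2 * z)) (p n m) (after z (p n.+1) m) (\sum_(k < n) _) => a b c s.
by rewrite exprSr; ring.
Qed.

Lemma before_iter z m n : 0 < Im z -> before z (p 0) m =
  \sum_(k < n) ('i%C / (2 * z)) ^+ k.+1 * ((-1) ^+ k * p k m) +
  ('i%C / (2 * z)) ^+ n * ((-1) ^+ n * before z (p n) m).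
Proof.
move=> z0; elim: n => [|n IH]; first by rewrite big_ord0 !expr0 !mul1r add0r.
have [M pM] := px n.
rewrite big_ord_recr /= IH.
rewrite {1}(before_parts m z0 (dp n) (cderive_continuous (dp n.+1)) (p1 n) (p1 n.+1) pM).
move: ('i%C / (2 * z)) (p n m) (before z (p n.+1) m) (\sum_(k < n) _) => a b c s.
by rewrite ![_ ^+ n.+1]exprSr; ring.
Qed.

(** The remainder after [N.+1] integrations by parts carries [zeta ^+ N.+1], the power of the last
    term, and is absorbed in the coefficient of index [N]. It is bounded by an [L^1] norm, so [K]
    does not depend on [z]. *)
Lemma after_expands N : exists K, forall z, 0 < Im z ->
  expands K N ('i%C / (2 * z)) p (after z (p 0)).
Proof.
have [M H] := uniform_bound N pb.
have I0 : 0 <= fine (nint mu (p N.+1)) by rewrite fine_ge0// nint_ge0.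
exists (M + fine (nint mu (p N.+1))) => z z0.
exists (fun k x => p k x + if k == N then after z (p N.+1) x else 0); split.
- by move=> k x kN; rewrite ltn_eqF// addr0.
- move=> k x kN; apply: (le_trans (normcD_le _ _)); apply: lerD; first exact: H.
  by case: ifP => _; [exact: after_bounded|rewrite normc0].
- move=> x; rewrite (after_iter x N.+1 z0) !big_ord_recr /= eqxx.
  rewrite mulrDr addrA; congr (_ + _ + _).
  by apply: eq_bigr => k _; rewrite ltn_eqF// addr0.
Qed.

Lemma before_expands N : exists K, forall z, 0 < Im z ->
  expands K N ('i%C / (2 * z)) (fun k x => (-1) ^+ k * p k x) (before z (p 0)).
Proof.
have [M H] := uniform_bound N pb.
have I0 : 0 <= fine (nint mu (p N.+1)) by rewrite fine_ge0// nint_ge0.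
have sg k : normc ((-1) ^+ k : R[i]) = 1 by rewrite normcX normc_opp normc1 expr1n.
exists (M + fine (nint mu (p N.+1))) => z z0.
exists (fun k x => (-1) ^+ k * p k x +
  if k == N then (-1) ^+ N.+1 * before z (p N.+1) x else 0); split.
- by move=> k x kN; rewrite ltn_eqF// addr0.
- move=> k x kN; apply: (le_trans (normcD_le _ _)); apply: lerD.
    by rewrite normcM sg mul1r H.
  by case: ifP => _; [rewrite normcM sg mul1r; exact: before_bounded|rewrite normc0].
- move=> x; rewrite (before_iter x N.+1 z0) !big_ord_recr /= eqxx.
  rewrite mulrDr addrA; congr (_ + _ + _).
  by apply: eq_bigr => k _; rewrite ltn_eqF// addr0.
Qed.

End Iterate.

(** Every discarded term has degree at least [N.+3] in [zeta], and [normc zeta <= 1] lowers the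
    degree to that value; the count is the crude one of all triples of indices. *)
Lemma triple_product N zeta (a b c : nat -> R[i]) K : 0 <= K -> normc zeta <= 1 ->
  (forall k, (k <= N)%N -> normc (a k) <= K) -> (forall k, (k <= N)%N -> normc (b k) <= K) ->
  (forall k, (k <= N)%N -> normc (c k) <= K) ->
  normc ((\sum_(k < N.+1) zeta ^+ k.+1 * a k) * (\sum_(k < N.+1) zeta ^+ k.+1 * b k) *
      (\sum_(k < N.+1) zeta ^+ k.+1 * c k) -
    \sum_(i < N.+1) \sum_(j < N.+1) \sum_(k < N.+1 | (i + j + k < N)%N)
      zeta ^+ (i + j + k).+3 * (a i * b j * c k)) <=
  N.+1%:R ^+ 3 * K ^+ 3 * normc zeta ^+ N.+3.
Proof.
move=> K0 z1 aK bK cK.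
have -> : (\sum_(k < N.+1) zeta ^+ k.+1 * a k) * (\sum_(k < N.+1) zeta ^+ k.+1 * b k) *
      (\sum_(k < N.+1) zeta ^+ k.+1 * c k) =
    \sum_(i < N.+1) \sum_(j < N.+1) \sum_(k < N.+1) zeta ^+ (i + j + k).+3 * (a i * b j * c k).
  rewrite big_distrlr /= big_distrl /=; apply: eq_bigr => i _.
  rewrite big_distrl /=; apply: eq_bigr => j _; rewrite big_distrr /=; apply: eq_bigr => k _.
  have -> : (i + j + k).+3 = (i.+1 + j.+1 + k.+1)%N by rewrite !addnS !addSn.
  by rewrite !exprD; ring.
rewrite -sumrB (le_trans (normc_sum _ _ _))//.
have -> : N.+1%:R ^+ 3 * K ^+ 3 * normc zeta ^+ N.+3 =
    \sum_(i < N.+1) \sum_(j < N.+1) \sum_(k < N.+1) (K ^+ 3 * normc zeta ^+ N.+3).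
  rewrite !sumr_const !card_ord -2!mulrnA -[RHS]mulr_natl 2!natrM.
  by move: (_ ^+ N.+3) N.+1%:R => y x; ring.
apply: ler_sum => i _; rewrite -sumrB (le_trans (normc_sum _ _ _))//.
apply: ler_sum => j _; rewrite [X in _ - X]big_mkcond /= -sumrB (le_trans (normc_sum _ _ _))//.
apply: ler_sum => k _; have K3 : 0 <= K ^+ 3 * normc zeta ^+ N.+3.
  by rewrite mulr_ge0 ?exprn_ge0 ?normc_ge0.
case: ifPn => [_|]; first by rewrite subrr normc0.
rewrite -leqNgt subr0 => sN; rewrite normcM normcX (normcM (a i * b j)) (normcM (a i)) mulrC.
have n0 := @normc_ge0 R; have leN (l : 'I_N.+1) : (l <= N)%N by rewrite -ltnS ltn_ord.
have abc : normc (a i) * normc (b j) * normc (c k) <= K ^+ 3.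
  have -> : K ^+ 3 = K * K * K by rewrite -expr2 -exprSr.
  apply: ler_pM (mulr_ge0 (n0 _) (n0 _)) (n0 _) _ (cK k (leN k)).
  exact: ler_pM (n0 _) (n0 _) (aK i (leN i)) (bK j (leN j)).
have zz : normc zeta ^+ (i + j + k).+3 <= normc zeta ^+ N.+3.
  by apply: ler_wiXn2l (n0 _) z1 _ _ _.
exact: ler_pM (mulr_ge0 (mulr_ge0 (n0 _) (n0 _)) (n0 _)) (exprn_ge0 _ (n0 _)) abc zz.
Qed.

End Expansion.

(** * Triple sums grouped by total degree *)

Section Regrouping.
Variable V : zmodType.

Lemma big_ord_extend m n (g : nat -> V) : (m <= n)%N -> (forall i, (m <= i)%N -> g i = 0) ->
  \sum_(i < n) g i = \sum_(i < m) g i.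
Proof.
move=> mn g0; rewrite (big_ord_widen n g mn) [RHS]big_mkcond /=; apply: eq_bigr => i _.
by case: ltnP => // /g0.
Qed.

(** No index can exceed a total equal to [s]. The shortened ranges are those of [H4] at
    [j = s.+2]. *)
Lemma big_level s N (tau : nat -> nat -> nat -> V) : (s <= N)%N ->
  \sum_(i < N.+1) \sum_(j < N.+1) \sum_(k < N.+1 | (i + j + k == s)%N) tau i j k =
  \sum_(i < s.+1) \sum_(j < s.+1) \sum_(k < s.+1 | (i + j + k == s)%N) tau i j k.
Proof.
move=> sN; have sN1 : (s.+1 <= N.+1)%N by [].
rewrite (big_ord_extend (m := s.+1) (g := fun i => \sum_(j < N.+1) \sum_(k < N.+1 | (i + j + k == s)%N) tau i j k))//.
  apply: eq_bigr => i _.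
  rewrite (big_ord_extend (m := s.+1) (g := fun j => \sum_(k < N.+1 | (i + j + k == s)%N) tau i j k))//.
    apply: eq_bigr => j _; rewrite big_mkcond [RHS]big_mkcond /=.
    rewrite (big_ord_extend (m := s.+1) (g := fun k => if (i + j + k == s)%N then tau i j k else 0))//.
    by move=> k sk; rewrite gtn_eqF// (leq_trans sk)// leq_addl.
  move=> j sj; rewrite big1// => k /eqP E.
  have : (j <= i + j + k)%N by rewrite addnAC leq_addl.
  by rewrite E leqNgt sj.
move=> i si; rewrite big1// => j _; rewrite big1// => k /eqP E.
have : (i <= i + j + k)%N by rewrite -addnA leq_addr.
by rewrite E leqNgt si.
Qed.

Lemma big_by_level N (tau : nat -> nat -> nat -> V) :
  \sum_(i < N.+1) \sum_(j < N.+1) \sum_(k < N.+1 | (i + j + k < N)%N) tau i j k =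
  \sum_(s < N) \sum_(i < s.+1) \sum_(j < s.+1) \sum_(k < s.+1 | (i + j + k == s)%N) tau i j k.
Proof.
under [RHS]eq_bigr => s _ do rewrite -(big_level tau (ltnW (ltn_ord s))).
rewrite [RHS]exchange_big /=; apply: eq_bigr => i _.
rewrite [RHS]exchange_big /=; apply: eq_bigr => j _.
rewrite big_mkcond /=; under [RHS]eq_bigr => s _ do rewrite big_mkcond /=.
rewrite [RHS]exchange_big /=; apply: eq_bigr => k _.
case: ltnP => [sN|Ns].
  rewrite (bigD1 (Ordinal sN))//= eqxx big1 ?addr0// => s sE.
  by case: eqP => // E; case/negP: sE; apply/eqP/val_inj; rewrite /= E.
rewrite big1// => s _; case: eqP => // E.
by have := ltn_ord s; rewrite -E ltnNge Ns.
Qed.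

End Regrouping.

(** * Cubic integrals of expanded functions *)

Section CubicExpansion.
Variable R : realType.
Local Notation mu := (@lebesgue_measure R).
Local Notation RT := (measurableTypeR R).
Implicit Types (A B C : nat -> RT -> R[i]) (w F G H : RT -> R[i]).

Lemma cint_expansion N K (zeta : R[i]) w A B C F G H : 0 <= K -> normc zeta <= 1 ->
  cL1 mu w -> (forall i j k, cL1 mu (fun x => w x * (A i x * B j x * C k x))) ->
  cL1 mu (fun x => w x * (F x * G x * H x)) ->
  expands K N zeta A F -> expands K N zeta B G -> expands K N zeta C H ->
  normc (cint mu (fun x => w x * (F x * G x * H x)) -
    \sum_(s < N) \sum_(i < s.+1) \sum_(j < s.+1) \sum_(k < s.+1 | (i + j + k == s)%N)
      zeta ^+ s.+3 * cint mu (fun x => w x * (A i x * B j x * C k x))) <=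
  N.+1%:R ^+ 3 * K ^+ 3 * fine (nint mu w) * normc zeta ^+ N.+3.
Proof.
move=> K0 z1 w1 L1 L2 [A' [A1 A2 A3]] [B' [B1 B2 B3]] [C' [C1 C2 C3]].
pose T (i j k : nat) (x : RT) := zeta ^+ (i + j + k).+3 * (w x * (A i x * B j x * C k x)).
have LT i j k : cL1 mu (T i j k) by exact: cL1Z.
pose S (x : RT) := \sum_(i < N.+1) \sum_(j < N.+1) \sum_(k < N.+1 | (i + j + k < N)%N) T i j k x.
have LS2 (i j : nat) : cL1 mu (fun x => \sum_(k < N.+1 | (i + j + k < N)%N) T i j k x).
  by apply: cL1_sum => k _.
have LS1 (i : nat) : cL1 mu (fun x => \sum_(j < N.+1) \sum_(k < N.+1 | (i + j + k < N)%N) T i j k x).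
  by apply: cL1_sum => j _.
have LS : cL1 mu S by apply: cL1_sum => i _.
have -> : \sum_(s < N) \sum_(i < s.+1) \sum_(j < s.+1) \sum_(k < s.+1 | (i + j + k == s)%N)
    zeta ^+ s.+3 * cint mu (fun x => w x * (A i x * B j x * C k x)) = cint mu S.
  transitivity (\sum_(s < N) \sum_(i < s.+1) \sum_(j < s.+1) \sum_(k < s.+1 | (i + j + k == s)%N)
      cint mu (T i j k)).
    apply: eq_bigr => s _; apply: eq_bigr => i _; apply: eq_bigr => j _; apply: eq_bigr => k /eqP E.
    by rewrite /T E (cintZ _ (L1 i j k)).
  rewrite -(big_by_level N (fun i j k => cint mu (T i j k))) /S.
  rewrite (@cint_sum _ _ _ mu _ _ _ (fun i : 'I_N.+1 => fun x => \sum_(j < N.+1) \sum_(k < N.+1 | (i + j + k < N)%N) T i j k x))//.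
  apply: eq_bigr => i _.
  rewrite (@cint_sum _ _ _ mu _ _ _ (fun j : 'I_N.+1 => fun x => \sum_(k < N.+1 | (i + j + k < N)%N) T i j k x))//.
  apply: eq_bigr => j _.
  by rewrite (@cint_sum _ _ _ mu _ _ _ (fun k : 'I_N.+1 => T i j k)).
rewrite -(cintB L2 LS) -lee_fin.
have L3 := cL1B L2 LS.
apply: (le_trans (le_normc_cint L3)).
pose c := N.+1%:R ^+ 3 * K ^+ 3 * normc zeta ^+ N.+3.
have c0 : 0 <= c.
  exact: mulr_ge0 (mulr_ge0 (exprn_ge0 _ (ler0n _ _)) (exprn_ge0 _ K0)) (exprn_ge0 _ (normc_ge0 _)).
have Lw := cL1Z c%:C w1.
have mw : cmeas w by case: w1.
have -> : EFin (N.+1%:R ^+ 3 * K ^+ 3 * fine (nint mu w) * normc zeta ^+ N.+3) =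
    nint mu (fun x => c%:C * w x).
  rewrite nintZ// normc_real ger0_norm// -[X in (_ * X)%E](fineK (nint_fin w1)) -EFinM.
  by rewrite /c mulrAC.
apply: le_nint; [by case: L3|by case: Lw|] => x.
have -> : w x * (F x * G x * H x) - S x = w x * (F x * G x * H x -
    \sum_(i < N.+1) \sum_(j < N.+1) \sum_(k < N.+1 | (i + j + k < N)%N)
      zeta ^+ (i + j + k).+3 * (A' i x * B' j x * C' k x)).
  rewrite mulrBr; congr (_ - _); rewrite /S big_distrr /=; apply: eq_bigr => i _.
  rewrite big_distrr /=; apply: eq_bigr => j _; rewrite big_distrr /=; apply: eq_bigr => k ijk.
  (* A total below [N] forces each index below [N], where the coefficients of the expansions are the
     true ones; the altered last coefficients enter the error only. *)
  have iN : (i < N)%N by apply: leq_ltn_trans ijk; rewrite -addnA leq_addr.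
  have jN : (j < N)%N by apply: leq_ltn_trans ijk; rewrite addnAC leq_addl.
  have kN : (k < N)%N by apply: leq_ltn_trans ijk; rewrite leq_addl.
  rewrite /T (A1 i x iN) (B1 j x jN) (C1 k x kN).
  by move: (zeta ^+ _) (A i x * _ * _) (w x) => a b d; rewrite mulrCA.
rewrite (normcM (w x)) (normcM c%:C) [leLHS]mulrC; apply: (ler_wpM2r (normc_ge0 _)).
rewrite normc_real (ger0_norm c0) A3 B3 C3.
exact: (triple_product K0 z1 (A2^~ x) (B2^~ x) (C2^~ x)).
Qed.

End CubicExpansion.

(** * Expansion of [b4] for Schwartz functions *)

Section Asymptotics.
Variables (R : realType) (q : R -> R[i]).
Local Notation mu := (@lebesgue_measure R).
Local Notation RT := (measurableTypeR R).
Hypothesis hq : schwartz q.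

Let p (k : nat) : RT -> R[i] := cderiven k q.
Let pc (k : nat) (x : RT) : R[i] := conjc (cderiven k q x).

Definition moment (i j k : nat) : R[i] :=
  cint mu (fun x => cderiven j q x * cderiven k q x * conjc (cderiven i q x * q x)).

(** The sum inside [H4] at [j = s.+2], so that [s] is the total number of derivatives. *)
Definition level (s : nat) : R[i] :=
  \sum_(i < s.+1) \sum_(j < s.+1) \sum_(k < s.+1 | (i + j + k == s)%N) (-1) ^+ i * moment i j k.

Lemma cL1_cubic (w a b c : RT -> R[i]) : cL1 mu w -> cmeas a -> cmeas b -> cmeas c ->
  (exists M : R, forall x, normc (a x) <= M) -> (exists M : R, forall x, normc (b x) <= M) ->
  (exists M : R, forall x, normc (c x) <= M) -> cL1 mu (fun x => w x * (a x * b x * c x)).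
Proof.
move=> w1 ma mb mc [Ma Ha] [Mb Hb] [Mc Hc].
apply: (eq_cL1 (f := fun x => a x * (b x * (c x * w x)))) => [x|]; first by ring.
apply: (@cL1M_bounded _ _ _ mu _ _ Ma) => //; apply: (@cL1M_bounded _ _ _ mu _ _ Mb) => //.
exact: (@cL1M_bounded _ _ _ mu _ _ Mc).
Qed.

Lemma cL1_q : cL1 mu q.
Proof. by have := cL1_cderiven hq 0; rewrite cderiven0. Qed.

Lemma cmeas_cderiven k : cmeas (cderiven k q : RT -> R[i]).
Proof. exact: ccontinuous_cmeas (ccontinuous_cderiven hq k). Qed.

Lemma cmeas_sign k (a : RT -> R[i]) : cmeas a -> cmeas (fun x => (-1) ^+ k * a x).
Proof. by move=> ma; apply: cmeasM => //; exact: cmeas_cst. Qed.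

Lemma normc_sign k : normc ((-1) ^+ k : R[i]) = 1.
Proof. by rewrite normcX normc_opp normc1 expr1n. Qed.

(** Modulo 2, [s + i] equals [j + k]. This converts the sign attached to one conjugated derivative
    into the signs attached to two, when the two formulas for [b4] are compared. *)
Lemma sign_level i j k s : (i + j + k)%N = s -> (-1) ^+ (s + i) = (-1) ^+ j * (-1) ^+ k :> R[i].
Proof.
move=> <-; rewrite -[in LHS]signr_odd !oddD addbC !addbA addbb addFb -oddD signr_odd.
exact: exprD.
Qed.

Lemma conjc_bounded k : exists M : R, forall x, normc (conjc (cderiven k q x)) <= M.
Proof. by have [M H] := cderiven_bounded hq k; exists M => x; rewrite normc_conjc. Qed.

Lemma sign_bounded k : exists M : R, forall x, normc ((-1) ^+ k * conjc (cderiven k q x)) <= M.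
Proof.
by have [M H] := conjc_bounded k; exists M => x; rewrite normcM normc_sign mul1r.
Qed.

Lemma cL1_moment i j k :
  cL1 mu (fun x => cderiven j q x * cderiven k q x * conjc (cderiven i q x * q x)).
Proof.
have H : cL1 mu (fun x => conjc (q x) * (cderiven j q x * cderiven k q x * conjc (cderiven i q x))).
  apply: cL1_cubic; [exact: cL1_conjc cL1_q|exact: cmeas_cderiven|exact: cmeas_cderiven| | | |].
  - exact: cmeas_conjc (cmeas_cderiven i).
  - exact: cderiven_bounded.
  - exact: cderiven_bounded.
  - exact: conjc_bounded.
apply: (eq_cL1 _ H) => x.
by rewrite conjcM; move: (conjc (cderiven i q x)) (conjc (q x)) => a b; ring.
Qed.

Lemma fg_expansion N : exists K : R, 0 <= K /\ forall z, 0 < Im z ->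
  expands K N ('i%C / (2 * z)) p (after z q) /\
  expands K N ('i%C / (2 * z)) (fun k x => (-1) ^+ k * pc k x) (before z (fun x => conjc (q x))).
Proof.
have [K1 H1] := after_expands (cderive_cderiven hq) (cL1_cderiven hq) (cderiven_bounded hq)
  (cderiven_decay hq) N.
have dc k : cderive (pc k) (pc k.+1) by exact: cderive_conjc (cderive_cderiven hq k).
have c1 k : cL1 mu (pc k) by exact: cL1_conjc (cL1_cderiven hq k).
have cd k : exists M : R, forall x : R, `|x| * normc (pc k x) <= M.
  by have [M H] := cderiven_decay hq k; exists M => x; rewrite normc_conjc.
have [K2 H2] := before_expands dc c1 conjc_bounded cd N.
exists (Num.max 0 (Num.max K1 K2)); split; first by rewrite le_max lexx.
move=> z z0; split.
  have := H1 z z0; rewrite cderiven0; apply: expands_le.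
  by rewrite !le_max lexx orbT.
have -> : (fun x : R => conjc (q x)) = pc 0 by apply/funext => x; rewrite /pc cderiven0.
have := H2 z z0; apply: expands_le.
by rewrite !le_max lexx !orbT.
Qed.

Lemma le_half_sum (L a b c C w : R) : 0 <= L -> a <= C * w -> b <= C * w -> c <= a + b ->
  L / 2 * c <= C * L * w.
Proof.
move=> L0 aw bw cab; have -> : C * L * w = L / 2 * (C * w + C * w) by field.
by rewrite ler_wpM2l ?divr_ge0// (le_trans cab)// lerD.
Qed.

Lemma L2_schwartz : cL2 mu q.
Proof.
have [M HM] := cderiven_bounded hq 0; rewrite cderiven0 in HM.
have [mq qoo] := cL1_q; split=> //.
have M0 : 0 <= M by exact: le_trans (normc_ge0 _) (HM 0).
have [_ H] := cL1Z M%:C cL1_q; apply: le_lt_trans H; apply: ge0_le_integral => //.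
- by move=> x _; rewrite lee_fin sqr_ge0.
- exact: msqr.
- by apply: mnormc; apply: cmeasM => //; exact: cmeas_cst.
- move=> x _; rewrite lee_fin normcM normc_real ger0_norm// expr2.
  by rewrite ler_wpM2r ?normc_ge0.
Qed.

(** The formula with [vv] contributes [level s]. In the one with [uu], [q] and its conjugate
    exchange roles and the signs fall on two factors instead of one, which gives [(-1) ^+ s] times
    the conjugate of [level s]. The constant is fixed before [lambda]. *)
Lemma b4_expansion N : exists C : R, 0 <= C /\ forall lambda : R[i], 0 < Im (lambda ^+ 2) ->
  let zeta := 'i%C / (2 * lambda ^+ 2) in normc zeta <= 1 ->
  normc (b4 q lambda - (- (lambda ^+ 4) / 2) *
    \sum_(s < N) zeta ^+ s.+3 * (level s + (-1) ^+ s * conjc (level s))) <=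
  C * normc lambda ^+ 4 * normc zeta ^+ N.+3.
Proof.
have [K [K0 HK]] := fg_expansion N.
pose n1 := fine (nint mu q).
have n10 : 0 <= n1 by rewrite fine_ge0// nint_ge0.
pose C := N.+1%:R ^+ 3 * K ^+ 3 * n1.
have C0 : 0 <= C by exact: mulr_ge0 (mulr_ge0 (exprn_ge0 _ (ler0n _ _)) (exprn_ge0 _ K0)) n10.
exists C; split=> // lambda l0 zeta z1.
have [Hf Hg] := HK _ l0.
have q2 := L2_schwartz; have q1 := cL1_q.
set z := lambda ^+ 2 in l0 Hf Hg.
pose f := after z q; pose g := before z (fun x => conjc (q x)).
have sg k : cmeas (fun x : RT => (-1) ^+ k * pc k x).
  by apply: cmeas_sign; apply: cmeas_conjc; exact: cmeas_cderiven.
have V1 : cL1 mu (fun x => conjc (q x) * (g x * f x * f x)).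
  apply: (eq_cL1 _ (cL1_fgM q2 l0 (cL1_vv q2 l0))) => x.
  by rewrite /vv /fg -/(f x) -/(g x); move: (conjc (q x)) (f x) (g x) => a b c; ring.
have U1 : cL1 mu (fun x => q x * (f x * g x * g x)).
  apply: (eq_cL1 _ (cL1_fgM q2 l0 (cL1_uu q2 l0))) => x.
  by rewrite /uu /fg -/(f x) -/(g x); move: (q x) (f x) (g x) => a b c; ring.
have TV i j k : cL1 mu (fun x => conjc (q x) * ((-1) ^+ i * pc i x * p j x * p k x)).
  apply: cL1_cubic; [exact: cL1_conjc|exact: sg|exact: cmeas_cderiven|exact: cmeas_cderiven| | |].
  - exact: sign_bounded.
  - exact: cderiven_bounded.
  - exact: cderiven_bounded.
have TU i j k : cL1 mu (fun x => q x * (p i x * ((-1) ^+ j * pc j x) * ((-1) ^+ k * pc k x))).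
  apply: cL1_cubic; [exact: cL1_q|exact: cmeas_cderiven|exact: sg|exact: sg| | |].
  - exact: cderiven_bounded.
  - exact: sign_bounded.
  - exact: sign_bounded.
have EV := cint_expansion K0 z1 (cL1_conjc q1) TV V1 Hg Hf Hf.
have EU := cint_expansion K0 z1 q1 TU U1 Hf Hg Hg.
have n1c : fine (nint mu (fun x => conjc (q x))) = n1 by rewrite nint_conjc.
rewrite n1c -/C in EV; rewrite -/n1 -/C in EU.
have SV : \sum_(s < N) \sum_(i < s.+1) \sum_(j < s.+1) \sum_(k < s.+1 | (i + j + k == s)%N)
      zeta ^+ s.+3 * cint mu (fun x => conjc (q x) * ((-1) ^+ i * pc i x * p j x * p k x)) =
    \sum_(s < N) zeta ^+ s.+3 * level s.
  apply: eq_bigr => s _; rewrite /level big_distrr /=; apply: eq_bigr => i _.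
  rewrite big_distrr /=; apply: eq_bigr => j _; rewrite big_distrr /=; apply: eq_bigr => k _.
  congr (_ * _); rewrite /moment -(cintZ _ (cL1_moment i j k)); apply: eq_cint => x.
  rewrite conjcM -/(pc i x) -/(p j x) -/(p k x).
  by move: (conjc (q x)) (pc i x) (p j x) (p k x) ((-1) ^+ i) => a b c d e; ring.
have SU : \sum_(s < N) \sum_(i < s.+1) \sum_(j < s.+1) \sum_(k < s.+1 | (i + j + k == s)%N)
      zeta ^+ s.+3 * cint mu (fun x => q x * (p i x * ((-1) ^+ j * pc j x) * ((-1) ^+ k * pc k x))) =
    \sum_(s < N) zeta ^+ s.+3 * ((-1) ^+ s * conjc (level s)).
  apply: eq_bigr => s _; rewrite /level rmorph_sum !big_distrr /=; apply: eq_bigr => i _.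
  rewrite rmorph_sum !big_distrr /=; apply: eq_bigr => j _.
  rewrite rmorph_sum !big_distrr /=; apply: eq_bigr => k /eqP E.
  congr (_ * _); rewrite /moment conjcM -cint_conjc; last exact: cL1_moment.
  have -> : conjc ((-1) ^+ i : R[i]) = (-1) ^+ i by rewrite conjcX conjcN conjc1.
  rewrite mulrA -exprD -(cintZ _ (cL1_conjc (cL1_moment i j k))); apply: eq_cint => x.
  have -> : (-1) ^+ (s + i) = (-1) ^+ j * (-1) ^+ k :> R[i].
    exact: sign_level E.
  rewrite !conjcM !conjcC -/(pc j x) -/(pc k x) -/(p i x).
  by move: (q x) (p i x) (pc j x) (pc k x) ((-1) ^+ j) ((-1) ^+ k) => a b c d e h; ring.
rewrite SV in EV; rewrite SU in EU.
set IV := cint mu _ in EV; set IU := cint mu _ in EU.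
have bV : b4 q lambda = - lambda ^+ 4 * IV.
  have -> : IV = cint mu (fun x => vv q z x * fg q z x); last exact: b4_vv q2 l0.
  apply: eq_cint => x.
  by rewrite /vv /fg -/(f x) -/(g x); move: (conjc (q x)) (f x) (g x) => a b c; ring.
have bU : b4 q lambda = - lambda ^+ 4 * IU.
  have -> : IU = cint mu (fun x => uu q z x * fg q z x); last exact: b4_uu q2 l0.
  apply: eq_cint => x.
  by rewrite /uu /fg -/(f x) -/(g x); move: (q x) (f x) (g x) => a b c; ring.
set X := \sum_(s < N) _ in EV; set Y := \sum_(s < N) _ in EU.
have -> : \sum_(s < N) zeta ^+ s.+3 * (level s + (-1) ^+ s * conjc (level s)) = X + Y.
  by rewrite -big_split; apply: eq_bigr => s _; rewrite mulrDr.
have two : (2%:R : R[i]) != 0 by rewrite -normc_eq0 normc_nat pnatr_eq0.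
have -> : b4 q lambda - - lambda ^+ 4 / 2 * (X + Y) =
    (- lambda ^+ 4 / 2) * ((IV - X) + (IU - Y)).
  have -> : b4 q lambda = - lambda ^+ 4 / 2 * (IV + IU).
    have -> : b4 q lambda = (b4 q lambda + b4 q lambda) / 2.
      by move: (b4 q lambda) => b; field.
    by rewrite {1}bV bU; clear bV bU EV EU; move: (lambda ^+ 4) IV IU => a b c; field.
  by clear bV bU EV EU; move: (lambda ^+ 4) IV IU X Y => a b c d e; ring.
rewrite normcM normcM normc_opp normcX normcV normc_nat.
exact: le_half_sum (exprn_ge0 _ (normc_ge0 _)) EV EU (normcD_le _ _).
Qed.

End Asymptotics.

(** * Coefficients of the asymptotic series *)

Section Coefficients.
Variables (R : realType) (q : R -> R[i]).

Lemma Re_twice (w : R[i]) : w + conjc w = 2 * (Re w)%:C.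
Proof. by apply: complex_eq; case: w => a b /=; ring. Qed.

Lemma H4_level s : (H4 q s.+2)%:C = - (Re ('i%C ^+ s.+2 * level q s))%:C.
Proof. by rewrite /H4 subn2 /= complexN. Qed.

(** The conjugate of ['i%C ^+ s.+2] is [(-1) ^+ s] times itself, so multiplying by this power, taken
    out of [zeta ^+ s.+3], makes the two contributions conjugate to each other. The remaining ['i%C]
    is the prefactor of the series. *)
Lemma coefficientE (lambda : R[i]) s : lambda != 0 ->
  - lambda ^+ 4 / 2 * (('i%C / (2 * lambda ^+ 2)) ^+ s.+3 *
    (level q s + (-1) ^+ s * conjc (level q s))) =
  'i%C * (H4 q s.+2)%:C / 2 ^+ s.+3 * lambda ^ (2%:Z - (2 * s.+2)%:Z).
Proof.
move=> l0; rewrite H4_level.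
have -> : lambda ^ (2%:Z - (2 * s.+2)%:Z) = lambda ^+ 4 / (lambda ^+ 2) ^+ s.+3.
  have -> : 2%:Z - (2 * s.+2)%:Z = 4%:Z - (2 * s.+3)%:Z by rewrite !mulnS !PoszD; ring.
  by rewrite expfzDr// -exprnN exprM.
have two : (2%:R : R[i]) != 0 by rewrite -normc_eq0 normc_nat pnatr_eq0.
have W : 'i%C ^+ s.+2 * (level q s + (-1) ^+ s * conjc (level q s)) =
    2 * (Re ('i%C ^+ s.+2 * level q s))%:C.
  rewrite -Re_twice conjcM conjcX mulrDr mulrA; congr (_ + _ * _).
  have -> : conjc 'i%C = - 'i%C :> R[i] by apply: complex_eq; rewrite /= ?oppr0.
  by rewrite -[X in _ = X ^+ _]mulN1r exprMn mulrC; congr (_ * _); rewrite !exprS; ring.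
have -> : ('i%C / (2 * lambda ^+ 2)) ^+ s.+3 =
    'i%C * 'i%C ^+ s.+2 / (2 ^+ s.+3 * (lambda ^+ 2) ^+ s.+3).
  by rewrite expr_div_n exprMn -exprS.
have l2 : lambda ^+ 2 != 0 by rewrite expf_neq0.
have := expf_neq0 s.+3 l2; have := expf_neq0 s.+3 two.
move: W; move: ('i%C ^+ s.+2) (level q s + _) (Re _)%:C ((lambda ^+ 2) ^+ _) (2 ^+ _) => I S r L T W T0 L0.
have -> : - lambda ^+ 4 / 2 * ('i%C * I / (T * L) * S) = - lambda ^+ 4 / 2 * 'i%C / (T * L) * (I * S).
  by ring.
by rewrite W; field; rewrite L0 T0.
Qed.

End Coefficients.

Theorem lemma7p1 (R : realType) (q : R -> R[i]) (hq : L2 q) :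
  (forall lambda : R[i], 0 < Im (lambda ^+ 2) ->
    b4 q lambda =
    'i%C / (2 * pi%:C) *
    cintegral
      (@lebesgue_measure R \x @lebesgue_measure R \x @lebesgue_measure R)%E
      setT
      (fun '(xi1, eta1, eta2) =>
         let xi2 := eta1 + eta2 - xi1 in
         lambda ^+ 4 /
           ((2 * lambda ^+ 2 + xi1%:C) * (2 * lambda ^+ 2 + eta1%:C) *
            (2 * lambda ^+ 2 + eta2%:C)) *
         (Re (fourier q eta1 * fourier q eta2 *
              conjc (fourier q xi1) * conjc (fourier q xi2)))%:C))
  /\
  (schwartz q ->
    asymptotic_series [set lambda : R[i] | 0 < Im (lambda ^+ 2)] (b4 q) 2
      (fun j => 'i%C * (H4 q j)%:C / 2 ^+ j.+1)
      (fun j lambda => lambda ^ (2%:Z - (2 * j)%:Z))).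
Proof.
split; first by move=> lambda; exact: b4_fourier.
(* With [n = N.+1] the partial sum runs over [j = s.+2] with [s < N], so [b4_expansion] is used at
   order [N]. *)
move=> hs [//|N] N1 e e0.
have [C [C0 HC]] := b4_expansion hs N.
(* Beyond [1] one has [normc zeta <= 1]; beyond [C / e] the constant [C] is below
   [e * normc lambda], hence below [e * normc lambda ^+ 2]. *)
exists (Num.max 1 (C / e)) => lambda l0; rewrite gt_max => /andP[l1 lC].
have lp : 0 < normc lambda by exact: lt_trans ltr01 l1.
have ln0 : lambda != 0 by rewrite -normc_gt0.
set zeta := 'i%C / (2 * lambda ^+ 2) in HC.
have zE : normc zeta = (2 * normc lambda ^+ 2)^-1.
  by rewrite normcM normc_i mul1r normcV normcM normc_nat normcX.
have l2 : 1 <= normc lambda ^+ 2 by rewrite exprn_ege1// ltW.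
have z1 : normc zeta <= (normc lambda ^+ 2)^-1.
  rewrite zE lef_pV2 ?posrE ?mulr_gt0 ?exprn_gt0//.
  by rewrite ler_peMl ?exprn_ge0 ?ltW// ltr1n.
have zle1 : normc zeta <= 1 by apply: le_trans z1 _; rewrite invf_le1 ?exprn_gt0.
have := HC lambda l0 zle1.
have -> : - lambda ^+ 4 / 2 * \sum_(s < N) zeta ^+ s.+3 * (level q s + (-1) ^+ s * conjc (level q s)) =
    \sum_(2 <= j < N.+2) 'i%C * (H4 q j)%:C / 2 ^+ j.+1 * lambda ^ (2%:Z - (2 * j)%:Z).
  rewrite [RHS](big_addn 0 N.+2 2) subn2 /= big_mkord big_distrr /=; apply: eq_bigr => s _.
  by rewrite addn2; exact: coefficientE.
move=> H; apply: (le_trans H) => {H}.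
(* The last retained power has modulus [normc lambda] to the [- 2 N], and the error is of order
   [- 2 N - 2]; this gap of two powers is the gain. The exponent [N.+3] is kept for comparison with
   [zeta]. *)
have -> : lambda ^ (2%:Z - (2 * N.+1)%:Z) = lambda ^+ 6 / (lambda ^+ 2) ^+ N.+3.
  have -> : 2%:Z - (2 * N.+1)%:Z = 6%:Z - (2 * N.+3)%:Z by rewrite !mulnS !PoszD; ring.
  by rewrite expfzDr// -exprnN exprM.
have -> : normc (lambda ^+ 6 / (lambda ^+ 2) ^+ N.+3) =
    normc lambda ^+ 4 * normc lambda ^+ 2 * (normc lambda ^+ 2)^-1 ^+ N.+3.
  by rewrite normcM normcV !normcX exprVn -exprD.
apply: (@le_trans _ _ (C * normc lambda ^+ 4 * (normc lambda ^+ 2)^-1 ^+ N.+3)).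
  apply: ler_wpM2l; first exact: mulr_ge0 C0 (exprn_ge0 _ (ltW lp)).
  by apply: lerXn2r z1; rewrite nnegrE ?normc_ge0// invr_ge0 exprn_ge0// ltW.
rewrite [leRHS]mulrA; apply: ler_wpM2r; first by rewrite exprn_ge0// invr_ge0 exprn_ge0// ltW.
rewrite [leRHS]mulrCA [leLHS]mulrC; apply: ler_wpM2l; first by rewrite exprn_ge0// ltW.
rewrite [leRHS]mulrC -ler_pdivrMr//; apply: le_trans (ltW lC) _.
by rewrite expr2 ler_peMl ?ltW.
Qed.
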